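(* There is a data structure representing a simple undirected graph $G=(V,E)$ that supports the following three operations: (1) answer a minimum cluster vertex deletion of the current graph $G$; (2) add an edge to $G$; (3) remove an edge from $G$. The time complexity of an edge addition or removal is $O(k^8+k^2\log |V|)$, and the time complexity of a query is $O(f(k^5,k))$, where $k$ is the cluster vertex deletion number of $G$ and $f(m,k)$ denotes the time complexity of any static algorithm solving Cluster Vertex Deletion on a graph of size $m$ with cluster vertex deletion number $k$.
   Context: A graph is a cluster graph if every connected component is a clique (equivalently, it has no induced path on three vertices). A set $X\subseteq V$ is a cluster vertex deletion of $G$ if $G[V\setminus X]$ is a cluster graph; Cluster Vertex Deletion asks for a minimum one, and its size is the cluster vertex deletion (cvd) number. The size of a graph is $|V|+|E|$. Convention: when an operation changes the graph from $G$ to $G'$, the parameter used is $k=\max\{k(G),k(G')\}$, where $k(\cdot)$ is the cvd number. *)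

(* Defs.v *)
From mathcomp Require Import all_boot.

Set Implicit Arguments.
Unset Strict Implicit.
Unset Printing Implicit Defensive.

Definition simple_graph (T : finType) (e : rel T) : Prop :=
  symmetric e /\ irreflexive e.

Definition edgeless (T : finType) : rel T := [rel x y | false].

Definition add_edge (T : finType) (e : rel T) (u v : T) : rel T :=
  [rel x y | [|| e x y, (x == u) && (y == v) | (x == v) && (y == u)]].

Definition remove_edge (T : finType) (e : rel T) (u v : T) : rel T :=
  [rel x y | [&& e x y, ~~ ((x == u) && (y == v)) & ~~ ((x == v) && (y == u))]].

Definition graph_size (n : nat) (e : rel 'I_n) : nat :=
  n + #|[set p : 'I_n * 'I_n | (p.1 < p.2) && e p.1 p.2]|.

Definition induced (T : finType) (e : rel T) (S : {set T}) : rel T :=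
  [rel x y | [&& x \in S, y \in S & e x y]].

(** Every connected component of the subgraph induced by [S] is a clique. *)
Definition cluster_on (T : finType) (e : rel T) (S : {set T}) : bool :=
  [forall x in S, forall y in S,
     (x != y) && connect (induced e S) x y ==> e x y].

Definition is_cvd (T : finType) (e : rel T) (X : {set T}) : bool :=
  cluster_on e (~: X).

Definition is_min_cvd (T : finType) (e : rel T) (X : {set T}) : Prop :=
  is_cvd e X /\ forall Y : {set T}, is_cvd e Y -> #|X| <= #|Y|.

(** [setT] is always a cluster vertex deletion, so the default is legitimate. *)
Definition cvd_number (T : finType) (e : rel T) : nat :=
  #|[arg min_(X < [set: T] | is_cvd e X) #|X| ]|.

(** A word RAM. A program is a finite syntactic object over registers [0, 1, 2, ...] and a
    memory addressed by natural numbers. Each instruction and each test costs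
    one time unit. The parameter [B] of [exec] is the largest number that fits
    in a machine word: an instruction computing a larger value has no
    execution, and only the cells [0..B] are addressable. The bound [B] is
    always taken polynomial in the size of the problem (and in the running time
    allotted to solving the static problem), i.e. words have logarithmically
    many bits. *)

Record state := State { reg : nat -> nat; mem : nat -> nat }.

Definition set_reg (s : state) (x a : nat) : state :=
  State [eta reg s with x |-> a] (mem s).

Definition set_mem (s : state) (i a : nat) : state :=
  State (reg s) [eta mem s with i |-> a].

Inductive binop := Add | Sub | Mul | Div | Mod | Eq | Lt.

(** Subtraction is truncated, division by [0] yields [0], and [a] modulo [0]
    is [a]. *)
Definition eval_op (o : binop) (a b : nat) : nat :=
  match o with
  | Add => a + b
  | Sub => a - b
  | Mul => a * b
  | Div => a %/ b
  | Mod => a %% b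
  | Eq => a == b
  | Lt => a < b
  end.

Inductive cmd :=
  | Skip
  | Const (x a : nat)                 (* x := a *)
  | Op (x : nat) (o : binop) (y z : nat)   (* x := y o z *)
  | Read (x y : nat)                  (* x := mem[y] *)
  | Write (x y : nat)                 (* mem[x] := y *)
  | Seq (p q : cmd)
  | If (x : nat) (p q : cmd)          (* nonzero means true *)
  | While (x : nat) (p : cmd).

(** [exec B p s t s']: with word bound [B], program [p] started in [s] halts in
    [s'] after exactly [t] time units. *)
Inductive exec (B : nat) : cmd -> state -> nat -> state -> Prop :=
  | ExecSkip s : exec B Skip s 1 s
  | ExecConst s x a of a <= B : exec B (Const x a) s 1 (set_reg s x a)
  | ExecOp s x o y z of eval_op o (reg s y) (reg s z) <= B :
      exec B (Op x o y z) s 1 (set_reg s x (eval_op o (reg s y) (reg s z)))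
  | ExecRead s x y of reg s y <= B :
      exec B (Read x y) s 1 (set_reg s x (mem s (reg s y)))
  | ExecWrite s x y of reg s x <= B :
      exec B (Write x y) s 1 (set_mem s (reg s x) (reg s y))
  | ExecSeq p q s1 s2 s3 t1 t2 of exec B p s1 t1 s2 & exec B q s2 t2 s3 :
      exec B (Seq p q) s1 (t1 + t2) s3
  | ExecIfTrue x p q s t s' of reg s x != 0 & exec B p s t s' :
      exec B (If x p q) s t.+1 s'
  | ExecIfFalse x p q s t s' of reg s x == 0 & exec B q s t s' :
      exec B (If x p q) s t.+1 s'
  | ExecWhileStop x p s of reg s x == 0 : exec B (While x p) s 1 s
  | ExecWhileStep x p s1 s2 s3 t1 t2
      of reg s1 x != 0 & exec B p s1 t1 s2 & exec B (While x p) s2 t2 s3 :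
      exec B (While x p) s1 (t1 + t2).+1 s3.

(** Register [0] holds [n]; everything else is zero. *)
Definition init_state (n : nat) : state :=
  set_reg (State (fun=> 0) (fun=> 0)) 0 n.

(** The arguments of an update are passed in registers [0] and [1]. *)
Definition with_args (n : nat) (u v : 'I_n) (s : state) : state :=
  set_reg (set_reg s 0 u) 1 v.

(** Each edge occurs exactly once, in one of its two orientations. *)
Definition edge_list (n : nat) (e : rel 'I_n) (es : seq ('I_n * 'I_n)) : Prop :=
  [/\ uniq es,
      forall u v, (u, v) \in es -> (v, u) \notin es &
      forall u v, e u v = ((u, v) \in es) || ((v, u) \in es)].

(** The memory starts with the number of vertices, the number of edges, and the
    endpoints of the edges in the order of [es]; everything else is zero. *)
Definition input_state (n : nat) (es : seq ('I_n * 'I_n)) : state :=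
  State (fun=> 0)
        (nth 0 [:: n, size es & flatten [seq [:: val p.1; val p.2] | p <- es]]).

(** Register [0] holds the number of vertices in the answer, and register [1]
    the address of an array listing them without repetition. *)
Definition outputs (n : nat) (s : state) (X : {set 'I_n}) : Prop :=
  perm_eq [seq mem s (reg s 1 + i) | i <- iota 0 (reg s 0)]
          [seq val x | x <- enum X].

Definition answers_cvd (n : nat) (e : rel 'I_n) (s : state) : Prop :=
  exists X : {set 'I_n}, outputs s X /\ is_min_cvd e X.

(** [A] solves Cluster Vertex Deletion, and [f m k] bounds its worst-case
    running time over the graphs of size at most [m] and cluster vertex
    deletion number at most [k]. The word bound is polynomial in the input size
    and the time bound, so that words can address all the space that [A] uses. *)
Definition static_cvd_algorithm (A : cmd) (f : nat -> nat -> nat) : Prop :=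
  exists c : nat,
  forall (n : nat) (e : rel 'I_n) (es : seq ('I_n * 'I_n)) (m k : nat),
    simple_graph e -> edge_list e es ->
    graph_size e <= m -> cvd_number e <= k ->
    exists (t : nat) (s : state),
      [/\ exec ((graph_size e + f m k + 2) ^ c) A (input_state es) t s,
          t <= f m k & answers_cvd e s].

(** [k ^ 8 + k ^ 2 * log n] for [k] the larger of the two cluster vertex
    deletion numbers. As usual for bounds inside an O, the parameter is read as
    at least [1]: the expression vanishes at [k = 0], and no program runs in
    zero time. *)
Definition update_bound (n : nat) (e e' : rel 'I_n) : nat :=
  let k := maxn 1 (maxn (cvd_number e) (cvd_number e')) in
  k ^ 8 + k ^ 2 * trunc_log 2 n.

Definition performs_update (n c C : nat) (p : cmd) (u v : 'I_n)
    (e e' : rel 'I_n) (repr : rel 'I_n -> state -> Prop) (s : state) : Prop :=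
  exists (t : nat) (s' : state),
    [/\ exec ((n + 2) ^ c) p (with_args u v s) t s',
        t <= C * update_bound e e' & repr e' s'].

(* Main.v *)
(* The state keeps a set [X] such that [G - X] is a cluster graph and [|X| <= 3 cvd(G)]. Each
   [x] in [X] has a default cluster, and [E(x)] consists of the vertices outside [X] whose
   adjacency to [x] is not the one the default predicts. These sets, and the complement of [X],
   are stored in trees counting the vertices by cluster, so that a vertex enters or leaves
   [X] in time [O(|X| log n)].

   An update puts both endpoints into [X] and changes the edge. Then every vertex of [X]
   either leaves [X], or is the end or the middle of an induced path whose other two vertices
   then enter [X]; these paths are disjoint, which restores [|X| <= 3 cvd(G)]. A vertex [x] of [X]
   for which no default leaves at most [|X|] exceptions belongs to every deletion set of size at most
   [|X|], hence is forced. The kernel consists of the other (light) [x], of the sets [E(x)], and,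
   for each light [x] and each of its at most [|X| + 1] relevant clusters, of three more vertices
   of the cluster. A vertex outside the kernel that lies on an induced path has in the kernel more
   true twins than these have other neighbours there, so a minimum solution of the kernel together
   with the forced vertices solves [G]. The kernel graph has size [O(k^4)], hence at most [k^5]
   unless [k] is bounded.

   A query runs the static algorithm on the stored kernel, logging its writes in order to undo
   them. Copying the answer takes [O(k)] time, and [k = O(f(k^5, k))] since on disjoint claws
   the algorithm has to write down an answer that does not occur in its input. *)

Require Import Defs.
From mathcomp Require Import all_boot.
From mathcomp Require Import zify.

Set Implicit Arguments.
Unset Strict Implicit.
Unset Printing Implicit Defensive.

(** * A While language with arrays *)

(** The obstacle is that nothing in an update or a query may take time linear in [n]. Hence the
    adjacency matrix and the rows of trees are arrays in a memory that starts at zero, scattered by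
    a pairing function; emptied subtrees are left stale, scratch entries are cleared one by one, and
    the static algorithm, which may rely on zero memory, must find it so at each query. Its
    registers are known only after the representation has been fixed, which therefore says nothing
    about registers from [64] on. Lightness is measured against [|X|] because a deletion set of that
    size can absorb at most [|X|] exceptions. Three vertices are taken per request because, if the
    light vertices have total weight [t > 0] at a cluster, up to [t] of the [3 * t] requested
    vertices may be exceptions, and the twins left must outnumber at most [t] other neighbours. The
    kernel has [O(k ^ 2)] vertices, so testing all pairs costs [O(k ^ 4)], well below [k ^ 8]. The
    logarithm is the depth of the trees, in which an update makes [O(k ^ 2)] walks. *)

Inductive expr :=
  | EVar (r : nat)
  | ECst (a : nat)
  | EBin (o : binop) (e1 e2 : expr)
  | ELd (a : nat) (e1 e2 : expr).

Inductive stm :=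
  | Nop
  | Asg (r : nat) (e : expr)
  | Sto (a : nat) (e1 e2 e3 : expr)
  | Raw (e1 e2 : expr)
  | Sq (p q : stm)
  | Ite (e : expr) (p q : stm)
  | Whl (e : expr) (p : stm).

Definition upd (A : Type) (f : nat -> A) (x : nat) (a : A) : nat -> A :=
  fun y => if y == x then a else f y.

Lemma updE (A : Type) (f : nat -> A) x a : upd f x a x = a.
Proof. by rewrite /upd eqxx. Qed.

Lemma updN (A : Type) (f : nat -> A) x a y : y != x -> upd f x a y = f y.
Proof. by rewrite /upd => /negbTE->. Qed.

(** [rw] is the memory at the cells that no array uses. Expressions cannot read it; it exists
    because an answer must occupy consecutive cells, whereas the rows of the arrays are
    scattered. *)
Record hst := Hst { rg : nat -> nat; ar : nat -> nat -> nat -> nat; rw : nat -> nat }.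

Definition setr h x a := Hst (upd (rg h) x a) (ar h) (rw h).
Definition seta h a i j v :=
  Hst (rg h) (upd (ar h) a (upd (ar h a) i (upd (ar h a i) j v))) (rw h).
Definition setw h p v := Hst (rg h) (ar h) (upd (rw h) p v).

Fixpoint ev (h : hst) (e : expr) : nat :=
  match e with
  | EVar r => rg h r
  | ECst a => a
  | EBin o e1 e2 => eval_op o (ev h e1) (ev h e2)
  | ELd a e1 e2 => ar h a (ev h e1) (ev h e2)
  end.

(* [i <= i + j], so the pairing [(i + j) ^ 2 + i] is injective; it misses the
   numbers strictly between [s ^ 2 + s] and [(s + 1) ^ 2]. *)
Definition addr (a i j : nat) := 16 * ((i + j) * (i + j) + i) + a.

Definition gap (p : nat) := forall a i j, a < 16 -> addr a i j != p.

(** Only values stored in registers and arrays are bounded by [V]. Intermediate results may exceed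
    it: they are polynomial in [V], of a degree read off the expression, and the word bound of the
    compiled program makes room for them. [Raw] is unrestricted because [rw] is never read back. *)
Inductive hexec (V : nat) : stm -> hst -> nat -> hst -> Prop :=
  | HNop h : hexec V Nop h 1 h
  | HAsg h r e of ev h e <= V : hexec V (Asg r e) h 1 (setr h r (ev h e))
  | HSto h a e1 e2 e3 of ev h e3 <= V :
      hexec V (Sto a e1 e2 e3) h 1 (seta h a (ev h e1) (ev h e2) (ev h e3))
  | HRaw h e1 e2 of gap (ev h e1) :
      hexec V (Raw e1 e2) h 1 (setw h (ev h e1) (ev h e2))
  | HSq p q h1 h2 h3 t1 t2 of hexec V p h1 t1 h2 & hexec V q h2 t2 h3 :
      hexec V (Sq p q) h1 (t1 + t2) h3
  | HIteT e p q h t h' of ev h e != 0 & hexec V p h t h' :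
      hexec V (Ite e p q) h t.+1 h'
  | HIteF e p q h t h' of ev h e == 0 & hexec V q h t h' :
      hexec V (Ite e p q) h t.+1 h'
  | HWhlF e p h of ev h e == 0 : hexec V (Whl e p) h 1 h
  | HWhlT e p h1 h2 h3 t1 t2 of ev h1 e != 0 & hexec V p h1 t1 h2 &
      hexec V (Whl e p) h2 t2 h3 : hexec V (Whl e p) h1 (t1 + t2).+1 h3.

Definition bdd (V : nat) (h : hst) :=
  (forall r, rg h r <= V) /\ (forall a i j, ar h a i j <= V).

Lemma hexec_bdd V p h t h' : hexec V p h t h' -> bdd V h -> bdd V h'.
Proof.
elim=> //=; try by eauto.
- move=> {}h r e le [H1 H2]; split=> // r'; rewrite /= /upd.
  by case: eqP.
- move=> {}h a e1 e2 e3 le [H1 H2]; split=> // a' i j; rewrite /= /upd.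
  do 3!(case: eqP => ? //; subst).
Qed.

Fixpoint rmods p : seq nat :=
  match p with
  | Nop | Sto _ _ _ _ | Raw _ _ => [::]
  | Asg r _ => [:: r]
  | Sq p q | Ite _ p q => rmods p ++ rmods q
  | Whl _ p => rmods p
  end.

Fixpoint amods p : seq nat :=
  match p with
  | Nop | Asg _ _ | Raw _ _ => [::]
  | Sto a _ _ _ => [:: a]
  | Sq p q | Ite _ p q => amods p ++ amods q
  | Whl _ p => amods p
  end.

Definition frame (rs as_ : seq nat) (h h' : hst) :=
  (forall r, r \notin rs -> rg h' r = rg h r) /\
  (forall a, a \notin as_ -> ar h' a = ar h a).

Lemma frame_refl rs as_ h : frame rs as_ h h.
Proof. by []. Qed.

Lemma frame_trans rs as_ h1 h2 h3 :
  frame rs as_ h1 h2 -> frame rs as_ h2 h3 -> frame rs as_ h1 h3.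
Proof.
by move=> [A1 A2] [B1 B2]; split=> x nx; rewrite ?B1 ?B2 ?A1 ?A2.
Qed.

Lemma frame_sub rs as_ rs' as' h h' :
  {subset rs <= rs'} -> {subset as_ <= as'} ->
  frame rs as_ h h' -> frame rs' as' h h'.
Proof.
by move=> S1 S2 [A1 A2]; split=> x nx; rewrite ?A1 ?A2 //; apply: contra nx; auto.
Qed.

(** Frames are computed from the program text, so a specification states only what its program
    achieves; that the other registers and arrays are kept follows by evaluating [rmods] and
    [amods]. *)
Lemma hexec_frame V p h t h' : hexec V p h t h' -> frame (rmods p) (amods p) h h'.
Proof.
have catl s1 s2 : {subset s1 <= s1 ++ s2 :> seq nat}.
  by move=> x; rewrite mem_cat => ->.
have catr s1 s2 : {subset s2 <= s1 ++ s2 :> seq nat}.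
  by move=> x; rewrite mem_cat orbC => ->.
elim=> //=.
- by move=> {}h r e _; split=> // x; rewrite inE /= => nx; rewrite updN.
- by move=> {}h a e1 e2 e3 _; split=> // x; rewrite inE /= => nx; rewrite updN.
- move=> {}p q h1 h2 h3 t1 t2 _ F1 _ F2.
  apply: frame_trans (frame_sub _ _ F1) (frame_sub _ _ F2); auto.
- move=> e {}p q {}h {}t {}h' _ _ F; apply: frame_sub F; auto.
- move=> e {}p q {}h {}t {}h' _ _ F; apply: frame_sub F; auto.
- by move=> e {}p h1 h2 h3 t1 t2 _ _ F1 _ F2; apply: frame_trans F1 F2.
Qed.

Fixpoint hsz p : nat :=
  match p with
  | Nop | Sto _ _ _ _ | Raw _ _ | Asg _ _ => 1
  | Sq p q => hsz p + hsz q
  | Ite _ p q => (hsz p + hsz q).+1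
  | Whl _ p => (hsz p).+1
  end.

(* Time is counted in multiples of the size of the program, so that only loops
   contribute to [M]. *)
Definition R V M p h (Q : hst -> Prop) :=
  exists t h', [/\ hexec V p h t h', t <= hsz p * M.+1 & Q h'].

Lemma R_mono V M M' p h Q Q' : M <= M' -> R V M p h Q ->
  (forall h', frame (rmods p) (amods p) h h' -> Q h' -> Q' h') -> R V M' p h Q'.
Proof.
move=> le [t [h' [ex le_t q]]] imp; exists t, h'; split=> //.
  by apply: leq_trans le_t _; rewrite leq_mul2l ltnS le orbT.
by apply: imp q; apply: hexec_frame ex.
Qed.

Lemma R_call V M p h Q Q' : R V M p h Q ->
  (forall h', frame (rmods p) (amods p) h h' -> Q h' -> Q' h') -> R V M p h Q'.
Proof. exact: R_mono. Qed.

Lemma R_nop V M h (Q : hst -> Prop) : Q h -> R V M Nop h Q.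
Proof. by move=> q; exists 1, h; split=> //; exact: HNop. Qed.

Lemma R_asg V M r e h (Q : hst -> Prop) :
  ev h e <= V -> Q (setr h r (ev h e)) -> R V M (Asg r e) h Q.
Proof. by move=> le q; exists 1; eexists; split; [exact: HAsg| |exact: q]. Qed.

Lemma R_sto V M a e1 e2 e3 h (Q : hst -> Prop) :
  ev h e3 <= V -> Q (seta h a (ev h e1) (ev h e2) (ev h e3)) ->
  R V M (Sto a e1 e2 e3) h Q.
Proof. by move=> le q; exists 1; eexists; split; [exact: HSto| |exact: q]. Qed.

Lemma R_raw V M e1 e2 h (Q : hst -> Prop) :
  gap (ev h e1) -> Q (setw h (ev h e1) (ev h e2)) -> R V M (Raw e1 e2) h Q.
Proof. by move=> le q; exists 1; eexists; split; [exact: HRaw| |exact: q]. Qed.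

Lemma R_seq V M p q h Q : R V M p h (fun h1 => R V M q h1 Q) -> R V M (Sq p q) h Q.
Proof.
move=> [t1 [h1 [e1 l1 [t2 [h2 [e2 l2 H]]]]]]; exists (t1 + t2), h2; split=> //.
  exact: HSq e1 e2.
by rewrite /= mulnDl leq_add.
Qed.

Lemma R_seqm V M M' p q h Q Q' : M' <= M -> R V M' p h Q' ->
  (forall h', frame (rmods p) (amods p) h h' -> Q' h' -> R V M q h' Q) ->
  R V M (Sq p q) h Q.
Proof. by move=> le Rp H; apply: R_seq; apply: R_mono Rp H. Qed.

Lemma R_seqa V M r e q h Q : ev h e <= V -> R V M q (setr h r (ev h e)) Q ->
  R V M (Sq (Asg r e) q) h Q.
Proof. by move=> le H; apply: R_seq; apply: R_asg. Qed.

Lemma R_seqs V M a e1 e2 e3 q h Q :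
  ev h e3 <= V -> R V M q (seta h a (ev h e1) (ev h e2) (ev h e3)) Q ->
  R V M (Sq (Sto a e1 e2 e3) q) h Q.
Proof. by move=> le H; apply: R_seq; apply: R_sto. Qed.

Lemma R_ite V M e p q h Q : (ev h e != 0 -> R V M p h Q) ->
  (ev h e == 0 -> R V M q h Q) -> R V M (Ite e p q) h Q.
Proof.
case: (boolP (ev h e == 0)) => [z _ /(_ isT)|z /(_ isT) + _].
  move=> [t [h' [ex le H]]]; exists t.+1, h'; split=> //; first exact: HIteF.
  by rewrite /= mulSn mulnDl; lia.
move=> [t [h' [ex le H]]]; exists t.+1, h'; split=> //; first exact: HIteT.
by rewrite /= mulSn mulnDl; lia.
Qed.

(** The bound [N] on the number of iterations is proved together with the step: a true test must
    give [i < N]. Costs multiply as [N.+1 * M'.+1], the successors absorbing the tests. *)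
Lemma R_whl V M M' N e p h (I : nat -> hst -> Prop) Q :
  N.+1 * M'.+1 <= M.+1 -> I 0 h ->
  (forall i h', frame (rmods p) (amods p) h h' -> I i h' -> ev h' e != 0 ->
     i < N /\ R V M' p h' (I i.+1)) ->
  (forall i h', frame (rmods p) (amods p) h h' -> I i h' -> ev h' e == 0 -> Q h') ->
  R V M (Whl e p) h Q.
Proof.
move=> leM I0 step stop.
suff H k i h' : frame (rmods p) (amods p) h h' -> I i h' -> N - i = k ->
    exists t h'', [/\ hexec V (Whl e p) h' t h'',
      t <= (N - i) * (hsz p * M'.+1).+1 + 1 & Q h''].
  have [t [h' [ex le q]]] := H _ 0 h (frame_refl _ _ _) I0 erefl.
  exists t, h'; split=> //; apply: leq_trans le _; rewrite subn0 /=.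
  apply: leq_trans (_ : (hsz p).+1 * (N.+1 * M'.+1) <= _).
    have : N <= N * M'.+1 by rewrite leq_pmulr.
    by rewrite mulSn [N.+1 * _]mulSn mulnDr mulnCA mulnS; move: (hsz p * _) => z; lia.
  by rewrite leq_mul2l leM.
elim: k i h' => [|k IH] i h' F Ii eqk.
  case: (boolP (ev h' e == 0)) => [z|nz].
    by exists 1, h'; split; [exact: HWhlF|exact: leq_addl|exact: stop F Ii z].
  by have [ltiN _] := step _ _ F Ii nz; lia.
case: (boolP (ev h' e == 0)) => [z|nz].
  by exists 1, h'; split; [exact: HWhlF|exact: leq_addl|exact: stop F Ii z].
have [ltiN [t1 [h1 [e1 l1 I1]]]] := step _ _ F Ii nz.
have [|t2 [h2 [e2 l2 q]]] := IH i.+1 h1 (frame_trans F (hexec_frame e1)) I1; first lia.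
exists (t1 + t2).+1, h2; split=> //; first exact: HWhlT e1 e2.
have ->: N - i = (N - i.+1).+1 by lia.
by rewrite mulSn -addnA addSn ltnS leq_add.
Qed.

(** * Compilation to the word RAM *)

Lemma exec_mono B B' p s t s' : B <= B' -> exec B p s t s' -> exec B' p s t s'.
Proof.
move=> le; elim=> *; try by econstructor; eauto; exact: leq_trans le.
Qed.

Section Compile.

Variable tau : nat.

(** The registers from [tau] on serve as an evaluation stack, [tau + d] receiving the result. The
    machine has no move instruction, so a copy is the addition of [0]. *)
Fixpoint cexp (e : expr) (d : nat) : cmd :=
  let x := tau + d in let y := tau + d.+1 in
  match e with
  | EVar r => Seq (Const x 0) (Op x Add r x)
  | ECst a => Const x a
  | EBin o e1 e2 => Seq (cexp e1 d) (Seq (cexp e2 d.+1) (Op x o x y))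
  | ELd a e1 e2 => Seq (cexp e1 d) (Seq (cexp e2 d.+1) (Seq (Op y Add x y)
      (Seq (Op y Mul y y) (Seq (Op x Add y x) (Seq (Const y 16) (Seq (Op x Mul y x)
      (Seq (Const y a) (Seq (Op x Add x y) (Read x x)))))))))
  end.

Definition caddr a (e1 e2 : expr) :=
  let x := tau in let y := tau.+1 in
  Seq (cexp e1 0) (Seq (cexp e2 1) (Seq (Op y Add x y)
      (Seq (Op y Mul y y) (Seq (Op x Add y x) (Seq (Const y 16) (Seq (Op x Mul y x)
      (Seq (Const y a) (Op x Add x y)))))))).

Fixpoint comp (p : stm) : cmd :=
  match p with
  | Nop => Skip
  | Asg r e => Seq (cexp e 0) (Seq (Const tau.+1 0) (Op r Add tau tau.+1))
  | Sto a e1 e2 e3 => Seq (caddr a e1 e2) (Seq (cexp e3 1) (Write tau tau.+1))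
  | Raw e1 e2 => Seq (cexp e1 0) (Seq (cexp e2 1) (Write tau tau.+1))
  | Sq p q => Seq (comp p) (comp q)
  | Ite e p q => Seq (cexp e 0) (If tau (comp p) (comp q))
  | Whl e p => Seq (cexp e 0) (While tau (Seq (comp p) (cexp e 0)))
  end.

Fixpoint ewf e :=
  match e with
  | EVar r => r < tau
  | ECst a => true
  | EBin _ e1 e2 => ewf e1 && ewf e2
  | ELd a e1 e2 => [&& a < 16, ewf e1 & ewf e2]
  end.

Fixpoint wf p :=
  match p with
  | Nop => true
  | Asg r e => (r < tau) && ewf e
  | Sto a e1 e2 e3 => [&& a < 16, ewf e1, ewf e2 & ewf e3]
  | Raw e1 e2 => ewf e1 && ewf e2
  | Sq p q => wf p && wf q
  | Ite e p q => [&& ewf e, wf p & wf q]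
  | Whl e p => ewf e && wf p
  end.

End Compile.

Definition phys tau h (s : state) :=
  [/\ forall r, r < tau -> reg s r = rg h r,
      forall a i j, a < 16 -> Defs.mem s (addr a i j) = ar h a i j &
      forall p, gap p -> Defs.mem s p = rw h p].

(** The degree of a polynomial in [V] bounding the values met during evaluation. A sum and a product
    are both bounded by the product of the bounds, and an address is quadratic in its indices. *)
Fixpoint esz e :=
  match e with
  | EVar r => 1
  | ECst a => a.+1
  | EBin _ e1 e2 => esz e1 + esz e2
  | ELd a e1 e2 => 2 * (esz e1 + esz e2) + 10
  end.

Fixpoint ecost e :=
  match e with
  | EVar r => 2
  | ECst a => 1
  | EBin _ e1 e2 => ecost e1 + ecost e2 + 1
  | ELd a e1 e2 => ecost e1 + ecost e2 + 8
  end.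

Fixpoint psz p :=
  match p with
  | Nop => 0
  | Asg r e => esz e + 1
  | Sto a e1 e2 e3 => 2 * (esz e1 + esz e2) + 10 + esz e3
  | Raw e1 e2 => esz e1 + esz e2
  | Sq p q => psz p + psz q
  | Ite e p q => esz e + psz p + psz q
  | Whl e p => esz e + psz p
  end.

Fixpoint cc p :=
  match p with
  | Nop => 1
  | Asg r e => ecost e + 2
  | Sto a e1 e2 e3 => ecost e1 + ecost e2 + 7 + ecost e3 + 1
  | Raw e1 e2 => ecost e1 + ecost e2 + 1
  | Sq p q => cc p + cc q
  | Ite e p q => ecost e + cc p + cc q + 2
  | Whl e p => ecost e + cc p + 2
  end.

Lemma addr_inj a i j a' i' j' : a < 16 -> a' < 16 ->
  addr a i j = addr a' i' j' -> [/\ a = a', i = i' & j = j'].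
Proof.
rewrite /addr => l1 l2 E.
have Ea : a = a' by lia.
have {}E : (i + j) * (i + j) + i = (i' + j') * (i' + j') + i' by lia.
have Es : i + j = i' + j' by nia.
by split; [|nia|nia].
Qed.

Section Sim.

Variables (tau B V : nat).
Notation W := (V + 2).

Lemma expW_ge2 m : 0 < m -> 2 <= W ^ m.
Proof. by case: m => // m _; rewrite expnS; have := expn_gt0 W m; nia. Qed.

Lemma esz_gt0 e : 0 < esz e.
Proof. by elim: e => //= *; lia. Qed.

Lemma leW m1 m2 : m1 <= m2 -> W ^ m1 <= W ^ m2.
Proof. by move=> le; rewrite leq_exp2l //; lia. Qed.

(** With the base [V + 2] all bounds are at least [2], and then a sum is at most the product. *)
Lemma ev_bound h e : bdd V h -> ev h e <= W ^ esz e.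
Proof.
move=> [H1 H2]; elim: e => [r|a|o e1 IH1 e2 IH2|a e1 IH1 e2 IH2] /=.
- by rewrite expn1; have := H1 r; lia.
- by apply: ltnW; apply: leq_trans (ltn_expl _ _) (leW _); lia.
- have b1 := expW_ge2 (esz_gt0 e1); have b2 := expW_ge2 (esz_gt0 e2).
  rewrite expnD; case: o => /=.
  + by nia.
  + by nia.
  + by apply: leq_mul.
  + by have := leq_div (ev h e1) (ev h e2); nia.
  + by have := leq_mod (ev h e1) (ev h e2); nia.
  + by case: eqP; nia.
  + by case: ltnP; nia.
- apply: leq_trans (_ : W ^ 1 <= _); last by apply: leW; lia.
  by rewrite expn1; have := H2 a (ev h e1) (ev h e2); lia.
Qed.

Lemma addr_bound h e1 e2 a : bdd V h -> a < 16 ->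
  addr a (ev h e1) (ev h e2) <= W ^ (2 * (esz e1 + esz e2) + 10).
Proof.
move=> Hb la; have := ev_bound e1 Hb; have := ev_bound e2 Hb.
have b1 := expW_ge2 (esz_gt0 e1); have b2 := expW_ge2 (esz_gt0 e2).
move: (ev h e1) (ev h e2) => i j; rewrite /addr.
have -> : 2 * (esz e1 + esz e2) + 10 = (esz e1 + esz e2) + (esz e1 + esz e2) + 10 by lia.
rewrite !expnD; move: (W ^ esz e1) (W ^ esz e2) b1 b2 => x y b1 b2 lj li.
have b16 : 1024 <= W ^ 10 by apply: leq_trans (_ : 2 ^ 10 <= _) => //; rewrite leq_exp2r //; lia.
have s : i + j <= x * y by nia.
have : (i + j) * (i + j) <= x * y * (x * y) by apply: leq_mul.
have : i <= x * y * (x * y) by nia.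
set z := (x * y * (x * y)) => h1 h2.
have z1 : 0 < z by rewrite !muln_gt0; lia.
by apply: leq_trans (_ : z * 1024 <= _); [lia|rewrite leq_mul2l b16 orbT].
Qed.

Lemma sim_cexp h e d s : ewf tau e -> phys tau h s -> bdd V h -> W ^ esz e <= B ->
  exists s', [/\ exec B (cexp tau e d) s (ecost e) s', Defs.mem s' = Defs.mem s,
    reg s' (tau + d) = ev h e & forall r, r < tau + d -> reg s' r = reg s r].
Proof.
move=> + + Hb; elim: e d s => [r|a|o e1 IH1 e2 IH2|a e1 IH1 e2 IH2] d s /=.
- move=> lr [Hr Hm _] leB.
  have E : eval_op Add (reg (set_reg s (tau + d) 0) r) (reg (set_reg s (tau + d) 0) (tau + d)) = rg h r.
    by rewrite /= eqxx ifN ?addn0 ?Hr //; apply/eqP; lia.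
  eexists; split; first (apply: (@ExecSeq _ _ _ _ _ _ 1 1); [exact: ExecConst|apply: ExecOp; rewrite E]).
  + by have := (ev_bound (EVar r) Hb); rewrite /= => le; apply: leq_trans leB.
  + by [].
  + by rewrite E /= eqxx.
  + by move=> r' lr'; rewrite /= !ifN //; apply/eqP; lia.
- move=> _ _ leB; eexists; split; first (apply: ExecConst).
  + by apply: leq_trans leB; have := ev_bound (ECst a) Hb.
  + by [].
  + by rewrite /= eqxx.
  + by move=> r' lr' /=; rewrite ifN //; apply/eqP; lia.
- move=> /andP[w1 w2] P leB.
  have B1 : W ^ esz e1 <= B by apply: leq_trans leB; apply: leW; lia.
  have B2 : W ^ esz e2 <= B by apply: leq_trans leB; apply: leW; lia.
  have [s1 [x1 m1 v1 f1]] := IH1 d s w1 P B1.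
  have P1 : phys tau h s1.
    by case: P => Hr Hm Hg; split=> [r lr|a i j la|p gp]; rewrite ?m1 ?Hm ?Hg // f1 ?Hr //; lia.
  have [s2 [x2 m2 v2 f2]] := IH2 d.+1 s1 w2 P1 B2.
  have E : eval_op o (reg s2 (tau + d)) (reg s2 (tau + d.+1)) = ev h (EBin o e1 e2).
    by rewrite v2 f2 ?v1 //; lia.
  eexists; split.
  + rewrite -addnA; apply: ExecSeq x1 _; apply: ExecSeq x2 _; apply: ExecOp.
    by rewrite E; apply: leq_trans (ev_bound (EBin o e1 e2) Hb) leB.
  + by rewrite /= m2 m1.
  + by rewrite E /= eqxx.
  + by move=> r lr; rewrite /= ifN ?f2 ?f1 //; [lia|apply/eqP; lia].
move=> /and3P[la w1 w2] P leB.
have B1 : W ^ esz e1 <= B by apply: leq_trans leB; apply: leW; lia.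
have B2 : W ^ esz e2 <= B by apply: leq_trans leB; apply: leW; lia.
have [s1 [x1 m1 v1 f1]] := IH1 d s w1 P B1.
have P1 : phys tau h s1.
  by case: P => Hr Hm Hg; split=> [r lr|a' i j la'|p gp]; rewrite ?m1 ?Hm ?Hg // f1 ?Hr //; lia.
have [s2 [x2 m2 v2 f2]] := IH2 d.+1 s1 w2 P1 B2.
have v1' : reg s2 (tau + d) = ev h e1 by rewrite f2 ?v1 //; lia.
have lB : addr a (ev h e1) (ev h e2) <= B.
  by apply: leq_trans leB; apply: addr_bound.
have [_ Hm _] := P.
have nn : (tau + d == tau + d.+1) = false by apply/eqP; lia.
have nn' : (tau + d.+1 == tau + d) = false by apply/eqP; lia.
have B16 : 16 <= B.
  apply: leq_trans leB; apply: leq_trans (_ : 2 ^ 10 <= _) => //.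
  apply: leq_trans (_ : W ^ 10 <= _); last by apply: leW; lia.
  by rewrite leq_exp2r //; lia.
rewrite /addr in lB.
eexists; split.
+ rewrite -addnA; apply: ExecSeq x1 _; apply: ExecSeq x2 _.
  rewrite (_ : 8 = 1 + (1 + (1 + (1 + (1 + (1 + (1 + 1))))))) //.
  apply: ExecSeq; first by apply: ExecOp; rewrite /= v1' v2; nia.
  apply: ExecSeq; first by apply: ExecOp; rewrite /= eqxx v1' v2; nia.
  apply: ExecSeq; first by apply: ExecOp; rewrite /= !eqxx nn v1' v2; nia.
  apply: ExecSeq; first by apply: ExecConst.
  apply: ExecSeq; first by apply: ExecOp; rewrite /= !(eqxx, nn, nn') v1' v2; nia.
  apply: ExecSeq; first by apply: ExecConst; lia.
  apply: ExecSeq; first by apply: ExecOp; rewrite /= !(eqxx, nn, nn') v1' v2; nia.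
  by apply: ExecRead; rewrite /= !(eqxx, nn, nn') v1' v2; nia.
+ by rewrite /= m2 m1.
+ rewrite /= !(eqxx, nn, nn') v1' v2 m2 m1 -Hm //.
+ by move=> r lr; rewrite /= !ifN ?f2 ?f1 //; try (apply/eqP); lia.
Qed.

Lemma phys_same h s s' : phys tau h s -> Defs.mem s' = Defs.mem s ->
  (forall r, r < tau -> reg s' r = reg s r) -> phys tau h s'.
Proof.
by move=> [Hr Hm Hg] m1 f1; split=> [r lr|a i j la|p gp]; rewrite ?m1 ?Hm ?Hg // f1 ?Hr.
Qed.

Lemma sim_caddr h a e1 e2 s : a < 16 -> ewf tau e1 -> ewf tau e2 -> phys tau h s -> bdd V h ->
  W ^ (2 * (esz e1 + esz e2) + 10) <= B ->
  exists s', [/\ exec B (caddr tau a e1 e2) s (ecost e1 + ecost e2 + 7) s', Defs.mem s' = Defs.mem s,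
    reg s' tau = addr a (ev h e1) (ev h e2) & forall r, r < tau -> reg s' r = reg s r].
Proof.
move=> la w1 w2 P Hb leB.
have B1 : W ^ esz e1 <= B by apply: leq_trans leB; apply: leW; lia.
have B2 : W ^ esz e2 <= B by apply: leq_trans leB; apply: leW; lia.
have [s1 [x1 m1 v1 f1]] := sim_cexp 0 w1 P Hb B1.
have P1 : phys tau h s1 by apply: phys_same P m1 _ => r lr; rewrite f1 ?addn0.
have [s2 [x2 m2 v2 f2]] := sim_cexp 1 w2 P1 Hb B2.
rewrite addn0 in v1 f1; rewrite addn1 in v2 f2.
have v1' : reg s2 tau = ev h e1 by rewrite f2 ?v1 //; lia.
have lB : addr a (ev h e1) (ev h e2) <= B.
  by apply: leq_trans leB; apply: addr_bound.
have nn : (tau == tau.+1) = false by apply/eqP; lia.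
have nn' : (tau.+1 == tau) = false by apply/eqP; lia.
have B16 : 16 <= B.
  apply: leq_trans leB; apply: leq_trans (_ : 2 ^ 10 <= _) => //.
  apply: leq_trans (_ : W ^ 10 <= _); last by apply: leW; lia.
  by rewrite leq_exp2r //; lia.
rewrite /addr in lB.
eexists; split.
+ rewrite -addnA; apply: ExecSeq x1 _; apply: ExecSeq x2 _.
  rewrite (_ : 7 = 1 + (1 + (1 + (1 + (1 + (1 + 1)))))) //.
  apply: ExecSeq; first by apply: ExecOp; rewrite /= v1' v2; nia.
  apply: ExecSeq; first by apply: ExecOp; rewrite /= eqxx v1' v2; nia.
  apply: ExecSeq; first by apply: ExecOp; rewrite /= !eqxx nn v1' v2; nia.
  apply: ExecSeq; first by apply: ExecConst.
  apply: ExecSeq; first by apply: ExecOp; rewrite /= !(eqxx, nn, nn') v1' v2; nia.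
  apply: ExecSeq; first by apply: ExecConst; lia.
  by apply: ExecOp; rewrite /= !(eqxx, nn, nn') v1' v2; nia.
+ by rewrite /= m2 m1.
+ by rewrite /= !(eqxx, nn, nn') v1' v2.
+ by move=> r lr; rewrite /= !ifN ?f2 ?f1 //; try (apply/eqP); lia.
Qed.

Lemma sim_comp p h t h' s : hexec V p h t h' -> wf tau p -> phys tau h s -> bdd V h ->
  W ^ psz p <= B ->
  exists t' s', [/\ exec B (comp tau p) s t' s', t' <= cc p * t & phys tau h' s'].
Proof.
move=> ex; elim: ex s => {p h t h'} /=.
- by move=> h s _ P _ _; exists 1, s; split=> //; exact: ExecSkip.
- move=> h r e le s /andP[lr we] P Hb leB.
  have B1 : W ^ esz e <= B by apply: leq_trans leB; apply: leW; lia.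
  have [s1 [x1 m1 v1 f1]] := sim_cexp 0 we P Hb B1.
  rewrite addn0 in v1 f1.
  do 2 eexists; split.
  + apply: ExecSeq x1 _; apply: (@ExecSeq _ _ _ _ _ _ 1 1); first exact: ExecConst.
    apply: ExecOp; rewrite /= eqxx ifN ?v1 ?addn0; last by apply/eqP; lia.
    by apply: leq_trans B1; apply: ev_bound.
  + by rewrite muln1.
  + case: P => Hr Hm Hg; split=> [r' lr'|a i j la|p gp] /=; last 2 first.
    * by rewrite m1 Hm.
    * by rewrite m1 Hg.
    * rewrite eqxx (_ : (tau == tau.+1) = false); last by apply/eqP; lia.
      by rewrite v1 addn0 /upd; case: eqP => // _; rewrite ifN ?f1 ?Hr //; apply/eqP; lia.
- move=> h a e1 e2 e3 le s /and4P[la w1 w2 w3] P Hb leB.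
  have B1 : W ^ (2 * (esz e1 + esz e2) + 10) <= B by apply: leq_trans leB; apply: leW; lia.
  have B3 : W ^ esz e3 <= B by apply: leq_trans leB; apply: leW; lia.
  have [s1 [x1 m1 v1 f1]] := sim_caddr la w1 w2 P Hb B1.
  have P1 := phys_same P m1 f1.
  have [s2 [x2 m2 v2 f2]] := sim_cexp 1 w3 P1 Hb B3.
  rewrite addn1 in v2 f2.
  have v1' : reg s2 tau = addr a (ev h e1) (ev h e2) by rewrite f2.
  do 2 eexists; split.
  + apply: ExecSeq x1 _; apply: ExecSeq x2 _; apply: ExecWrite.
    by rewrite v1'; apply: leq_trans B1; exact: addr_bound.
  + by rewrite muln1; lia.
  + case: P => Hr Hm Hg; split=> [r' lr'|a' i j la'|p gp] /=.
    * by rewrite f2 ?f1 ?Hr //; lia.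
    * rewrite v1' v2 m2 m1 Hm //; case: eqP => [/addr_inj[//|//|-> -> ->]|ne].
        by rewrite !updE.
      rewrite /upd; case: eqP => // ?; subst; case: eqP => // ?; subst.
      by case: eqP => // ?; subst.
    * rewrite v1' v2 m2 m1 Hg //; case: eqP => // E.
      by have := gp a (ev h e1) (ev h e2) la; rewrite E eqxx.
- move=> h e1 e2 gp s /andP[w1 w2] P Hb leB.
  have B1 : W ^ esz e1 <= B by apply: leq_trans leB; apply: leW; lia.
  have B2 : W ^ esz e2 <= B by apply: leq_trans leB; apply: leW; lia.
  have [s1 [x1 m1 v1 f1]] := sim_cexp 0 w1 P Hb B1.
  rewrite addn0 in v1 f1.
  have P1 := phys_same P m1 f1.
  have [s2 [x2 m2 v2 f2]] := sim_cexp 1 w2 P1 Hb B2.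
  rewrite addn1 in v2 f2.
  have v1' : reg s2 tau = ev h e1 by rewrite f2.
  do 2 eexists; split.
  + apply: ExecSeq x1 _; apply: ExecSeq x2 _; apply: ExecWrite.
    by rewrite v1'; apply: leq_trans B1; exact: ev_bound.
  + by rewrite muln1; lia.
  + case: P => Hr Hm Hg; split=> [r' lr'|a' i j la'|p gp'] /=.
    * by rewrite f2 ?f1 ?Hr //; lia.
    * rewrite v1' v2 m2 m1 Hm //; case: eqP => // E.
      by have := gp a' i j la'; rewrite E eqxx.
    * by rewrite v1' v2 m2 m1 Hg // /upd; case: eqP.
- move=> p q h1 h2 h3 t1 t2 e1 IH1 e2 IH2 s /andP[w1 w2] P Hb leB.
  have B1 : W ^ psz p <= B by apply: leq_trans leB; apply: leW; lia.
  have B2 : W ^ psz q <= B by apply: leq_trans leB; apply: leW; lia.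
  have [t1' [s1 [x1 l1 P1]]] := IH1 s w1 P Hb B1.
  have [t2' [s2 [x2 l2 P2]]] := IH2 s1 w2 P1 (hexec_bdd e1 Hb) B2.
  by exists (t1' + t2'), s2; split=> //; [exact: ExecSeq x1 x2|nia].
- move=> e p q h t h' nz e1 IH1 s /and3P[we w1 w2] P Hb leB.
  have B0 : W ^ esz e <= B by apply: leq_trans leB; apply: leW; lia.
  have B1 : W ^ psz p <= B by apply: leq_trans leB; apply: leW; lia.
  have [s0 [x0 m0 v0 f0]] := sim_cexp 0 we P Hb B0; rewrite addn0 in v0 f0.
  have [t1' [s1 [x1 l1 P1]]] := IH1 s0 w1 (phys_same P m0 f0) Hb B1.
  exists (ecost e + t1'.+1), s1; split=> //; last by nia.
  by apply: ExecSeq x0 _; apply: ExecIfTrue x1; rewrite v0.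
- move=> e p q h t h' nz e1 IH1 s /and3P[we w1 w2] P Hb leB.
  have B0 : W ^ esz e <= B by apply: leq_trans leB; apply: leW; lia.
  have B1 : W ^ psz q <= B by apply: leq_trans leB; apply: leW; lia.
  have [s0 [x0 m0 v0 f0]] := sim_cexp 0 we P Hb B0; rewrite addn0 in v0 f0.
  have [t1' [s1 [x1 l1 P1]]] := IH1 s0 w2 (phys_same P m0 f0) Hb B1.
  exists (ecost e + t1'.+1), s1; split=> //; last by nia.
  by apply: ExecSeq x0 _; apply: ExecIfFalse x1; rewrite v0.
- move=> e p h z s /andP[we w1] P Hb leB.
  have B0 : W ^ esz e <= B by apply: leq_trans leB; apply: leW; lia.
  have [s0 [x0 m0 v0 f0]] := sim_cexp 0 we P Hb B0; rewrite addn0 in v0 f0.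
  exists (ecost e + 1), s0; split; [|by lia|exact: phys_same P m0 f0].
  by apply: ExecSeq x0 _; apply: ExecWhileStop; rewrite v0.
- move=> e p h1 h2 h3 t1 t2 nz e1 IH1 e2 IH2 s /andP[we w1] P Hb leB.
  have B0 : W ^ esz e <= B by apply: leq_trans leB; apply: leW; lia.
  have B1 : W ^ psz p <= B by apply: leq_trans leB; apply: leW; lia.
  have [s0 [x0 m0 v0 f0]] := sim_cexp 0 we P Hb B0; rewrite addn0 in v0 f0.
  have [t1' [s1 [x1 l1 P1]]] := IH1 s0 w1 (phys_same P m0 f0) Hb B1.
  have W2 : ewf tau e && wf tau p by rewrite we.
  have [t2' [s2 [x2 l2 P2]]] := IH2 s1 W2 P1 (hexec_bdd e1 Hb) leB.
  (* The induction hypothesis evaluates the test and then runs the loop. Its first half is the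
     evaluation of the test that ends the compiled loop body. *)
  inversion x2; subst.
  exists (ecost e + (t1' + t0 + t3).+1), s2; split=> //; last by nia.
  apply: ExecSeq x0 _; apply: ExecWhileStep; first by rewrite v0.
    by apply: ExecSeq x1 _; eassumption.
  by eassumption.
Qed.

End Sim.

(** * Counting trees *)

Lemma card_sep (T : finType) (A : {set T}) (p : pred T) :
  #|A| = #|[set w in A | p w]| + #|[set w in A | ~~ p w]|.
Proof.
rewrite -(cardsID [set w | p w] A); congr (_ + _); apply: eq_card => w.
  by rewrite !inE.
by rewrite !inE andbC.
Qed.

Section Tree.

Variables n L : nat.
Notation P := (2 ^ L).

(** Nodes are numbered as in a heap: the root is [1] and the children of [i] are [2 * i] and
    [2 * i + 1]. Vertices are leaves at depth [2 * L], sorted by cluster first, so that cluster [c]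
    is the subtree at node [P + c]. *)
Definition lf (cl : nat -> nat) (w : nat) := P * P + cl w * P + w.

Definition under cl (S : {set 'I_n}) h i := [set w in S | lf cl w %/ 2 ^ h == i].

Definition cnt cl (S : {set 'I_n}) h i := #|under cl S h i|.

Fixpoint rs (T : nat -> nat) cl S h i :=
  T i = cnt cl S h i /\
  match h with
  | 0 => True
  | h.+1 => 0 < cnt cl S h.+1 i ->
            rs T cl S h (2 * i) /\ rs T cl S h (2 * i + 1)
  end.

(* Below a node counting [0] the tree [T] is stale, so that a whole subtree is
   emptied by resetting its root. *)
Definition rep T cl S := rs T cl S (2 * L) 1.

Lemma divS q h : q %/ 2 ^ h.+1 = q %/ 2 ^ h %/ 2.
Proof. by rewrite expnSr divnMA. Qed.

Lemma cnt_split (cl : nat -> nat) (S : {set 'I_n}) h i : cnt cl S h.+1 i = cnt cl S h (2 * i) + cnt cl S h (2 * i + 1).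
Proof.
rewrite /cnt (card_sep _ [pred w : 'I_n | lf cl w %/ 2 ^ h == 2 * i]).
congr (_ + _); apply: eq_card => w; rewrite !inE divS; case: (w \in S) => //=;
  move: (lf cl w %/ 2 ^ h) => q; lia.
Qed.

Lemma rs_val T (cl : nat -> nat) (S : {set 'I_n}) h i : rs T cl S h i -> T i = cnt cl S h i.
Proof. by case: h => [|h] []. Qed.

Lemma rs_eq T T' (cl cl' : nat -> nat) (S S' : {set 'I_n}) h i :
  (forall w : 'I_n, w \in S -> lf cl w %/ 2 ^ h = i -> w \in S' /\ cl' w = cl w) ->
  (forall w : 'I_n, w \in S' -> lf cl' w %/ 2 ^ h = i -> w \in S /\ cl w = cl' w) ->
  (forall j k, j %/ 2 ^ k = i -> T' j = T j) ->
  rs T cl S h i -> rs T' cl' S' h i.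
Proof.
have ecnt h' j : (forall w : 'I_n, w \in S -> lf cl w %/ 2 ^ h' = j -> w \in S' /\ cl' w = cl w) ->
  (forall w : 'I_n, w \in S' -> lf cl' w %/ 2 ^ h' = j -> w \in S /\ cl w = cl' w) ->
  cnt cl' S' h' j = cnt cl S h' j.
  move=> H1 H2; apply: eq_card => w; rewrite !inE; apply/andP/andP => -[wS /eqP wj].
    by have [-> E] := H2 w wS wj; rewrite -wj /lf E.
  by have [-> E] := H1 w wS wj; rewrite -wj /lf E.
elim: h i => [|h IH] i H1 H2 HT; cbn [rs].
  by move=> [E _]; rewrite (ecnt 0) // (HT i 0) ?divn1.
move=> [E ch]; rewrite (ecnt h.+1) // (HT i 0) ?divn1 //; split=> // /ch[c1 c2].
have sub w h' b : b < 2 -> w %/ 2 ^ h' = 2 * i + b -> w %/ 2 ^ h'.+1 = i.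
  by rewrite divS => lb ->; lia.
split; [apply: IH c1|apply: IH c2].
- by move=> w wS E'; apply: H1 => //; apply: (sub _ _ 0); rewrite ?addn0.
- by move=> w wS E'; apply: H2 => //; apply: (sub _ _ 0); rewrite ?addn0.
- by move=> j k E'; apply: (HT _ k.+1); apply: (sub _ _ 0); rewrite ?addn0.
- by move=> w wS E'; apply: H1 => //; apply: (sub _ _ 1).
- by move=> w wS E'; apply: H2 => //; apply: (sub _ _ 1).
- by move=> j k E'; apply: (HT _ k.+1); apply: (sub _ _ 1).
Qed.

Lemma rep_eq T (cl cl' : nat -> nat) (S S' : {set 'I_n}) : (forall w : 'I_n, w \in S -> cl' w = cl w) -> S' = S ->
  rep T cl S -> rep T cl' S'.
Proof.
by move=> H ->; apply: rs_eq => // w wS _; split; rewrite ?H.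
Qed.

(** A node counting [0] may have stale children, so they are reset before the node can become
    positive. The walk goes from the root down because an entry can be trusted only if its parent
    counts something. *)
Definition step (dp dm : nat) (T : nat -> nat) i :=
  let T1 := if T i == 0 then upd (upd T (2 * i) 0) (2 * i + 1) 0 else T in
  upd T1 i (T1 i + dp - dm).

Fixpoint walkf dp dm tg d T :=
  if d is d'.+1 then walkf dp dm tg d' (step dp dm T (tg %/ 2 ^ d')) else T.

Lemma step_out dp dm T i j : (forall k, j %/ 2 ^ k != i) -> step dp dm T i j = T j.
Proof.
move=> H; have := H 0; have := H 1; rewrite divn1 expn1 /step => n1 n0.
by rewrite updN //; case: eqP => // _; rewrite !updN //; apply: contra n1 => /eqP->; lia.
Qed.

Lemma walkf_out dp dm tg d T j : (forall k, j %/ 2 ^ k != tg %/ 2 ^ d) ->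
  walkf dp dm tg d.+1 T j = T j.
Proof.
elim: d T => [|d IH] T H; cbn [walkf]; first by rewrite step_out.
rewrite [LHS]IH ?step_out // => k; apply: contra (H k.+1) => /eqP E.
by rewrite divS E -divS.
Qed.

Lemma sib_disj i k k' j b : 0 < i -> b < 2 ->
  j %/ 2 ^ k = 2 * i + b -> j %/ 2 ^ k' != 2 * i + (1 - b).
Proof.
move=> i0 lb E; apply/eqP => E'; case: (ltngtP k k') => [lt|lt|eqk].
- move: E'; rewrite -(subnK (ltnW lt)) addnC expnD divnMA E.
  have : 0 < k' - k by lia.
  case: (k' - k) => // m _; rewrite expnS divnMA => E'.
  by have := leq_div ((2 * i + b) %/ 2) (2 ^ m); lia.
- move: E; rewrite -(subnK (ltnW lt)) addnC expnD divnMA E'.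
  have : 0 < k - k' by lia.
  case: (k - k') => // m _; rewrite expnS divnMA => E.
  by have := leq_div ((2 * i + (1 - b)) %/ 2) (2 ^ m); lia.
- by rewrite eqk in E; lia.
Qed.

Lemma node_out i b j k : 0 < i -> b < 2 -> j %/ 2 ^ k = 2 * i + b -> j != i.
Proof. by move=> i0 lb E; apply/eqP => Ej; have := leq_div j (2 ^ k); lia. Qed.

Lemma rs_child dp dm T cl S h i b : 0 < i -> b < 2 -> rs T cl S h.+1 i ->
  rs (step dp dm T i) cl S h (2 * i + b).
Proof.
move=> i0 lb [E ch].
have nb : (2 * i == i) = false by lia.
have nb1 : (2 * i + 1 == i) = false by lia.
have Hb : b = 0 \/ b = 1 by lia.
case: (posnP (cnt cl S h.+1 i)) => [z|pos].
  have zb : cnt cl S h (2 * i + b) = 0.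
    by move: z; rewrite cnt_split; case: Hb => ->; rewrite ?addn0; lia.
  have zt : step dp dm T i (2 * i + b) = 0.
    rewrite /step E z eqxx updN; last by lia.
    by case: Hb => ->; rewrite ?addn0 /upd ?eqxx //; case: eqP.
  by case: (h) zb => [|h'] zb; cbn [rs]; rewrite zt zb.
have [c1 c2] := ch pos.
have {c1 c2} : rs T cl S h (2 * i + b) by case: Hb => ->; rewrite ?addn0.
apply: rs_eq => // j k /(node_out i0 lb) nj; rewrite /step E ifN ?updN //; lia.
Qed.

(** Either [tg] is a leaf, which one vertex enters or leaves, or [tg] is a node whose whole subtree
    is emptied. In both cases nothing has to be done below [tg], in the second one because the
    subtree becomes stale. *)
Lemma walkf_rs dp dm tg lt d T (cl : nat -> nat) (S S' : {set 'I_n}) :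
  0 < tg %/ 2 ^ d ->
  (forall w, (w \in S') != (w \in S) -> lf cl w %/ 2 ^ lt = tg) ->
  cnt cl S' lt tg = cnt cl S lt tg + dp - dm -> dm <= cnt cl S lt tg ->
  lt = 0 \/ cnt cl S' lt tg = 0 ->
  rs T cl S (lt + d) (tg %/ 2 ^ d) ->
  rs (walkf dp dm tg d.+1 T) cl S' (lt + d) (tg %/ 2 ^ d) /\ walkf dp dm tg d.+1 T tg = cnt cl S' lt tg.
Proof.
move=> i0 Hd Hc ledm H0.
(* All ancestors of [tg] change by the same amount, since [S] and [S'] agree on the leaves that are
   not below [tg]. *)
have Hcd e : cnt cl S' (lt + e) (tg %/ 2 ^ e) = cnt cl S (lt + e) (tg %/ 2 ^ e) + dp - dm
    /\ dm <= cnt cl S (lt + e) (tg %/ 2 ^ e).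
  pose p := [pred w : 'I_n | lf cl w %/ 2 ^ lt == tg].
  have sp A : #|[set w in under cl A (lt + e) (tg %/ 2 ^ e) | p w]| = cnt cl A lt tg.
    apply: eq_card => w; rewrite !inE expnD divnMA; case: (w \in A) => //=.
    by rewrite andbC; case: (_ =P tg) => [->|_]; rewrite ?eqxx.
  have sn : #|[set w in under cl S' (lt + e) (tg %/ 2 ^ e) | ~~ p w]| =
            #|[set w in under cl S (lt + e) (tg %/ 2 ^ e) | ~~ p w]|.
    apply: eq_card => w; rewrite !inE.
    case E: ((w \in S') == (w \in S)); first by rewrite (eqP E).
    by rewrite Hd ?E // eqxx !andbF.
  have := card_sep (under cl S' (lt + e) (tg %/ 2 ^ e)) p.
  have := card_sep (under cl S (lt + e) (tg %/ 2 ^ e)) p.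
  by rewrite !sp sn -!/(cnt _ _ _ _) Hc; lia.
elim: d T i0 => [|d IH] T i0 HT.
  rewrite expn0 divn1 addn0 in i0 HT *; rewrite /= expn0 divn1.
  have E : step dp dm T tg tg = cnt cl S' lt tg.
    rewrite /step updE; case: ifP => _; rewrite ?updN ?(rs_val HT) //; lia.
  split=> //; case: H0 => [z|z]; first by rewrite z in E *.
  by case: (lt) z E => [|m] z E; cbn [rs]; split; rewrite // z.
set i := tg %/ 2 ^ d.+1 in i0 HT *.
have [b lb Ei] : exists2 b, b < 2 & tg %/ 2 ^ d = 2 * i + b.
  by exists (tg %/ 2 ^ d - 2 * i); rewrite /i divS; lia.
rewrite addnS in HT *.
have Hb : b = 0 \/ b = 1 by lia.
pose T1 := step dp dm T i.
have c1 : rs T1 cl S (lt + d) (tg %/ 2 ^ d) by rewrite Ei; apply: rs_child.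
have i0' : 0 < tg %/ 2 ^ d by lia.
have [c1' v1] := IH T1 i0' c1.
have c2 : rs T1 cl S (lt + d) (2 * i + (1 - b)) by apply: rs_child => //; lia.
have Ew : walkf dp dm tg d.+2 T = walkf dp dm tg d.+1 T1 by [].
rewrite Ew; split=> //.
set T2 := walkf _ _ _ _ _ in c1' *.
have c2' : rs T2 cl S' (lt + d) (2 * i + (1 - b)).
  have Hn (w : 'I_n) : lf cl w %/ 2 ^ (lt + d) = 2 * i + (1 - b) -> (w \in S') = (w \in S).
    move=> E; apply/eqP; apply: contraT => /Hd E'.
    by move: E; rewrite expnD divnMA E' Ei; lia.
  apply: rs_eq c2 => [w wS /Hn E'|w wS /Hn E'|j k E]; [by rewrite E'|by rewrite -E'|].
  rewrite /T2; apply: walkf_out => k'; rewrite Ei.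
  by have := @sib_disj i k k' j (1 - b) i0 _ E; rewrite (_ : 1 - (1 - b) = b) => [->//|]; lia.
have Ti : T2 i = cnt cl S' (lt + d.+1) i.
  rewrite /T2 walkf_out; last first.
    by move=> k; rewrite Ei; apply/eqP => /(node_out i0 lb) /eqP; lia.
  have [-> _] := Hcd d.+1; rewrite /T1 /step updE [lt + d.+1]addnS -/i.
  have [E _] := HT; rewrite -E; case: ifP => _ //; rewrite !updN //; lia.
rewrite addnS in Ti; cbn [rs]; split=> // _.
by case: Hb Ei c1' c2' => -> -> ; rewrite ?addn0 ?subn0 ?subnn ?addn0.
Qed.

Hypothesis nP : n <= P.

Lemma PP_gt0 : 0 < P. Proof. by rewrite expn_gt0. Qed.

Lemma lf_inj (cl : nat -> nat) (w w' : 'I_n) : cl w < P -> cl w' < P -> lf cl w = lf cl w' -> w = w'.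
Proof.
rewrite /lf => l1 l2 E; apply/val_inj => /=.
have := ltn_ord w; have := ltn_ord w' => la' la.
have : (P * P + cl w * P + w) %% P = (P * P + cl w' * P + w') %% P by rewrite E.
by rewrite -!mulnDl !modnMDl !modn_small //; lia.
Qed.

Lemma lf_block (cl : nat -> nat) (w : 'I_n) : lf cl w %/ P = P + cl w.
Proof.
by rewrite /lf -mulnDl divnMDl ?PP_gt0 // divn_small ?addn0 //; have := ltn_ord w; lia.
Qed.

Lemma lf_root (cl : nat -> nat) (w : 'I_n) : cl w < P -> lf cl w %/ (P * P) = 1.
Proof.
move=> lc; rewrite divnMA lf_block; have -> : P + cl w = 1 * P + cl w by lia.
by rewrite divnMDl ?PP_gt0 // divn_small // addn0.
Qed.

Lemma P2E : 2 ^ (2 * L) = P * P. Proof. by rewrite mul2n -addnn expnD. Qed.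

Lemma lf_lt (cl : nat -> nat) (w : 'I_n) : cl w < P -> lf cl w < 2 * (P * P).
Proof.
move=> lc; rewrite /lf; have := ltn_ord w; have : cl w * P + P <= P * P by nia.
by lia.
Qed.

Definition valid (cl : nat -> nat) (S : {set 'I_n}) := forall w : 'I_n, w \in S -> cl w < P.

Lemma cnt_root (cl : nat -> nat) (S : {set 'I_n}) : valid cl S -> cnt cl S (2 * L) 1 = #|S|.
Proof.
move=> v; apply: eq_card => w; rewrite !inE P2E; case wS: (w \in S) => //=.
by rewrite lf_root ?v ?eqxx.
Qed.

Lemma cnt_block (cl : nat -> nat) (S : {set 'I_n}) c : cnt cl S L (P + c) = #|[set w in S | cl w == c]|.
Proof.
by apply: eq_card => w; rewrite !inE lf_block eqn_add2l.
Qed.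

Lemma cnt_le (cl : nat -> nat) (S : {set 'I_n}) h i : cnt cl S h i <= n.
Proof. by rewrite -[X in _ <= X](card_ord n) max_card. Qed.

Lemma cnt_leaf1 (cl : nat -> nat) (S : {set 'I_n}) (w : 'I_n) : valid cl S -> w \in S -> cnt cl S 0 (lf cl w) = 1.
Proof.
move=> v wS; apply/eqP/cards1P; exists w; apply/setP => w'; rewrite !inE expn0 divn1.
apply/andP/eqP => [[wS' /eqP]|->//]; by apply: lf_inj; apply: v.
Qed.

Lemma rep_ins T (cl : nat -> nat) (S : {set 'I_n}) (w : 'I_n) : valid cl (w |: S) -> w \notin S -> rep T cl S ->
  rep (walkf 1 0 (lf cl w) (2 * L).+1 T) cl (w |: S).
Proof.
move=> v nw; rewrite /rep => HT.
have E1 : lf cl w %/ 2 ^ (2 * L) = 1 by rewrite P2E lf_root // v // setU11.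
have z : cnt cl S 0 (lf cl w) = 0.
  apply/eqP; rewrite cards_eq0; apply/set0Pn => -[w']; rewrite !inE expn0 divn1.
  move=> /andP[wS' /eqP E]; suff E' : w' = w by rewrite -E' wS' in nw.
  by apply: lf_inj E; apply: v; rewrite !inE ?wS' ?eqxx ?orbT.
have := @walkf_rs 1 0 (lf cl w) 0 (2 * L) T cl S (w |: S).
rewrite E1 add0n; case=> //.
- by move=> w'; rewrite !inE expn0 divn1; case: (w' =P w) => [->//|_]; rewrite eqxx.
- by rewrite z cnt_leaf1 // setU11.
- by left.
Qed.

Lemma rep_del T (cl : nat -> nat) (S : {set 'I_n}) (w : 'I_n) : valid cl S -> w \in S -> rep T cl S ->
  rep (walkf 0 1 (lf cl w) (2 * L).+1 T) cl (S :\ w).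
Proof.
move=> v wS; rewrite /rep => HT.
have E1 : lf cl w %/ 2 ^ (2 * L) = 1 by rewrite P2E lf_root // v // setU11.
have z : cnt cl (S :\ w) 0 (lf cl w) = 0.
  apply/eqP; rewrite cards_eq0; apply/set0Pn => -[w']; rewrite !inE expn0 divn1.
  move=> /andP[/andP[nw wS'] /eqP E]; move/eqP: nw; apply.
  by apply: lf_inj E; apply: v.
have o := cnt_leaf1 v wS.
have := @walkf_rs 0 1 (lf cl w) 0 (2 * L) T cl S (S :\ w).
rewrite E1 add0n; case=> //.
- by move=> w'; rewrite !inE expn0 divn1; case: (w' =P w) => [->//|_]; rewrite eqxx.
- by rewrite z o.
- by rewrite o.
- by left.
Qed.

Lemma rep_clr T (cl : nat -> nat) (S : {set 'I_n}) c : c < P -> rep T cl S ->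
  rep (walkf 0 #|[set w in S | cl w == c]| (P + c) L.+1 T) cl [set w in S | cl w != c].
Proof.
move=> lc; rewrite /rep => HT.
have E1 : (P + c) %/ 2 ^ L = 1.
  by rewrite -{1}(mul1n P) divnMDl ?PP_gt0 // divn_small // addn0.
have z : cnt cl [set w in S | cl w != c] L (P + c) = 0.
  rewrite cnt_block; apply/eqP; rewrite cards_eq0; apply/set0Pn => -[w']; rewrite !inE.
  by case: (cl w' == c); rewrite ?andbF.
have := @walkf_rs 0 #|[set w in S | cl w == c]| (P + c) L L T cl S [set w in S | cl w != c].
rewrite E1 addnn -mul2n; case=> //.
- move=> w; rewrite !inE lf_block; case: (w \in S) => //=.
  by case: (cl w =P c) => [->|].
- by rewrite z cnt_block; lia.
- by rewrite cnt_block.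
- by right.
Qed.

End Tree.

Arguments upd {A} f x a y /.
Arguments walkf : simpl never.

(* Concrete syntax, memory layout and the programs on trees *)
Declare Scope stm_scope.
Delimit Scope stm_scope with stm.
Bind Scope stm_scope with stm.
Bind Scope stm_scope with expr.
Notation "$ r" := (EVar r) (at level 1, r at level 0, format "$ r") : stm_scope.
Notation "# a" := (ECst a) (at level 1, a at level 0, format "# a") : stm_scope.
Notation "a + b" := (EBin Add a b) : stm_scope.
Notation "a - b" := (EBin Defs.Sub a b) : stm_scope.
Notation "a * b" := (EBin Mul a b) : stm_scope.
Notation "a %/ b" := (EBin Div a b) : stm_scope.
Notation "a %% b" := (EBin Mod a b) : stm_scope.
Notation "a == b" := (EBin Eq a b) : stm_scope.
Notation "a < b" := (EBin Lt a b) : stm_scope.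
Notation "a @[ i , j ]" := (ELd a i j) (at level 2, format "a @[ i ,  j ]") : stm_scope.
Notation "r ::= e" := (Asg r e) (at level 90) : stm_scope.
Notation "a [< i , j >] ::= e" := (Sto a i j e) (at level 90, i at level 89, j at level 89) : stm_scope.
Notation "p ;; q" := (Sq p q) (at level 100, right associativity) : stm_scope.

(* [rU], [rV]: the arguments; [rN]: the number of vertices; [rP]: the power of [2] above it;
   [rX]: the size of the deletion set; [rW], [rE]: the sizes of the kernel graph;
   [rH]: the number of forced vertices. *)
Notation rU := 0 (only parsing).
Notation rV := 1 (only parsing).
Notation rN := 2 (only parsing).
Notation rP := 3 (only parsing).
Notation rX := 4 (only parsing).
Notation rE := 5 (only parsing).
Notation rW := 6 (only parsing).
Notation rH := 7 (only parsing).

(* [aK]: the input of the static algorithm; [aA]: adjacency; [aT]: one tree per row;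
   [aC]: (default) clusters; [aX], [aI]: list and characteristic function of the deletion set;
   [aV], [aW]: the same for the kernel; [aP]: how many first vertices of each cluster
   are in the kernel; [aH]: forced vertices; [aL]: undo log; [aO]: the light vertices;
   [aB]: scratch. *)
Notation aK := 0 (only parsing).
Notation aA := 1 (only parsing).
Notation aT := 2 (only parsing).
Notation aC := 3 (only parsing).
Notation aI := 4 (only parsing).
Notation aX := 5 (only parsing).
Notation aB := 6 (only parsing).
Notation aV := 7 (only parsing).
Notation aP := 8 (only parsing).
Notation aW := 9 (only parsing).
Notation aH := 10 (only parsing).
Notation aL := 11 (only parsing).
Notation aO := 12 (only parsing).

Notation wT := 10 (only parsing).
Notation wG := 11 (only parsing).
Notation wP := 12 (only parsing).
Notation wA := 13 (only parsing).
Notation wS := 14 (only parsing).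
Notation wI := 15 (only parsing).
Notation wR := 16 (only parsing).
Notation sT := 17 (only parsing).
Notation sI := 18 (only parsing).
Notation sR := 19 (only parsing).
Notation sM := 20 (only parsing).
Notation sE := 21 (only parsing).
Notation sC := 22 (only parsing).
Notation sB := 23 (only parsing).
Notation fI := 24 (only parsing).
Notation fQ := 25 (only parsing).
Notation fE := 26 (only parsing).
Notation fC := 27 (only parsing).

Local Open Scope stm_scope.

Definition walk : stm :=
  Whl $wP (wI ::= $wG %/ $wP ;;
    Ite (aT@[$wT, $wI] == #0)
      (aT[<$wT, #2 * $wI>] ::= #0 ;; aT[<$wT, #2 * $wI + #1>] ::= #0) Nop ;;
    aT[<$wT, $wI>] ::= aT@[$wT, $wI] + $wA - $wS ;;
    wP ::= $wP %/ #2).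

(** Once a [0] has been read the descent stops reading, as everything below is stale. *)
Definition rd : stm :=
  wR ::= aT@[$wT, #1] ;;
  Whl $wP (Ite $wR (wR ::= aT@[$wT, $wG %/ $wP]) Nop ;; wP ::= $wP %/ #2).

(** Descends to the vertex of rank [sR] below node [sI]. With [sM] set it selects among the vertices
    of row [rN] that are not in row [sT]: counts of a difference are differences of counts, so the
    non-exceptions need no tree of their own. [sE] carries the count of row [sT] at the current
    node, so that stale children are not consulted. *)
Definition sel : stm :=
  Whl ($sI < $rP * $rP) (
    Ite $sE (sC ::= aT@[$sT, #2 * $sI]) (sC ::= #0) ;;
    sB ::= $sC ;;
    Ite $sM (sB ::= aT@[$rN, #2 * $sI] - $sC) Nop ;;
    sI ::= #2 * $sI ;;
    Ite ($sR < $sB) (sE ::= $sC)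
      (sR ::= $sR - $sB ;; sI ::= $sI + #1 ;; sE ::= $sE - $sC)) ;;
  sI ::= $sI %% $rP.

(** A descent by the pigeonhole principle: fewer vertices than clusters lie below the current node,
    which passes on to one of its children; for a single cluster this says that it is empty. *)
Definition fempty : stm :=
  fI ::= #1 ;; fQ ::= $rP ;; fE ::= aT@[$rN, #1] ;;
  Whl ($fI < $rP) (
    Ite $fE (fC ::= aT@[$rN, #2 * $fI]) (fC ::= #0) ;;
    fQ ::= $fQ %/ #2 ;; fI ::= #2 * $fI ;;
    Ite ($fC < $fQ) (fE ::= $fC) (fI ::= $fI + #1 ;; fE ::= $fE - $fC)) ;;
  fC ::= $fI - $rP.

Local Close Scope stm_scope.

Lemma child_ex q : exists2 b, (b = 0 \/ b = 1) & q = 2 * (q %/ 2) + b.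
Proof. by exists (q %% 2); have := divn_eq q 2; lia. Qed.

Lemma upd_child (T : nat -> nat) i : 0 < i ->
  upd (upd T (2 * i) 0) (2 * i + 1) 0 i = T i.
Proof. by move=> i0; rewrite /= !ifN //; apply/eqP; lia. Qed.

Lemma subn_ex a b : b < a -> exists2 h, a - b = h.+1 & a - b.+1 = h.
Proof. by move=> lt; exists (a - b).-1; lia. Qed.

Lemma PgP L : 2 ^ L <= 2 ^ L * 2 ^ L. Proof. by rewrite leq_pmulr // expn_gt0. Qed.

Lemma cnt_child0 n L cl (S : {set 'I_n}) h i b :
  cnt L cl S h.+1 i = 0 -> b = 0 \/ b = 1 -> cnt L cl S h (2 * i + b) = 0.
Proof. by rewrite cnt_split => /eqP; rewrite addn_eq0 => /andP[/eqP z0 /eqP z1] [] ->; rewrite ?addn0. Qed.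

Section Spec.

Variables (n L V : nat).
Notation P := (2 ^ L).
Notation rep := (@rep n L).
Notation rs := (@rs n L).
Notation cnt := (@cnt n L).
Notation lf := (@lf L).
Hypothesis nP : n <= P.
Hypothesis hV : 64 * (P * P) + 64 <= V.
Implicit Types (cl : nat -> nat) (S : {set 'I_n}).

Lemma cntV cl S h i : cnt cl S h i + 60 <= V.
Proof. by have := cnt_le L cl S h i; have := PgP L; lia. Qed.

Lemma powV D j : D <= 2 * L -> 2 ^ D %/ 2 ^ j + 60 <= V.
Proof.
move=> le; have := leq_div (2 ^ D) (2 ^ j); have : 2 ^ D <= 2 ^ (2 * L) by rewrite leq_exp2l.
by rewrite P2E; lia.
Qed.

Lemma pow_div D j : 2 ^ D %/ 2 ^ j != 0 -> j <= D.
Proof.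
rewrite -lt0n divn_gt0 ?expn_gt0 // => le.
by rewrite -(leq_exp2l (m := 2)).
Qed.

Lemma walk_spec s cl S dp dm lt D T0 : lt + D = 2 * L ->
  rg s wP = 2 ^ D -> rg s wG %/ 2 ^ D = 1 -> rg s wG < V -> rg s wA = dp -> rg s wS = dm ->
  dp <= 1 -> dm <= cnt cl S lt (rg s wG) ->
  ar s aT (rg s wT) = T0 -> rep T0 cl S ->
  R V (2 * L + 1) walk s (fun s' =>
    ar s' aT (rg s wT) = walkf dp dm (rg s wG) D.+1 T0 /\
    forall y, y != rg s wT -> ar s' aT y = ar s aT y).
Proof.
move=> eD eP eG gV eA eS ldp ldm eT HT; set x := rg s wT in eT *; set tg := rg s wG in eG gV ldm *.
(* Finishing the walk from the current row gives the result of the whole walk, and the row still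
   satisfies [rs] at the node to be visited next. *)
pose I j s' := [/\ rg s' wP = 2 ^ D %/ 2 ^ j, j <= D.+1,
  walkf dp dm tg (D.+1 - j) (ar s' aT x) = walkf dp dm tg D.+1 T0,
  (j <= D -> rs (ar s' aT x) cl S (lt + (D - j)) (tg %/ 2 ^ (D - j))) &
  forall y, y != x -> ar s' aT y = ar s aT y].
have fw : (wG \notin rmods walk) && (wT \notin rmods walk) && (wA \notin rmods walk) && (wS \notin rmods walk) by [].
apply: (@R_whl _ _ 0 D.+1 _ _ _ I); first by lia.
- by rewrite /I divn1 subn0 eP eT subn0 eD eG.
- move=> j s' [F _] [p1 p2 p3 p4 p5] /=; rewrite p1 => nz.
  have leD := pow_div nz; split=> //.
  have [gG gT gA gS] : [/\ rg s' wG = tg, rg s' wT = x, rg s' wA = dp & rg s' wS = dm].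
    by rewrite !F.
  have eI : tg %/ (2 ^ D %/ 2 ^ j) = tg %/ 2 ^ (D - j) by rewrite -expnB.
  set i := tg %/ 2 ^ (D - j) in eI.
  have Hi := p4 leD; rewrite -/i in Hi.
  have i0 : 0 < i.
    rewrite lt0n; apply/eqP => z; move: eG; rewrite -(subnK leD) addnC expnD mulnC divnMA -/i z.
    by rewrite div0n.
  have vI := rs_val Hi.
  have stp T : T = ar s' aT x -> step dp dm T i = upd (if ar s' aT x i == 0 then
      upd (upd (ar s' aT x) (2 * i) 0) (2 * i + 1) 0 else ar s' aT x) i (cnt cl S (lt + (D - j)) i + dp - dm).
    by move=> ->; rewrite /step; case: eqP => z; rewrite ?upd_child -?vI.
  apply: R_seqa; first by rewrite /= gG p1 eI; have := leq_div tg (2 ^ (D - j)); rewrite -/i; lia.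
  rewrite /= gG p1 eI.
  apply: (@R_seqm _ _ 0 _ _ _ _ (fun s2 => ar s2 aT x = (if ar s' aT x i == 0 then
      upd (upd (ar s' aT x) (2 * i) 0) (2 * i + 1) 0 else ar s' aT x) /\
      forall y, y != x -> ar s2 aT y = ar s aT y)).
  - by [].
  - apply: R_ite; rewrite /= gT.
      case: (boolP (ar s' aT x i == 0)) => //= z _; apply: R_seqs; first by [].
      apply: R_sto => //=; rewrite gT eqxx; split=> // y ny.
      by rewrite (negbTE ny) p5.
    by case: (boolP (ar s' aT x i == 0)) => //= z _; apply: R_nop.
  move=> s2 [F2 G2] [q1 q2].
  have [g2G g2T g2A [g2S [g2P g2I]]] : [/\ rg s2 wG = tg, rg s2 wT = x, rg s2 wA = dp & rg s2 wS = dm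
     /\ rg s2 wP = 2 ^ D %/ 2 ^ j /\ rg s2 wI = i].
    by rewrite !F2 //= gG gT gA gS p1.
  have q1i : ar s2 aT x i = ar s' aT x i.
    by rewrite q1; case: ifP => // z; rewrite upd_child.
  apply: R_seqs; first by rewrite /= g2T g2I g2A g2S q1i vI; have := cntV cl S (lt + (D - j)) i; lia.
  have leD2 : D <= 2 * L by rewrite -eD leq_addl.
  apply: R_asg; first by rewrite /= g2P -divS; have := powV j.+1 leD2; lia.
  have eT2 : upd (ar s2 aT x) i (ar s2 aT x i + dp - dm) = step dp dm (ar s' aT x) i.
    by rewrite (stp _ erefl) q1i q1 vI.
  rewrite /I /= g2T g2I g2A g2S g2P eqxx eT2 subSS; split=> //.
  - by rewrite divS.
  - by move: p3; rewrite subSn.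
  - move=> lt1; have [h Eh Eh'] := subn_ex lt1.
    rewrite Eh'; rewrite Eh addnS in Hi.
    have [b Hb Ei] := child_ex (tg %/ 2 ^ h).
    rewrite -divS -Eh -/i in Ei; rewrite Ei; apply: rs_child => //.
    by case: Hb => ->.
  - by move=> y ny; rewrite (negbTE ny) q2.
- move=> j s' _ [p1 p2 p3 p4 p5] /= /eqP; rewrite p1 => z.
  have Ej : j = D.+1.
    apply/eqP; rewrite eqn_leq p2 ltnNge; apply/negP => le.
    by have := expn_gt0 2 (D - j); rewrite expnB // z.
  by rewrite -p3 Ej subnn.
Qed.

Lemma rd_spec s cl S lt D : lt + D = 2 * L ->
  rg s wP = 2 ^ D -> rg s wG %/ 2 ^ D = 1 ->
  rep (ar s aT (rg s wT)) cl S ->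
  R V (2 * L + 1) rd s (fun s' => rg s' wR = cnt cl S lt (rg s wG)).
Proof.
move=> eD eP eG HT; set x := rg s wT in HT *; set tg := rg s wG in eG *.
have HT' : rs (ar s aT x) cl S (lt + D) (tg %/ 2 ^ D) by rewrite eD eG.
apply: R_seqa; first by rewrite /= -/x (rs_val HT); have := cntV cl S (2 * L) 1; lia.
(* The predecessor in [j.-1] appears because the root is read before the loop and once more in its
   first iteration. *)
pose I j s' := [/\ rg s' wP = 2 ^ D %/ 2 ^ j, j <= D.+1,
  rg s' wR = cnt cl S (lt + (D - j.-1)) (tg %/ 2 ^ (D - j.-1)) &
  0 < rg s' wR -> rs (ar s aT x) cl S (lt + (D - j.-1)) (tg %/ 2 ^ (D - j.-1))].
apply: (@R_whl _ _ 0 D.+1 _ _ _ I); first by lia.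
- by rewrite /I /= divn1 subn0 -/x (rs_val HT) eG eD; split.
- move=> j s' [F G] [p1 p2 p3 p4] /=; rewrite p1 => nz.
  have leD := pow_div nz; split=> //.
  have gG : rg s' wG = tg by rewrite F.
  have gT : rg s' wT = x by rewrite F.
  have aTe : ar s' aT = ar s aT by rewrite G.
  have eI : tg %/ (2 ^ D %/ 2 ^ j) = tg %/ 2 ^ (D - j) by rewrite -expnB.
  apply: (@R_seqm _ _ 0 _ _ _ _ (fun s2 => rg s2 wP = rg s' wP /\
     rg s2 wR = cnt cl S (lt + (D - j)) (tg %/ 2 ^ (D - j)) /\
     (0 < rg s2 wR -> rs (ar s aT x) cl S (lt + (D - j)) (tg %/ 2 ^ (D - j))))) => //.
    have [j0|j0] := posnP j.
      rewrite j0 /= in p3 p4 eI *.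
      apply: R_ite => /= nz'; last by apply: R_nop.
      have p4' : rs (ar s aT x) cl S (lt + (D - 0)) (tg %/ 2 ^ (D - 0)) by apply: p4; rewrite lt0n.
      apply: R_asg; rewrite /= gT gG p1 j0 eI aTe (rs_val p4'); first by have := cntV cl S (lt + (D - 0)) (tg %/ 2 ^ (D - 0)); lia.
      by split.
    have Ej : D - j.-1 = (D - j).+1 by case: (j) j0 leD => // j' _ leD'; rewrite subnSK.
    rewrite Ej addnS in p3 p4.
    have [b Hb Ei] := child_ex (tg %/ 2 ^ (D - j)); rewrite -divS in Ei.
    apply: R_ite => /= nz'.
      rewrite -lt0n in nz'.
      have [_ ch] := p4 nz'; rewrite p3 in nz'; have [c1 c2] := ch nz'.
      have {c1 c2} c : rs (ar s aT x) cl S (lt + (D - j)) (tg %/ 2 ^ (D - j)).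
        by rewrite Ei; case: Hb => ->; rewrite ?addn0.
      apply: R_asg; rewrite /= gT gG p1 eI aTe (rs_val c); first by have := cntV cl S (lt + (D - j)) (tg %/ 2 ^ (D - j)); lia.
      by split.
    apply: R_nop; split=> //; have z : rg s' wR = 0 by apply/eqP.
    have zc : cnt cl S (lt + (D - j)) (tg %/ 2 ^ (D - j)) = 0.
      by rewrite Ei cnt_child0 // -p3.
    by rewrite zc z.
  move=> s2 [F2 G2] [q1 [q2 q3]].
  have leD2 : D <= 2 * L by rewrite -eD leq_addl.
  apply: R_asg; first by rewrite /= q1 p1 -divS; have := powV j.+1 leD2; lia.
  by rewrite /I /= q1 p1; split=> //; rewrite divS.
- move=> j s' _ [p1 p2 p3 p4] /= /eqP; rewrite p1 => z.
  have Ej : j = D.+1.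
    apply/eqP; rewrite eqn_leq p2 ltnNge; apply/negP => le.
    by have := expn_gt0 2 (D - j); rewrite expnB // z.
  by rewrite p3 Ej /= subnn addn0 expn0 divn1.
Qed.

End Spec.

Section Spec2.

Variables (n L V : nat).
Notation P := (2 ^ L).
Notation rep := (@rep n L).
Notation rs := (@rs n L).
Notation cnt := (@cnt n L).
Notation lf := (@lf L).
Hypothesis nP : n <= P.
Hypothesis hV : 64 * (P * P) + 64 <= V.
Implicit Types (cl : nat -> nat) (S : {set 'I_n}).
Lemma cntV0 cl S h i : cnt cl S h i <= V.
Proof. exact: leq_trans (leq_addr _ _) (cntV nP hV cl S h i). Qed.

(** The ancestors of a nonempty node are nonempty, so no entry on the way down to it is stale. *)
Lemma rs_desc T cl S d h i : rs T cl S (h + d) (i %/ 2 ^ d) -> 0 < cnt cl S h i -> rs T cl S h i.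
Proof.
elim: d h i => [|d IH] h i; first by rewrite addn0 divn1.
rewrite addnS -addSn expnS divnMA => H pos.
have pos' : 0 < cnt cl S h.+1 (i %/ 2).
  rewrite cnt_split; have [b lb E] : exists2 b, b < 2 & i = 2 * (i %/ 2) + b.
    by exists (i - 2 * (i %/ 2)); lia.
  have Hb : b = 0 \/ b = 1 by lia.
  by rewrite {1}E in pos; case: Hb pos => ->; rewrite ?addn0; lia.
have [_ /(_ pos') [c1 c2]] := IH _ _ H pos'.
have : i = 2 * (i %/ 2) \/ i = 2 * (i %/ 2) + 1 by lia.
by case=> ->.
Qed.

Lemma node_lt q m i : i %/ 2 ^ q = 1 -> (i < 2 ^ m) = (q < m).
Proof.
move=> E1.
have Hlow : 2 ^ q <= i by rewrite leqNgt; apply/negP => lt; move: E1; rewrite divn_small.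
have Hup : i < 2 ^ q.+1 by rewrite expnS -ltn_divLR ?expn_gt0 // E1.
apply/idP/idP => [lt|lt].
  by have := leq_ltn_trans Hlow lt; rewrite ltn_exp2l.
by apply: leq_trans Hup _; rewrite leq_exp2l.
Qed.

Definition rank cl S w := #|[set w' : 'I_n in S | lf cl w' < lf cl w]|.

Lemma cntD cl (A B : {set 'I_n}) h i : B \subset A -> cnt cl (A :\: B) h i = cnt cl A h i - cnt cl B h i.
Proof.
move=> sBA; rewrite {2}/cnt (card_sep _ [pred w | w \in B]).
have -> : [set w in under L cl A h i | w \in B] = under L cl B h i.
  apply/setP => w; rewrite !inE /=; case wB: (w \in B); rewrite ?andbF ?andbT //.
  by rewrite (subsetP sBA).
rewrite addKn; apply: eq_card => w; rewrite !inE /=.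
by case: (w \in B); rewrite ?andbF ?andbT.
Qed.

Lemma sel_spec s cl E S0 h0 d : h0 + d = 2 * L ->
  rg s rN = n -> rg s rP = P -> rg s sI %/ 2 ^ d = 1 ->
  rep (ar s aT (rg s sT)) cl E -> valid L cl S0 ->
  (rg s sM = 0 /\ S0 = E) \/
    (exists A, [/\ rg s sM = 1, rep (ar s aT n) cl A, E \subset A & S0 = A :\: E]) ->
  rg s sE = cnt cl E h0 (rg s sI) -> rg s sR < cnt cl S0 h0 (rg s sI) ->
  R V (2 * L + 1) sel s (fun s' => exists w : 'I_n, [/\ rg s' sI = w, w \in S0,
    lf cl w %/ 2 ^ h0 = rg s sI & rank cl (under L cl S0 h0 (rg s sI)) w = rg s sR]).
Proof.
move=> eh eN eP eI HE vS Hm eE rlt; set x := rg s sT in HE; set i0 := rg s sI in eI eE rlt *.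
set r0 := rg s sR in rlt *; set U := under L cl S0 h0 i0.
(* The rank still to be skipped, plus the members of [U] left of the current node, is the rank that
   was asked for. *)
pose I j s' := [/\ j <= h0, rg s' sI %/ 2 ^ j = i0, rg s' sE = cnt cl E (h0 - j) (rg s' sI),
   rg s' sR + #|[set w : 'I_n in U | lf cl w < rg s' sI * 2 ^ (h0 - j)]| = r0 &
   rg s' sR < cnt cl S0 (h0 - j) (rg s' sI)].
have hj j : h0 - j <= 2 * L by rewrite -eh (leq_trans (leq_subr _ _)) // leq_addr.
have dnode j i : j <= h0 -> i %/ 2 ^ j = i0 -> i %/ 2 ^ (2 * L - (h0 - j)) = 1.
  by move=> lj e; rewrite (_ : 2 * L - (h0 - j) = j + d) ?expnD ?divnMA ?e; lia.
have ilt j i : j <= h0 -> i %/ 2 ^ j = i0 -> (i < P * P) = (j < h0).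
  move=> lj e; rewrite -P2E (node_lt _ (dnode j i lj e)); lia.
apply: (@R_seqm _ _ (2 * L + 1) _ _ _ _ (I h0)) => //.
  apply: (@R_whl _ _ 0 h0 _ _ _ I); first by lia.
  - rewrite /I subn0 divn1; split=> //.
    rewrite [X in _ + X](_ : _ = 0) ?addn0 //; apply/eqP; rewrite cards_eq0; apply/eqP/setP => w.
    rewrite !inE; apply/negP => /andP[/andP[_ /eqP e]]; rewrite -/i0 -e ltnNge leq_trunc_div.
    by [].
  - move=> j s' [F G] [p1 p2 p3 p4 p5] /=.
    have [gN gP gT gM] : [/\ rg s' rN = n, rg s' rP = P, rg s' sT = x & rg s' sM = rg s sM].
      by rewrite !F.
    have gA : ar s' aT = ar s aT by rewrite G.
    rewrite gP (ilt j) // eqb0 negbK => ltj; split=> //.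
    have [h Eh Eh'] := subn_ex ltj.
    rewrite /I Eh Eh' in p3 p4 p5 *.
    set i := rg s' sI in p2 p3 p4 p5 *.
    have iP : i < P * P by rewrite (ilt j).
    have cE : (if cnt cl E h.+1 i != 0 then ar s aT x (2 * i) else 0) = cnt cl E h (2 * i).
      case: eqP => [z|/eqP]; last rewrite -lt0n /= => pos.
        by rewrite -[2 * i]addn0 cnt_child0 //; left.
      have [||_ /(_ pos) [/rs_val]] // := @rs_desc (ar s aT x) cl E (2 * L - (h0 - j)) h.+1 i.
      by rewrite -Eh subnKC ?(dnode j) // hj.
    apply: (@R_seqm _ _ 0 _ _ _ _ (fun s2 => rg s2 sC = cnt cl E h (2 * i))); first by [].
      apply: R_ite => /=; rewrite p3 => z.
        have e1 : ar s aT x (2 * i) = cnt cl E h (2 * i) by move: cE; rewrite z.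
        by apply: R_asg => /=; rewrite gT gA e1 // cntV0.
      by apply: R_asg => //=; move: cE; rewrite (eqP z).
    move=> s2 [F2 G2] eC.
    have [g2N g2T g2M [g2I [g2E g2R]]] : [/\ rg s2 rN = n, rg s2 sT = x, rg s2 sM = rg s sM &
      rg s2 sI = i /\ rg s2 sE = cnt cl E h.+1 i /\ rg s2 sR = rg s' sR] by rewrite !F2 // gN gT gM p3.
    have g2A : ar s2 aT = ar s aT by rewrite G2.
    apply: R_seqa => /=; rewrite eC; first by exact: cntV0.
    set s3 := setr _ _ _.
    apply: (@R_seqm _ _ 0 _ _ _ _ (fun s4 => rg s4 sB = cnt cl S0 h (2 * i))); first by [].
      case: Hm => [[m0 e0]|[A [m1 HA sEA e0]]].
        apply: R_ite => /=; rewrite g2M m0 // => _.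
        by apply: R_nop; rewrite /= e0.
      have pA : 0 < cnt cl A h.+1 i by move: p5; rewrite e0 cntD //; lia.
      have vA : ar s aT n (2 * i) = cnt cl A h (2 * i).
        have [||_ /(_ pA) [/rs_val]] // := @rs_desc (ar s aT n) cl A (2 * L - (h0 - j)) h.+1 i.
        by rewrite -Eh subnKC ?(dnode j) // hj.
      apply: R_ite => /=; rewrite g2M m1 // => _.
      apply: R_asg => /=; rewrite g2N g2I g2A eC vA -?cntD // -?e0 //.
      exact: cntV0.
    move=> s4 [F4 G4] eB.
    have [g4I g4E g4R g4C] : [/\ rg s4 sI = i, rg s4 sE = cnt cl E h.+1 i, rg s4 sR = rg s' sR &
       rg s4 sC = cnt cl E h (2 * i)] by rewrite !F4.
    apply: R_seqa; first by rewrite /= g4I; lia.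
    rewrite /= g4I.
    have c2 : cnt cl S0 h.+1 i = cnt cl S0 h (2 * i) + cnt cl S0 h (2 * i + 1) by rewrite cnt_split.
    have i2 : 2 * i * 2 ^ h = i * 2 ^ h.+1 by rewrite expnS; lia.
    apply: R_ite => /=; rewrite g4R eB; case: (ltnP (rg s' sR)) => // lt _.
      apply: R_asg; rewrite /= g4C; first by exact: cntV0.
      split=> //; rewrite ?g4R ?i2 //.
      by rewrite expnS divnMA mulKn.
    apply: R_seqa; rewrite /= g4R eB.
      by apply: leq_trans (leq_subr _ _) (leq_trans (ltnW p5) (cntV0 _ _ _ _)).
    apply: R_seqa; rewrite /=; first by lia.
    apply: R_asg; rewrite /= g4E g4C; first exact: leq_trans (leq_subr _ _) (cntV0 _ _ _ _).
    split=> //.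
    - by rewrite expnS divnMA (_ : (2 * i + 1) %/ 2 = i) //; lia.
    - by rewrite cnt_split; lia.
    - rewrite -p4 -i2.
      have -> : #|[set w : 'I_n in U | lf cl w < (2 * i + 1) * 2 ^ h]| =
         #|[set w : 'I_n in U | lf cl w < 2 * i * 2 ^ h]| + cnt cl S0 h (2 * i).
        rewrite (card_sep _ [pred w : 'I_n | lf cl w < 2 * i * 2 ^ h]); congr (_ + _).
          apply: eq_card => w; rewrite !inE /=; case: (_ && (_ == i0)) => //=.
          by rewrite mulnDl mul1n; lia.
        apply: eq_card => w; rewrite !inE /= -leqNgt.
        rewrite -leq_divRL ?expn_gt0 // -ltn_divLR ?expn_gt0 // addn1 ltnS.
        have eh0 : h0 = h + j.+1 by rewrite -(subnK p1) Eh; lia.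
        apply/idP/idP => [/andP[/andP[/andP[-> _] h1] h2]|/andP[wS /eqP e2]].
          by rewrite eqn_leq h1 h2.
        by rewrite wS {1}eh0 expnD divnMA e2 expnS divnMA mulKn // p2 eqxx leqnn.
      by lia.
    - by lia.
  - move=> j s' [F G] Ij /=; have [p1 p2 _ _ _] := Ij.
    have gP : rg s' rP = P by rewrite F.
    rewrite gP (ilt j) // eqb0 -leqNgt => le.
    by rewrite (_ : h0 = j) //; lia.
move=> s' [F G] [p1 p2 p3 p4 p5].
rewrite subnn in p3 p4 p5; set i := rg s' sI in p2 p3 p4 p5.
have [w] : exists w, w \in under L cl S0 0 i.
  by apply/set0Pn; rewrite -cards_eq0 -lt0n; move: p5; rewrite /cnt; lia.
rewrite inE expn0 divn1 => /andP[wS /eqP ew].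
have c1 : cnt cl S0 0 i = 1 by rewrite -ew cnt_leaf1.
have gP : rg s' rP = P by rewrite F.
have ewi : (i %% P) = w.
  by rewrite -ew /lf -mulnDl modnMDl modn_small //; have := ltn_ord w; lia.
apply: R_asg; rewrite /= gP -/i ewi; first by have := ltn_ord w; have := PgP L; lia.
exists w; split=> //; first by rewrite ew.
rewrite /rank ew -p4 expn0 muln1 -/U; lia.
Qed.

Lemma fempty_spec s cl A : rg s rN = n -> rg s rP = P ->
  rep (ar s aT n) cl A -> valid L cl A -> #|A| < P ->
  R V (2 * L + 1) fempty s (fun s' => rg s' fC < P /\ forall w, w \in A -> cl w != rg s' fC).
Proof.
move=> eN eP HA vA ltA.
have P0 : 0 < P by rewrite expn_gt0.
have HP := PgP L.
do 2!(apply: R_seqa; first by rewrite /= ?eP; lia).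
apply: R_seqa; first by rewrite /= eN (rs_val HA); exact: cntV0.
set s0 := setr _ _ _.
pose I j s' := [/\ j <= L, rg s' fI %/ 2 ^ j = 1, rg s' fE = cnt cl A (2 * L - j) (rg s' fI),
   rg s' fQ = 2 ^ (L - j) & rg s' fE < rg s' fQ].
have ilt j i : i %/ 2 ^ j = 1 -> (i < P) = (j < L) by exact: node_lt.
apply: (@R_seqm _ _ (2 * L + 1) _ _ _ _ (I L)) => //.
  apply: (@R_whl _ _ 0 L _ _ _ I); first by lia.
  - by rewrite /I /= eN eP !subn0 divn1 (rs_val HA) (cnt_root nP vA).
  - move=> j s' [F G] [p1 p2 p3 p4 p5] /=.
    have [gN gP] : rg s' rN = n /\ rg s' rP = P by rewrite !F //= eN eP.
    have gA : ar s' aT = ar s aT by rewrite G.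
    rewrite gP (ilt j) // eqb0 negbK => ltj; split=> //.
    have [h Eh Eh'] : exists2 h, 2 * L - j = h.+1 & 2 * L - j.+1 = h.
      by apply: subn_ex; rewrite (leq_trans ltj) // leq_pmull.
    rewrite /I Eh Eh' in p3 p4 p5 *.
    set i := rg s' fI in p2 p3 *.
    have iP : i < P by rewrite (ilt j).
    have cE : (if cnt cl A h.+1 i != 0 then ar s aT n (2 * i) else 0) = cnt cl A h (2 * i).
      case: eqP => [z|/eqP]; last rewrite -lt0n /= => pos.
        by rewrite -[2 * i]addn0 cnt_child0 //; left.
      have [||_ /(_ pos) [/rs_val]] // := @rs_desc (ar s aT n) cl A j h.+1 i.
      by rewrite p2 -Eh subnK // (leq_trans (ltnW ltj)) // leq_pmull.
    apply: (@R_seqm _ _ 0 _ _ _ _ (fun s2 => rg s2 fC = cnt cl A h (2 * i))); first by [].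
      apply: R_ite => /=; rewrite p3 => z.
        have e1 : ar s aT n (2 * i) = cnt cl A h (2 * i) by move: cE; rewrite z.
        by apply: R_asg => /=; rewrite gN gA e1 // cntV0.
      by apply: R_asg => //=; move: cE; rewrite (eqP z).
    move=> s2 [F2 G2] eC.
    have [g2I g2E g2Q] : [/\ rg s2 fI = i, rg s2 fE = cnt cl A h.+1 i & rg s2 fQ = 2 ^ (L - j)].
      by rewrite !F2 // p3.
    have Ehj : L - j = (L - j.+1).+1 by lia.
    have eQ : 2 ^ (L - j) = 2 * 2 ^ (L - j.+1) by rewrite Ehj expnS.
    have leQ : 2 ^ (L - j) <= P by rewrite leq_exp2l //; lia.
    apply: R_seqa; rewrite /= g2Q; first by apply: leq_trans (leq_div _ _) _; lia.
    apply: R_seqa; rewrite /= g2I; first by lia.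
    have c2 : cnt cl A h.+1 i = cnt cl A h (2 * i) + cnt cl A h (2 * i + 1) by rewrite cnt_split.
    apply: R_ite => /=; rewrite eC eQ mulKn //; case: ltnP => // lt _.
      apply: R_asg; rewrite /= eC; first by exact: cntV0.
      by split=> //; rewrite ?eQ ?mulKn // expnS divnMA mulKn.
    apply: R_seqa; rewrite /=; first by lia.
    apply: R_asg; rewrite /= g2E eC; first exact: leq_trans (leq_subr _ _) (cntV0 _ _ _ _).
    split=> //.
    - by rewrite expnS divnMA (_ : (2 * i + 1) %/ 2 = i) //; lia.
    - by rewrite cnt_split; lia.
    - by rewrite ?mulKn //; move: p5; rewrite p3 p4 eQ cnt_split; lia.
  - move=> j s' [F G] Ij /=; have [p1 p2 _ _ _] := Ij.
    have gP : rg s' rP = P by rewrite F //= eP.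
    rewrite gP (ilt j) // eqb0 -leqNgt => le.
    by rewrite (_ : L = j) //; lia.
move=> s' [F G] [p1 p2 p3 p4 p5].
have gP : rg s' rP = P by rewrite F //= eP.
have lo : P <= rg s' fI by rewrite leqNgt (ilt L) // ltnn.
have up : rg s' fI < P + P.
  by rewrite addnn -mul2n -ltn_divLR // p2.
rewrite p4 subnn expn0 (_ : 2 * L - L = L) in p3 p5; last by lia.
apply: R_asg; rewrite /= gP; first by lia.
split; first by lia.
move=> w wA; apply/eqP => E.
have := cnt_block nP cl A (rg s' fI - P); rewrite subnKC // -p3 => /eqP.
have -> : rg s' fE = 0 by lia.
rewrite eq_sym cards_eq0 => /eqP /setP /(_ w); rewrite !inE wA E eqxx.
by [].
Qed.
Lemma rank_inj cl S (w w' : 'I_n) : valid L cl S -> w \in S -> w' \in S ->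
  rank cl S w = rank cl S w' -> w = w'.
Proof.
move=> vS wS wS' E; apply: (lf_inj nP (vS w wS) (vS w' wS')).
have lt (a b : 'I_n) : a \in S -> lf cl a < lf cl b -> rank cl S a < rank cl S b.
  move=> aS lt; apply: proper_card; apply/properP; split.
    by apply/subsetP => c; rewrite !inE => /andP[-> /= /ltn_trans]; exact.
  by exists a; rewrite !inE aS ?ltnn.
by case: (ltngtP (lf cl w) (lf cl w')) => // h; [have := lt _ _ wS h|have := lt _ _ wS' h]; rewrite E ltnn.
Qed.

Lemma rank_lt cl S (w : 'I_n) : w \in S -> rank cl S w < #|S|.
Proof.
move=> wS; apply: proper_card; apply/properP; split.
  by apply/subsetP => c; rewrite !inE => /andP[].
by exists w; rewrite // !inE ltnn andbF.
Qed.

Definition below cl S r := [set w : 'I_n in S | rank cl S w < r].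

Lemma below0 cl S : below cl S 0 = set0.
Proof. by apply/setP => w; rewrite !inE andbF. Qed.

Lemma belowS cl S r (w : 'I_n) : valid L cl S -> w \in S -> rank cl S w = r ->
  below cl S r.+1 = w |: below cl S r /\ w \notin below cl S r.
Proof.
move=> vS wS E; split; last by rewrite !inE E ltnn andbF.
apply/setP => w'; rewrite !inE; case: eqP => [->|ne]; first by rewrite wS E ltnSn.
case wS': (w' \in S) => //=; rewrite ltnS leq_eqVlt.
by case: eqP => //; rewrite -E => /(rank_inj vS wS' wS).
Qed.

Lemma below_all cl S r : #|S| <= r -> below cl S r = S.
Proof.
move=> le; apply/setP => w; rewrite !inE; case wS: (w \in S) => //=.
exact: leq_trans (rank_lt cl wS) le.
Qed.

Lemma rank_ex cl S r : valid L cl S -> r < #|S| -> exists2 w : 'I_n, w \in S & rank cl S w = r.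
Proof.
move=> vS lt; pose s := map (fun w : 'I_n => rank cl S w) (enum S).
have us : uniq s.
  rewrite map_inj_in_uniq ?enum_uniq // => w w'; rewrite !mem_enum; exact: rank_inj.
have sub : {subset s <= iota 0 #|S|}.
  by move=> k /mapP[w]; rewrite mem_enum mem_iota => /(rank_lt cl) wS ->.
have szi : size (iota 0 #|S|) <= size s by rewrite size_iota size_map -cardE.
have [_ H] := uniq_min_size us sub szi.
have : r \in s by rewrite H mem_iota.
by case/mapP => w; rewrite mem_enum => wS ->; exists w.
Qed.

Lemma card_below cl S r : valid L cl S -> r <= #|S| -> #|below cl S r| = r.
Proof.
move=> vS; elim: r => [|r IH] lt; first by rewrite below0 cards0.
have [w wS rw] := rank_ex vS lt; have [-> nw] := belowS vS wS rw.
by rewrite cardsU1 nw IH // ltnW.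
Qed.

End Spec2.

(** * Deletion sets *)

Notation eW := 28 (only parsing).
Notation eJ := 29 (only parsing).
Notation eX := 30 (only parsing).
Notation eK := 31 (only parsing).
Notation fM := 35 (only parsing).
Notation fJ := 36 (only parsing).
Notation gX := 37 (only parsing).
Notation gC := 38 (only parsing).
Notation gR := 39 (only parsing).

Local Open Scope stm_scope.

(* Inserts into or deletes from the tree in row [r] the vertex in [eW]. *)
Definition wset r dp dm : stm :=
  wT ::= $r ;; wG ::= $rP * $rP + aC@[#0, $eW] * $rP + $eW ;;
  wP ::= $rP * $rP ;; wA ::= #dp ;; wS ::= #dm ;; walk.

Definition rdb r : stm := wT ::= $r ;; wG ::= $rP + $gC ;; wP ::= $rP ;; rd.

Definition selr : stm :=
  sT ::= $gX ;; sI ::= #1 ;; sR ::= $gR ;; sM ::= #0 ;; sE ::= aT@[$gX, #1] ;; sel.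

Definition selb m : stm :=
  rdb gX ;; sT ::= $gX ;; sI ::= $rP + $gC ;; sR ::= $gR ;; sM ::= #m ;; sE ::= $wR ;; sel.

(** A vertex entering or leaving the deletion set occurs only in the rows for which it is an
    exception, so one walk per member of the deletion set suffices. *)
Definition tloop dp dm : stm :=
  eJ ::= #0 ;;
  Whl ($eJ < $rX) (
    eX ::= aX@[#0, $eJ] ;;
    Ite (aA@[$eX, $eW] == (aC@[#0, $eW] == aC@[#0, $eX])) Nop (wset eX dp dm) ;;
    eJ ::= $eJ + #1).

Definition enter : stm :=
  tloop 0 1 ;; wset rN 0 1 ;;
  aX[< #0, $rX >] ::= $eW ;; rX ::= $rX + #1 ;; aI[< #0, $eW >] ::= #1.

(* [eW] sits at position [eK] of the array [aX]. *)
Definition leave : stm :=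
  aX[< #0, $eK >] ::= aX@[#0, $rX - #1] ;; rX ::= $rX - #1 ;; aI[< #0, $eW >] ::= #0 ;;
  tloop 1 0 ;; wset rN 1 0.

(* Switches block [gC] of the tree of [gX] between the two default adjacencies. *)
Definition flip : stm :=
  rdb rN ;; fM ::= $wR ;; rdb gX ;; fM ::= $fM - $wR ;; gR ::= #0 ;;
  Whl ($gR < $fM) (selb 1 ;; aB[< #0, $gR >] ::= $sI ;; gR ::= $gR + #1) ;;
  rdb gX ;;
  wT ::= $gX ;; wG ::= $rP + $gC ;; wP ::= $rP ;; wA ::= #0 ;; wS ::= $wR ;; walk ;;
  fJ ::= #0 ;;
  Whl ($fJ < $fM) (eW ::= aB@[#0, $fJ] ;; wset gX 1 0 ;; fJ ::= $fJ + #1) ;;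
  Ite (aC@[#0, $gX] == $gC) (aC[< #0, $gX >] ::= $rP) (aC[< #0, $gX >] ::= $gC).

Local Close Scope stm_scope.

Section Core.

Variables (n L V : nat).
Notation P := (2 ^ L).
Notation rep := (@rep n L).
Notation cnt := (@cnt n L).
Notation lf := (@lf L).
Notation rank := (@rank n L).
Hypothesis nP : n <= P.
Hypothesis hV : 64 * (P * P) + 64 <= V.
Implicit Types (cl : nat -> nat) (S : {set 'I_n}) (e : rel 'I_n) (xs : seq 'I_n).

(** For [x] in [X] the value [cl x] is the default cluster, and [P] means none, since no vertex
    outside [X] has it. For [x] outside [X], emptiness of this set says that [x] is adjacent to
    exactly the other vertices of its cluster. *)
Definition Es e (X : {set 'I_n}) cl (x : 'I_n) : {set 'I_n} :=
  [set w | [&& w \notin X, w != x & e x w != (cl w == cl x)]].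

Notation setof xs := [set x in xs].

(** Row [n] of [aT] is the complement of the deletion set. [c_clu] makes the rest a cluster graph;
    with [c_E] it also says that the row of a vertex outside the deletion set is empty, which is the
    right row when this vertex enters with its cluster as default. *)
Record core (s : hst) e xs : Prop := Core {
  c_n : rg s rN = n;
  c_p : rg s rP = P;
  c_x : rg s rX = size xs;
  c_u : uniq xs;
  c_xa : forall i x0, i < size xs -> ar s aX 0 i = nth x0 xs i;
  c_adj : forall u v : 'I_n, ar s aA u v = e u v;
  c_in : forall v : 'I_n, ar s aI 0 v = (v \in xs);
  c_M : rep (ar s aT n) (ar s aC 0) (~: setof xs);
  c_E : forall x : 'I_n, rep (ar s aT x) (ar s aC 0) (Es e (setof xs) (ar s aC 0) x);
  c_cl : forall v : 'I_n, v \notin xs -> ar s aC 0 v < P;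
  c_clP : forall v : 'I_n, ar s aC 0 v <= P;
  c_clu : forall v : 'I_n, v \notin xs -> Es e (setof xs) (ar s aC 0) v = set0 }.

Lemma core_frame s s' e xs rs as_ : core s e xs -> frame rs as_ s s' ->
  all (fun r => r \notin rs) [:: rN; rP; rX] ->
  all (fun a => a \notin as_) [:: aX; aA; aI; aT; aC] -> core s' e xs.
Proof.
move=> H [F G] /= /and4P[r1 r2 r3 _] /and5P[a1 a2 a3 a4 /andP[a5 _]].
by case: H => *; split; rewrite ?F ?G.
Qed.

Lemma core_valid s e xs S : core s e xs -> S \subset ~: setof xs -> valid L (ar s aC 0) S.
Proof.
move=> H sub w /(subsetP sub); rewrite !inE; exact: c_cl H _.
Qed.

Lemma Es_sub e X cl x : Es e X cl x \subset ~: X.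
Proof. by apply/subsetP => w; rewrite !inE => /and3P[]. Qed.

Lemma core_size s e xs : core s e xs -> size xs <= n.
Proof.
by move=> H; rewrite -(card_uniqP (c_u H)) -[X in _ <= X](card_ord n) max_card.
Qed.

Lemma nV : n + 60 <= V /\ P + 60 <= V /\ P + P + 60 <= V /\ 2 * (P * P) + 60 <= V.
Proof. by have := PgP L; lia. Qed.

Lemma ordV (v : 'I_n) : v <= V.
Proof. by have := ltn_ord v; have [v1 _] := nV; lia. Qed.

Lemma wset_spec s r dp dm (w : 'I_n) S : rg s rP = P -> rg s eW = w ->
  rg s r <= V -> ar s aC 0 w < P -> dp <= 1 -> dm <= 1 -> dm <= cnt (ar s aC 0) S 0 (lf (ar s aC 0) w) ->
  rep (ar s aT (rg s r)) (ar s aC 0) S ->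
  R V (2 * L + 1) (wset r dp dm) s (fun s' =>
    ar s' aT (rg s r) = walkf dp dm (lf (ar s aC 0) w) (2 * L).+1 (ar s aT (rg s r)) /\
    forall y, y != rg s r -> ar s' aT y = ar s aT y).
Proof.
move=> eP eW' leV lc ldp ldm1 ldm HT; set x := rg s r in HT *.
have llf : lf (ar s aC 0) w < V by have := lf_lt nP lc; have := nV; lia.
have [v1 [v2 [v3 v4]]] := nV.
apply: R_seqa; first exact: leV.
apply: R_seqa; rewrite /= eP eW'; first exact: ltnW.
apply: R_seqa; rewrite /= eP; first lia.
apply: R_seqa; rewrite /=; first lia.
apply: R_seqa; rewrite /=; first lia.
apply: R_call; first apply: (walk_spec nP hV (lt := 0) (D := 2 * L) (dp := dp) (dm := dm) (S := S) (cl := ar s aC 0)) => //=.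
- by rewrite P2E.
- by rewrite P2E lf_root.
- by [].
Qed.

Lemma rdb_spec s r cl S : rg s rP = P -> rg s gC < P -> rg s r <= V ->
  rep (ar s aT (rg s r)) cl S ->
  R V (2 * L + 1) (rdb r) s (fun s' => rg s' wR = #|[set w : 'I_n in S | cl w == rg s gC]|).
Proof.
move=> eP lc leV HT; have [v1 [v2 [v3 v4]]] := nV.
apply: R_seqa; first exact: leV.
apply: R_seqa; rewrite /= eP; first lia.
apply: R_seqa; rewrite /= eP; first lia.
apply: R_call; first apply: (rd_spec nP hV (lt := L) (D := L) (S := S) (cl := cl)) => //=.
- lia.
- by rewrite -{1}(mul1n P) divnMDl ?expn_gt0 // divn_small // addn0.
- by move=> s' _ ->; rewrite /= cnt_block.
Qed.

Lemma selr_spec s cl E : rg s rN = n -> rg s rP = P -> rg s gX <= V -> rg s gR <= V ->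
  rep (ar s aT (rg s gX)) cl E -> valid L cl E -> rg s gR < #|E| ->
  R V (2 * L + 1) selr s (fun s' => exists w : 'I_n, [/\ rg s' sI = w, w \in E &
     rank cl E w = rg s gR]).
Proof.
move=> eN eP lX lR HT vE lt; have [v1 [v2 [v3 v4]]] := nV.
apply: R_seqa; first by [].
apply: R_seqa; rewrite /=; first lia.
apply: R_seqa; rewrite /=; first by [].
apply: R_seqa; rewrite /=; first lia.
have H1 := rs_val HT.
apply: R_seqa; rewrite /= H1; first by apply: cntV0.
have uE : under L cl E (2 * L) 1 = E.
  apply/setP => w; rewrite !inE P2E; case wE: (w \in E) => //=.
  by rewrite lf_root ?vE ?eqxx.
apply: R_call; first apply: (sel_spec nP hV (cl := cl) (E := E) (S0 := E) (h0 := 2 * L) (d := 0)) => //=.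
- by rewrite addn0.
- by left.
- by rewrite cnt_root.
- by move=> s' _ /= [w [? ? _]]; rewrite uE => ?; exists w.
Qed.

Lemma selb_spec s m cl E S0 : rg s rN = n -> rg s rP = P -> rg s gX <= V -> rg s gR <= V ->
  rg s gC < P -> rep (ar s aT (rg s gX)) cl E -> valid L cl S0 ->
  (m = 0 /\ S0 = E) \/
    (exists A, [/\ m = 1, rep (ar s aT n) cl A, E \subset A & S0 = A :\: E]) ->
  let U := [set w : 'I_n in S0 | cl w == rg s gC] in
  rg s gR < #|U| ->
  R V (2 * L + 1) (selb m) s (fun s' => exists w : 'I_n, [/\ rg s' sI = w, w \in U &
     rank cl U w = rg s gR]).
Proof.
move=> eN eP lX lR lc HT vE Hm U lt; have [v1 [v2 [v3 v4]]] := nV.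
apply: R_seqm; [exact: leqnn|exact: rdb_spec HT|].
move=> s1 [F G] e1.
have uE : under L cl S0 L (P + rg s gC) = U.
  apply/setP => w; rewrite !inE lf_block //.
  by rewrite eqn_add2l.
apply: R_seqa; rewrite /= F //.
apply: R_seqa; rewrite /= !F // eP; first lia.
apply: R_seqa; rewrite /= !F //.
apply: R_seqa; rewrite /=; first by case: Hm => [[->]|[A [-> _ _ _]]]; lia.
apply: R_seqa; rewrite /= e1; first by rewrite -(cnt_block nP); apply: cntV0.
apply: R_call; first apply: (sel_spec nP hV (cl := cl) (E := E) (S0 := S0) (h0 := L) (d := L)) => //=.
- lia.
- by rewrite F.
- by rewrite F.
- by rewrite -{1}(mul1n P) divnMDl ?expn_gt0 // divn_small // addn0.
- by rewrite G.
- by case: Hm => [[->]|[A [-> H1 H2 H3]]]; [left|right; exists A; rewrite G].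
- by rewrite cnt_block.
- by rewrite cnt_block.
- move=> s' _ /= [w [h1 h2 h3]]; rewrite uE => h4; exists w; split=> //.
  by rewrite -uE inE h2 h3 eqxx.
Qed.


Definition mism s e (w y : 'I_n) := e y w != (ar s aC 0 w == ar s aC 0 y).

Lemma tloop_spec s e dp dm (w : 'I_n) (ys : seq 'I_n) (Sx : 'I_n -> {set 'I_n}) M :
  rg s rP = P -> rg s eW = w -> rg s rX = size ys -> size ys <= n -> uniq ys ->
  (forall i x0, i < size ys -> ar s aX 0 i = nth x0 ys i) ->
  (forall u v : 'I_n, ar s aA u v = e u v) ->
  ar s aC 0 w < P -> dp <= 1 -> dm <= 1 ->
  (forall y, y \in ys -> mism s e w y -> dm <= cnt (ar s aC 0) (Sx y) 0 (lf (ar s aC 0) w) /\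
     rep (ar s aT y) (ar s aC 0) (Sx y)) ->
  (size ys).+1 * (2 * L + 1).+1 <= M.+1 ->
  R V M (tloop dp dm) s (fun s' =>
    (forall y : 'I_n, y \in ys -> mism s e w y ->
       ar s' aT y = walkf dp dm (lf (ar s aC 0) w) (2 * L).+1 (ar s aT y)) /\
    (forall z : nat, (forall y : 'I_n, y \in ys -> mism s e w y -> z != y) ->
       ar s' aT z = ar s aT z)).
Proof.
move=> eP eW' eX' szn uys exa eadj lc ldp ldm HS leM.
have [v1 [v2 [v3 v4]]] := nV.
apply: R_seqa; rewrite /=; first lia.
pose I j s' := [/\ rg s' eJ = j, j <= size ys,
    (forall y : 'I_n, y \in take j ys -> mism s e w y ->
       ar s' aT y = walkf dp dm (lf (ar s aC 0) w) (2 * L).+1 (ar s aT y)) &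
    (forall z : nat, (forall y : 'I_n, y \in take j ys -> mism s e w y -> z != y) ->
       ar s' aT z = ar s aT z)].
apply: (@R_whl _ _ (2 * L + 1) (size ys) _ _ _ I); first by [].

- by rewrite /I take0.
- move=> j s' [F G] [p1 p2 p3 p4] /=.
  have gX' : rg s' rX = size ys by rewrite F.
  rewrite gX' p1 eqb0 negbK => ltj; split=> //.
  have [y0 _] : exists y0 : 'I_n, true by exists w.
  set y := nth y0 ys j.
  have yin : y \in ys by apply: mem_nth.
  have ytk : y \notin take j ys.
    have : uniq (take j ys ++ y :: drop j.+1 ys) by rewrite -drop_nth // cat_take_drop.
    by rewrite cat_uniq /= negb_or => /and3P[_ /andP[-> _] _].
  apply: R_seqa; rewrite /= G //= p1 (exa _ y0) // -/y; first by have := ltn_ord y; lia.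
  set s1 := setr _ _ _.
  have row : ar s' aT y = ar s aT y by apply: p4 => x xin _; apply: contraNneq ytk => /val_inj ->.
  have mE : ev s1 (EBin Eq (ELd aA (EVar eX) (EVar eW)) (EBin Eq (ELd aC (ECst 0) (EVar eW)) (ELd aC (ECst 0) (EVar eX)))) = ~~ mism s e w y.
    have gW : rg s' eW = w by rewrite F.
    have [hA hC] : ar s' aA = ar s aA /\ ar s' aC = ar s aC by rewrite !G.
    by rewrite /s1 /= gW hA hC eadj /mism; case: (e y w); case: (ar s aC 0 w == ar s aC 0 y).
  have take1 x : (x \in take j.+1 ys) = (x == y) || (x \in take j ys).
    by rewrite (take_nth y0) // mem_rcons inE.
  apply: (@R_seqm _ _ (2 * L + 1) _ _ _ _ (fun s2 =>
    (mism s e w y -> ar s2 aT y = walkf dp dm (lf (ar s aC 0) w) (2 * L).+1 (ar s aT y)) /\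
    forall z : nat, (mism s e w y -> z != y) -> ar s2 aT z = ar s' aT z)) => //.
    apply: R_ite; rewrite mE; case: (boolP (mism s e w y)) => my //= _.
      by apply: R_nop; split.
    have [H1 H2] := HS _ yin my.
    apply: R_call; first apply: (wset_spec (w := w) (S := Sx y)) => //=.
    + by rewrite F.
    + by rewrite F.
    + by have := ltn_ord y; lia.
    + by rewrite G.
    + by rewrite G.
    + by rewrite row G.
    + move=> s2 _; rewrite /s1 /= => -[h1 h2]; split=> [_|z /(_ isT) nz]; last by rewrite h2.
      by rewrite h1 row G.
  move=> s2 [F2 G2] [q1 q2].
  apply: R_asg; rewrite /= F2 //= p1; first lia.
  split=> //=; first by rewrite addn1.
  + move=> x; rewrite take1 => /orP[/eqP->//|xin] mx; rewrite q2 ?p3 // => _.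
    by apply: contraNneq ytk => /val_inj <-.
  + move=> z Hz; rewrite q2 ?p4 //.
    * by move=> x xin; apply: Hz; rewrite take1 xin orbT.
    * by apply: Hz; rewrite take1 eqxx.
- move=> j s' [F _] [p1 p2 p3 p4] /=.
  have gX' : rg s' rX = size ys by rewrite F.
  rewrite gX' p1 eqb0 -leqNgt => le.
  have E : take j ys = ys by apply: take_oversize.
  by rewrite E in p3 p4.
Qed.


Lemma Es_add e (X : {set 'I_n}) cl (w x : 'I_n) : Es e (w |: X) cl x = Es e X cl x :\ w.
Proof. by apply/setP => v; rewrite !inE negb_or -andbA. Qed.

Lemma Es_rem e (X : {set 'I_n}) cl (w x : 'I_n) : w \in X -> Es e (X :\ w) cl x =
  if (w != x) && (e x w != (cl w == cl x)) then w |: Es e X cl x else Es e X cl x.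
Proof.
move=> wX; apply/setP => v; rewrite !inE.
case: ifP => c; rewrite !inE; case: (v =P w) => [->|_] //=; rewrite ?wX //=.
Qed.

(** [w] keeps its cluster as default, for which it has no exceptions; work is needed only to take
    [w] out of the other rows. *)
Lemma enter_spec s e xs (w : 'I_n) M : core s e xs -> w \notin xs -> rg s eW = w ->
  (size xs).+1 * (2 * L + 1).+1 <= M.+1 ->
  R V M enter s (fun s' => core s' e (rcons xs w)).
Proof.
move=> H nw eW' leM; have [v1 [v2 [v3 v4]]] := nV.
set X := setof xs; set cl := ar s aC 0.
have szn := core_size H.
have vE x : valid L cl (Es e X cl x) by apply: core_valid H (Es_sub _ _ _ _).
have wE y : y \in xs -> mism s e w y -> w \in Es e X cl y.
  by move=> yin my; rewrite !inE nw /=; apply/andP; split=> //; apply: contraNneq nw => ->.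
apply: R_seqm; [exact: leqnn|apply: (tloop_spec (e := e) (w := w) (ys := xs) (Sx := Es e X cl))|] => //.
- exact: c_p H.
- exact: c_x H.
- exact: c_u H.
- exact: c_xa H.
- exact: c_adj H.
- exact: c_cl H _ nw.
- move=> y yin my; split; last exact: c_E H y.
  by rewrite cnt_leaf1 //; apply: wE.
move=> s1 [F1 G1] [q1 q2].
have row1 (x : 'I_n) : rep (ar s1 aT x) cl (Es e (w |: X) cl x).
  rewrite Es_add; case xin : (x \in xs); last first.
    rewrite q2; last by move=> y yin _; apply: contraFneq xin => /val_inj->.
    have := c_E H x; rewrite -/X -/cl (c_clu H) ?xin //.
    by apply: rep_eq => //; apply/setP => v; rewrite !inE andbF.
  case mx : (mism s e w x).
    by rewrite q1 //; apply: rep_del => //; [exact: wE|exact: c_E H x].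
  rewrite q2; last by move=> y yin my; apply: contraFneq mx => /val_inj->.
  have := c_E H x; apply: rep_eq => //; apply/setP => v; rewrite !inE.
  by case: (v =P w) => //= ->; move: mx; rewrite /mism -/cl => ->; rewrite !andbF.
have g1 : [/\ rg s1 rN = n, rg s1 rP = P, rg s1 rX = size xs & rg s1 eW = w].
  by rewrite !F1 // (c_n H) (c_p H) (c_x H).
have [g1N g1P g1X g1W] := g1.
have rowM : ar s1 aT n = ar s aT n.
  by apply: q2 => y _ _; have := ltn_ord y; lia.
have vM : valid L cl (~: X) by apply: core_valid H _.
have wM : w \in ~: X by rewrite !inE.
apply: (@R_seqm _ _ (2 * L + 1)); first by lia.
  apply: (wset_spec (w := w) (S := ~: X)) => //.
  - by rewrite g1N; lia.
  - by rewrite G1 //; apply: c_cl H _ nw.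
  - by rewrite G1 // cnt_leaf1.
  - by rewrite g1N rowM (G1 aC isT); exact: c_M H.
move=> s2 [F2 G2]; rewrite g1N rowM => -[q3 q4].
have [g2N g2P g2X g2W] : [/\ rg s2 rN = n, rg s2 rP = P, rg s2 rX = size xs & rg s2 eW = w].
  by rewrite !F2.
have [hX hA hI hC] : [/\ ar s2 aX = ar s aX, ar s2 aA = ar s aA, ar s2 aI = ar s aI & ar s2 aC = ar s aC].
  by rewrite !G2 // !G1.
apply: R_seqs; rewrite /= g2W; first by have := ltn_ord w; lia.
apply: R_seqa; rewrite /= g2X; first by lia.
apply: R_sto; rewrite /= ?g2W; first lia.
have eqX : setof (rcons xs w) = w |: X.
  by apply/setP => v; rewrite !inE mem_rcons inE.
split; rewrite /= ?hA ?hC ?eqX //.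
- by rewrite size_rcons addn1.
- by rewrite rcons_uniq nw (c_u H).
- move=> i x0; rewrite size_rcons nth_rcons ltnS leq_eqVlt => /orP[/eqP->|lt].
    by rewrite !eqxx ltnn.
  by rewrite lt (ltn_eqF lt) hX (c_xa H x0).
- exact: c_adj H.
- move=> v; rewrite hI mem_rcons inE -val_eqE /=; case: eqP => // _.
  exact: c_in H v.
- have -> : ~: (w |: X) = (~: X) :\ w by apply/setP => v; rewrite !inE negb_or.
  by rewrite q3 G1 //; apply: rep_del => //; exact: c_M H.
- by move=> x; rewrite q4 ?row1 //; have := ltn_ord x; lia.
- by move=> v; rewrite mem_rcons inE negb_or => /andP[_]; apply: c_cl H v.
- exact: c_clP H.
- move=> v; rewrite mem_rcons inE negb_or => /andP[_ nv].
  by rewrite Es_add (c_clu H) //; apply/setP => u; rewrite !inE andbF.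
Qed.

Lemma leave_spec s e p q (w : 'I_n) M : symmetric e -> core s e (p ++ w :: q) ->
  rg s eW = w -> rg s eK = size p ->
  ar s aC 0 w < P -> Es e (setof (p ++ w :: q)) (ar s aC 0) w = set0 ->
  (size (p ++ w :: q)).+1 * (2 * L + 1).+1 <= M.+1 ->
  R V M leave s (fun s' => exists2 q', perm_eq q' q & core s' e (p ++ q')).
Proof.
move=> esym H eW' eK' lcw Ew leM; have [v1 [v2 [v3 v4]]] := nV.
set xs := p ++ w :: q in H Ew leM; set X := setof xs in Ew; set cl := ar s aC 0 in lcw Ew.
have szn := core_size H.
have uxs := c_u H.
have /andP[nw upq] : (w \notin p ++ q) && uniq (p ++ q) by move: uxs; rewrite /xs -cat1s uniq_catCA.
have szx : size xs = (size (p ++ q)).+1 by rewrite /xs !size_cat /= addnS.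
(* [q'] is [q] with its last vertex moved to the front, or empty if [w] itself is the last vertex of
   the list. *)
have [q' pq nth'] : exists2 q', perm_eq q' q & forall x0 i, i < size (p ++ q) ->
   nth x0 (p ++ q') i = if i == size p then nth x0 xs (size xs - 1) else nth x0 xs i.
  case/lastP: (q) @xs {H Ew X szn uxs nw upq leM} szx => [|q0 l] xs szx.
    exists [::] => // x0 i; rewrite cats0 => lt.
    by rewrite (ltn_eqF lt) /xs nth_cat lt.
  exists (l :: q0); first by rewrite perm_sym perm_rcons.
  move=> x0 i lt; rewrite subn1 nth_last /xs last_cat /= last_rcons !nth_cat.
  case: ltngtP => // [gt|->]; last by rewrite subnn.
  have [k Ek] : exists k, i - size p = k.+1 by exists (i - size p).-1; lia.
  by rewrite Ek /= nth_rcons ifT //; move: lt; rewrite size_cat size_rcons; lia.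
have mq x : (x \in p ++ q') = (x \in p ++ q) by apply/perm_mem; rewrite perm_cat2l.
have sq : size (p ++ q') = size (p ++ q) by apply: perm_size; rewrite perm_cat2l.
have uq : uniq (p ++ q') by rewrite (perm_uniq (_ : perm_eq _ (p ++ q))) // perm_cat2l.
have mx x : (x \in xs) = (x == w) || (x \in p ++ q').
  by rewrite mq /xs !mem_cat inE orbCA.
have eqX : setof (p ++ q') = X :\ w.
  by apply/setP => v; rewrite !inE mx mq; case: (v =P w) => [->|]; rewrite ?(negbTE nw).
have wX : w \in X by rewrite inE mx eqxx.
have nwq : w \notin p ++ q' by rewrite mq.
have splt : size p < size xs by rewrite szx size_cat; lia.
apply: R_seqs; rewrite /= (c_x H).
  rewrite (c_xa H w); last by lia.
  by apply: ltnW; apply: leq_trans (ltn_ord _) _; lia.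
apply: R_seqa; rewrite /= (c_x H); first by lia.
apply: R_seqs; rewrite /= ?eW' //.
set s0 := seta _ _ _ _ _.
have vE x : valid L cl (Es e X cl x) by apply: core_valid H (Es_sub _ _ _ _).
have wE y : w \notin Es e X cl y by rewrite !inE mx eqxx.
have sz' : size xs - 1 = size (p ++ q') by rewrite szx sq; lia.
have vw (S : {set 'I_n}) : valid L cl S -> valid L cl (w |: S).
  by move=> vS v; rewrite !inE => /orP[/eqP->|/vS].
have xa' i x0 : i < size (p ++ q') -> ar s0 aX 0 i = nth x0 (p ++ q') i.
  move=> lt; rewrite /s0 /= eK' nth' -?sq //; case: eqP => [_|ne].
    by rewrite (c_xa H x0) //; lia.
  by rewrite (c_xa H x0) //; lia.
apply: R_seqm; [exact: leqnn|apply: (tloop_spec (e := e) (w := w) (ys := p ++ q') (Sx := Es e X cl))|] => //=.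
- exact: c_p H.
- by rewrite -sz' //; lia.
- exact: c_adj H.
- by move=> y yin my; split=> //; exact: c_E H y.
- by apply: leq_trans leM; rewrite leq_mul2r; apply/orP; right; lia.
move=> s1 [F1 G1] [q1 q2].
have row1 (x : 'I_n) : rep (ar s1 aT x) cl (Es e (X :\ w) cl x).
  rewrite Es_rem //; case xin : (x \in p ++ q').
    have nwx : w != x by apply: contraNneq nwq => ->.
    rewrite nwx /=; case mmx : (e x w != (cl w == cl x)).
      rewrite q1 //; apply: rep_ins => //; first exact: vw.
      exact: c_E H x.
    rewrite q2; first exact: c_E H x.
    by move=> y yin my; apply: contraFneq mmx => /val_inj->.
  (* Rows of vertices outside the new deletion set are not touched: these vertices are no exceptions
     for [w], so by symmetry [w] is none for them. *)
  rewrite q2; last by move=> y yin _; apply: contraFneq xin => /val_inj->.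
  rewrite ifN; first exact: c_E H x.
  rewrite negb_and negbK; case: eqP => //= /eqP nwx.
  have nx : x \notin xs by rewrite mx xin orbF eq_sym.
  move/setP: Ew => /(_ x); rewrite !inE nx eq_sym nwx /= => /negbFE/eqP.
  by rewrite esym [_ == cl w]eq_sym => ->; rewrite eqxx.
have [g1N g1P g1X g1W] : [/\ rg s1 rN = n, rg s1 rP = P, rg s1 rX = size (p ++ q') & rg s1 eW = w].
  by rewrite !F1 //= -?sz' (c_n H) (c_p H) ?(c_x H).
have rowM : ar s1 aT n = ar s aT n.
  by apply: q2 => y _ _; have := ltn_ord y; lia.
have vM : valid L cl (~: X) by apply: core_valid H _.
have wM : w \notin ~: X by rewrite inE wX.
have hC1 : ar s1 aC = ar s aC by rewrite G1.
apply: R_mono; [|apply: (wset_spec (w := w) (S := ~: X)) => //|]; rewrite ?hC1 ?g1N //.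
- by lia.
- by lia.
- by rewrite rowM; exact: c_M H.
move=> s2 [F2 G2]; rewrite rowM => -[q3 q4].
have [hX hA hI hC] : [/\ ar s2 aX = ar s0 aX, ar s2 aA = ar s aA, ar s2 aI = ar s0 aI & ar s2 aC = ar s aC].
  by rewrite !G2 // !G1.
exists q' => //; split; rewrite ?hA ?hC ?eqX ?F2 //.
- by rewrite hX.
- exact: c_adj H.
- move=> v; rewrite hI /s0 /= -[in RHS]/(v \in _); have := c_in H v; rewrite mx.
  rewrite -val_eqE /= ?eW'; case: eqP => [/val_inj->|_ ->//]; by rewrite (negbTE nwq).
- have -> : ~: (X :\ w) = w |: ~: X by apply/setP => v; rewrite !inE negb_and negbK.
  by rewrite q3; apply: rep_ins => //; [exact: vw|exact: c_M H].
- by move=> x; rewrite q4 ?row1 //; have := ltn_ord x; lia.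
- move=> v nv; case: (eqVneq v w) => [->//|nvw].
  by apply: (c_cl H); rewrite mx negb_or nvw.
- exact: c_clP H.
- move=> v nv; rewrite Es_rem //; case: (eqVneq v w) => [->|nvw].
    by rewrite eqxx.
  have nx : v \notin xs by rewrite mx negb_or nvw.
  rewrite (c_clu H nx); case: ifP => // /andP[_].
  move/setP: Ew => /(_ v); rewrite !inE nx nvw /= => /negbFE/eqP.
  by rewrite esym [_ == cl w]eq_sym => ->; rewrite eqxx.
Qed.

End Core.

Section Flip.

Variables (n L V : nat).
Notation P := (2 ^ L).
Notation rep := (@rep n L).
Notation cnt := (@cnt n L).
Notation lf := (@lf L).
Notation rank := (@rank n L).
Notation below := (@below n L).
Notation core := (@core n L).
Hypothesis nP : n <= P.
Hypothesis hV : 64 * (P * P) + 64 <= V.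
Implicit Types (cl : nat -> nat) (S : {set 'I_n}) (e : rel 'I_n) (xs : seq 'I_n).
Notation setof xs := [set x in xs].

Definition blk e xs cl (x : 'I_n) c := [set w in (~: setof xs) :\: Es e (setof xs) cl x | cl w == c].

Lemma nth_list_step (A : {set 'I_n}) cl j (bs : seq 'I_n) (w : 'I_n) (T T' : nat -> nat) :
  valid L cl A -> size bs = j -> uniq bs -> setof bs = below cl A j -> w \in A ->
  rank cl A w = j ->
  (forall i x0, i < size bs -> T i = nth x0 bs i) -> T' = upd T j (nat_of_ord w) ->
  exists bs' : seq 'I_n, [/\ size bs' = j.+1, uniq bs', setof bs' = below cl A j.+1 &
    forall i x0, i < size bs' -> T' i = nth x0 bs' i].
Proof.
move=> vA <- {j} ub eb wA rw HT ->; have [e1 n1] := belowS nP vA wA rw.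
exists (rcons bs w); split.
- by rewrite size_rcons.
- by rewrite rcons_uniq ub andbT; move: n1; rewrite -eb inE.
- by rewrite e1 -eb; apply/setP => v; rewrite !inE mem_rcons inE.
- move=> i x0; rewrite size_rcons ltnS nth_rcons leq_eqVlt /=.
  case: eqP => [->|_] /= lt; first by rewrite ltnn.
  by rewrite lt; apply: HT.
Qed.

(** Changing the default between [c] and none affects the prediction on cluster [c] only, so the
    exceptions are complemented inside this cluster. The old ones vanish with one walk that clears
    the block, and only the new ones, the elements of [blk], are handled one by one. *)
Lemma flip_spec s e xs (x : 'I_n) M : core s e xs -> x \in xs -> rg s gX = x -> rg s gC < P ->
  ar s aC 0 x = rg s gC \/ ar s aC 0 x = P ->
  (#|blk e xs (ar s aC 0) x (rg s gC)|).+1 * (2 * L + 1).+1 <= M.+1 ->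
  R V M flip s (fun s' => [/\ core s' e xs,
    ar s' aC 0 x = (if ar s aC 0 x == rg s gC then P else rg s gC) &
    forall y, y != x -> ar s' aC 0 y = ar s aC 0 y]).
Proof.
move=> H xin eX' lc hcl; set c := rg s gC in lc hcl *; set cl := ar s aC 0 in hcl *.
set X := setof xs; set A := blk e xs cl x c => leM.
have [v1 [v2 [v3 v4]]] := nV nP hV.
have le1 : 2 * L + 1 <= M by rewrite -ltnS; apply: leq_trans leM; rewrite leq_pmull.
set E := Es e X cl x.
have vM : valid L cl (~: X) by apply: core_valid H _.
have vE : valid L cl E by apply: core_valid H (Es_sub _ _ _ _).
have sEM : E \subset ~: X := Es_sub e X cl x.
have vA : valid L cl A by move=> w; rewrite !inE => /andP[/andP[_ /(c_cl H)]].
have cA : #|[set w : 'I_n in ~: X | cl w == c]| - #|[set w : 'I_n in E | cl w == c]| = #|A|.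
  by have := cntD L cl L (P + c) sEM; rewrite !(cnt_block nP).
have An : #|A| <= n by rewrite -[X in _ <= X](card_ord n) max_card.
have eN := c_n H; have eP := c_p H.
have xn := ltn_ord x.
apply: R_seqm; [exact: le1|apply: (rdb_spec nP hV (cl := cl) (S := ~: X)) => //|].
- by rewrite eN; lia.
- by rewrite eN; exact: c_M H.
move=> s1 [F1 G1] r1.
have [g1N g1P [g1X g1C]] : [/\ rg s1 rN = n, rg s1 rP = P & rg s1 gX = x /\ rg s1 gC = c].
  by rewrite !F1.
apply: R_seqa; rewrite /= r1.
  by rewrite -(cnt_block nP); apply: cntV0.
apply: R_seqm; [exact: le1|apply: (rdb_spec nP hV (cl := cl) (S := E)) => //|] => //=.
- by rewrite g1C.
- by rewrite g1X; lia.
- by rewrite g1X (G1 aT isT); exact: c_E H x.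
move=> s2 [F2 G2] /= r2.
have [g2N g2P [g2X g2C]] : [/\ rg s2 rN = n, rg s2 rP = P & rg s2 gX = x /\ rg s2 gC = c].
  by rewrite !F2.
have g2M : rg s2 fM = #|[set w : 'I_n in ~: X | cl w == c]| by rewrite F2 //= r1.
apply: R_seqa; rewrite /= r2 g2M g1C cA; first by lia.
apply: R_seqa; rewrite //=.
set s3 := setr _ _ _.
have aTeq : ar s3 aT = ar s aT by rewrite /s3 /= (G2 aT isT) /= (G1 aT isT).
have aCeq : ar s3 aC = ar s aC by rewrite /s3 /= (G2 aC isT) /= (G1 aC isT).
pose I j s' := [/\ rg s' gR = j, j <= #|A| & exists bs : seq 'I_n, [/\ size bs = j, uniq bs,
   setof bs = below cl A j & forall i x0, i < size bs -> ar s' aB 0 i = nth x0 bs i]].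
apply: (@R_seqm _ _ M _ _ _ _ (I #|A|)) => //.
  apply: (@R_whl _ _ (2 * L + 1) #|A| _ _ _ I) => //.
  - by split=> //; exists [::]; split=> //; rewrite below0; apply/setP => v; rewrite !inE.
  - move=> j s' [F G] [p1 p2 [bs [p3 p4 p5 p6]]] /=.
    have [gN gP [gX' gC' gM]] : [/\ rg s' rN = n, rg s' rP = P & [/\ rg s' gX = x, rg s' gC = c & rg s' fM = #|A|]].
      by rewrite !F.
    rewrite p1 gM eqb0 negbK => ltj; split=> //.
    have hT : ar s' aT = ar s aT by rewrite (G aT isT).
    apply: R_seqm; [exact: leqnn|apply: (selb_spec nP hV (m := 1) (cl := cl) (E := E) (S0 := ~: X :\: E)) => //|].
    + by rewrite gX'; lia.
    + by rewrite p1; lia.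
    + by rewrite gC'.
    + by rewrite gX' hT; exact: c_E H x.
    + by move=> w; rewrite !inE => /andP[_ /(c_cl H)].
    + by right; exists (~: X); split=> //; rewrite hT; exact: c_M H.
    + by rewrite p1 gC'.
    move=> s'' [F' G']; rewrite gC' p1 => -[w [q1 q2 q3]].
    have g'R : rg s'' gR = j by rewrite F'.
    apply: R_seqs; rewrite /= q1; first by have := ltn_ord w; lia.
    apply: R_asg; rewrite /= g'R addn1; first by lia.
    have hB : ar s'' aB = ar s' aB by rewrite (G' aB isT).
    rewrite /I /= hB; split=> //.
    exact: nth_list_step vA p3 p4 p5 q2 q3 p6 erefl.
  - move=> j s' [F G] Ij /=; have [p1 p2 _] := Ij.
    have gM : rg s' fM = #|A| by rewrite F.
    rewrite p1 gM eqb0 -leqNgt => le.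
    by rewrite (_ : #|A| = j) //; apply/eqP; rewrite eqn_leq le.
move=> s4 [F4 G4] [_ _ [bs [b1 b2 b3 b4]]].
rewrite below_all // in b3.
have [g4N g4P [g4X g4C g4M]] : [/\ rg s4 rN = n, rg s4 rP = P & [/\ rg s4 gX = x, rg s4 gC = c & rg s4 fM = #|A|]].
  by rewrite !F4.
have h4T : ar s4 aT = ar s aT by rewrite (G4 aT isT).
apply: R_seqm; [exact: le1|apply: (rdb_spec nP hV (cl := cl) (S := E)) => //|] => //=.
- by rewrite g4C.
- by rewrite g4X; lia.
- by rewrite g4X h4T; exact: c_E H x.
move=> s5 [F5 G5] /= r5; rewrite g4C in r5.
have [g5N g5P [g5X g5C g5M]] : [/\ rg s5 rN = n, rg s5 rP = P & [/\ rg s5 gX = x, rg s5 gC = c & rg s5 fM = #|A|]].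
  by rewrite !F5.
have h5T : ar s5 aT = ar s aT by rewrite (G5 aT isT).
have EV : #|[set w : 'I_n in E | cl w == c]| <= V by rewrite -(cnt_block nP); apply: cntV0.
apply: R_seqa; rewrite /= g5X; first by lia.
apply: R_seqa; rewrite /= g5P g5C; first by lia.
apply: R_seqa; rewrite /= g5P; first by lia.
apply: R_seqa; rewrite //=.
apply: R_seqa; rewrite /= r5 //.
set s6 := setr _ _ _.
apply: R_seqm; [exact: le1|apply: (walk_spec nP hV (lt := L) (D := L) (dp := 0)
   (dm := #|[set w : 'I_n in E | cl w == c]|) (S := E) (cl := cl) (T0 := ar s aT x)) => //=|].
- lia.
- by rewrite -{1}(mul1n P) divnMDl ?expn_gt0 // divn_small // addn0.
- by lia.
- by rewrite cnt_block.
- by rewrite h5T.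
- exact: c_E H x.
move=> s7 [F7 G7] /= [w1 w2].
have {}w1 := w1; rewrite /s6 /= in w1 w2.
have rep7 : rep (ar s7 aT x) cl [set w in E | cl w != c].
  by rewrite w1; apply: rep_clr => //; exact: c_E H x.
have [g7N g7P [g7X g7C g7M]] : [/\ rg s7 rN = n, rg s7 rP = P & [/\ rg s7 gX = x, rg s7 gC = c & rg s7 fM = #|A|]].
  by rewrite !F7 // /s6 /= g5N g5P g5X g5C g5M.
apply: R_seqa; rewrite //=.
pose J j s' := [/\ rg s' fJ = j, j <= #|A|, rep (ar s' aT x) cl ([set w in E | cl w != c] :|: setof (take j bs)) &
   forall y : nat, y != x -> ar s' aT y = ar s aT y].
have h7C : ar s7 aC = ar s aC by rewrite (G7 aC isT) /s6 /= (G5 aC isT) (G4 aC isT).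
have h7B : ar s7 aB = ar s4 aB by rewrite (G7 aB isT) /s6 /= (G5 aB isT).
have bsA w : (w \in bs) = (w \in A) by rewrite -b3 inE.
apply: (@R_seqm _ _ M _ _ _ _ (J #|A|)) => //.
  apply: (@R_whl _ _ (2 * L + 1) #|A| _ _ _ J) => //.
  - split=> //; last by move=> y ny; rewrite /= w2 // h5T.
    by rewrite take0 (_ : [set w in [::]] = set0) ?setU0 //; apply/setP => v; rewrite !inE.
  - move=> j s' [F G] [p1 p2 p3 p4] /=.
    have [gP gX' gM] : [/\ rg s' rP = P, rg s' gX = x & rg s' fM = #|A|] by rewrite !F.
    rewrite p1 gM eqb0 negbK => ltj; split=> //.
    have hC : ar s' aC = ar s aC by rewrite (G aC isT).
    have hB : ar s' aB = ar s4 aB by rewrite (G aB isT).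
    have ltb : j < size bs by rewrite b1.
    apply: R_seqa; rewrite /= p1 hB (b4 _ x) //; first by have := ltn_ord (nth x bs j); lia.
    set w := nth x bs j.
    have wA : w \in A by rewrite -bsA mem_nth.
    have wn : w \notin [set w in E | cl w != c] :|: setof (take j bs).
      move: (wA); rewrite !inE => /andP[_ ->]; rewrite andbF /=.
      have : uniq (take j bs ++ w :: drop j.+1 bs) by rewrite -drop_nth // cat_take_drop.
      by rewrite cat_uniq /= negb_or => /and3P[_ /andP[-> _] _].
    have v' : valid L cl (w |: ([set w in E | cl w != c] :|: setof (take j bs))).
      move=> v; rewrite inE => /orP[|]; first by rewrite inE => /eqP->; apply: vA.
      rewrite inE => /orP[|]; first by rewrite inE => /andP[/vE].
      by rewrite inE => /mem_take; rewrite bsA => /vA.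
    apply: R_seqm; [exact: leqnn|apply: (wset_spec nP hV (w := w) (S := [set w in E | cl w != c] :|: setof (take j bs))) => //|] => //=.
    + by rewrite gX'; lia.
    + by rewrite hC; apply: vA.
    + by rewrite gX' hC.
    move=> s'' [F' G'] /=; rewrite gX' hC => -[q1 q2].
    have g'J : rg s'' fJ = j by rewrite F'.
    apply: R_asg; rewrite /= g'J addn1; first by lia.
    split=> //=.
    + have -> : [set w in E | cl w != c] :|: setof (take j.+1 bs) = w |: ([set w in E | cl w != c] :|: setof (take j bs)).
        by apply/setP => v; rewrite (take_nth x) // !inE mem_rcons inE -/w orbCA.
      by rewrite q1; apply: rep_ins.
    + by move=> y ny; rewrite q2 // p4.
  - move=> j s' [F G] Jj /=; have [p1 p2 _ _] := Jj.
    have gM : rg s' fM = #|A| by rewrite F.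
    rewrite p1 gM eqb0 -leqNgt => le.
    by rewrite (_ : #|A| = j) //; apply/eqP; rewrite eqn_leq le.
move=> s8 [F8 G8] [_ _ r8 row8].
rewrite take_oversize ?b1 // b3 in r8.
have [g8N g8P [g8X g8C]] : [/\ rg s8 rN = n, rg s8 rP = P & rg s8 gX = x /\ rg s8 gC = c].
  by rewrite !F8.
have h8C : ar s8 aC = ar s aC by rewrite (G8 aC isT).
set d := if cl x == c then P else c.
have Hfin : core (seta s8 aC 0 x d) e xs.
  have [fX fA fI] : [/\ ar s8 aX = ar s aX, ar s8 aA = ar s aA & ar s8 aI = ar s aI].
    by rewrite !G8 //= !G7 // /s6 /= !G5 // !G4 // /s3 /= !G2 //= !G1.
  have cln w : w \notin xs -> upd (ar s8 aC 0) x d w = cl w.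
    by move=> nw; rewrite h8C updN //; apply: contraNneq nw => /val_inj->.
  have Ey y : y != x -> Es e X (upd (ar s8 aC 0) x d) y = Es e X cl y.
    move=> ny; apply/setP => w; rewrite !inE; case wx: (w \in xs); first by [].
    by rewrite cln ?wx // h8C updN // (inj_eq val_inj).
  have Ex : Es e X (upd (ar s8 aC 0) x d) x = [set w in E | cl w != c] :|: A.
    apply/setP => w; rewrite !inE; case wx: (w \in xs); first by rewrite /= ?andbF.
    rewrite cln ?wx // updE /d.
    have nwx : w != x by apply: contraFneq wx => ->.
    have lw : cl w < P by apply: c_cl H _ (negbT wx).
    rewrite nwx /=; case: (hcl) => ->; rewrite ?eqxx.
      rewrite (ltn_eqF lw); case: (e x w); case: (cl w == c) => //.
    rewrite (gtn_eqF lc) (ltn_eqF lw); case: (e x w); case: (cl w == c) => //.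
  split; rewrite /= ?fX ?fA ?fI //.
  - by rewrite F8 //= F7 //= F5 // F4 //= F2 //= F1 // (c_x H).
  - exact: c_u H.
  - exact: c_xa H.
  - exact: c_adj H.
  - exact: c_in H.
  - rewrite row8; last by apply/eqP; lia.
    apply: rep_eq (c_M H) => // w; rewrite !inE; exact: cln.
  - move=> y; case: (eqVneq y x) => [->|ny].
      rewrite Ex; apply: rep_eq r8 => // w; rewrite !inE => Hw; apply: cln.
      by move: Hw => /orP[/andP[/andP[]]|/andP[/andP[_]]].
    rewrite row8 ?(inj_eq val_inj) // Ey //; apply: rep_eq (c_E H y) => // w.
    by rewrite !inE => /andP[nw _]; exact: cln.
  - by move=> w nw; have /= -> := cln w nw; apply: c_cl H w nw.
  - move=> w; rewrite /upd h8C; case: eqP => _; last exact: c_clP H w.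
    by rewrite /d; case: ifP => _; lia.
  - move=> w nw; rewrite Ey; first exact: c_clu H w nw.
    by apply: contraNneq nw => ->.
apply: R_ite => /=; rewrite g8X g8C h8C -/cl.
  case: (boolP (cl x == c)) => //= /eqP Ec _; apply: R_sto; rewrite /= ?g8X ?g8P; first by lia.
  have Ed : d = P by rewrite /d Ec eqxx.
  split.
  - by rewrite -Ed.
  - by rewrite /= eqxx ?Ed.
  - by move=> y ny; rewrite /= ifN ?h8C // (inj_eq val_inj).
case: (boolP (cl x == c)) => //= Ec _; apply: R_sto; rewrite /= ?g8X ?g8C; first by lia.
have Ed : d = c by rewrite /d (negbTE Ec).
split.
- by rewrite -Ed.
- by rewrite /= eqxx ?Ed.
- by move=> y ny; rewrite /= ifN ?h8C // (inj_eq val_inj).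
Qed.

End Flip.

(** * Small deletion sets *)

Section Cvd.

Variables (T : finType) (e : rel T).
Hypothesis esym : symmetric e.
Implicit Types (X Y : {set T}).

(** Being a cluster graph is the absence of an induced path on three vertices: by induction along a
    walk from [a], each vertex met is [a] or adjacent to [a]. *)
Lemma cvdP Y : reflect (forall a b c, a \notin Y -> b \notin Y -> c \notin Y ->
  a != c -> e a b -> e b c -> e a c) (is_cvd e Y).
Proof.
rewrite /is_cvd /cluster_on; apply: (iffP forall_inP) => [H a b c na nb nc ac eab ebc|H a na].
  have na' : a \in ~: Y by rewrite inE.
  have /forall_inP/(_ c) := H a na'; rewrite inE => /(_ nc)/implyP; apply.
  by rewrite ac /=; apply: (@connect_trans _ _ b); apply: connect1; rewrite /induced /= !in_setC ?na ?nb ?nc ?eab ?ebc.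
apply/forall_inP => c nc; apply/implyP => /andP[ac /connectP[p]].
rewrite !inE in na nc; move=> pth Ec; move: ac; rewrite {}Ec {nc}.
elim/last_ind: p pth => [|p z IH]; first by rewrite eqxx.
rewrite rcons_path last_rcons => /andP[pth /and3P[nl nz el]] az.
rewrite !in_setC in nl nz.
have [eq|ne] := eqVneq a (last a p); first by rewrite {1}eq.
by apply: (H a (last a p)) => //; apply: IH.
Qed.

Lemma cvd_numberP : exists X, [/\ is_cvd e X, #|X| = cvd_number e &
  forall Y, is_cvd e Y -> cvd_number e <= #|Y|].
Proof.
rewrite /cvd_number; case: arg_minnP => [|X cX mX]; last by exists X.
by apply/cvdP => a b c; rewrite inE.
Qed.

Lemma cvd_number_le Y : is_cvd e Y -> cvd_number e <= #|Y|.
Proof. by have [X [_ _ H]] := cvd_numberP; exact: H. Qed.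

Lemma min_cvd_card X : is_min_cvd e X <-> is_cvd e X /\ #|X| <= cvd_number e.
Proof.
have [X0 [c0 e0 m0]] := cvd_numberP; split=> -[cX H]; split=> //.
  by rewrite -e0; apply: H.
by move=> Y /m0; apply: leq_trans.
Qed.

Definition bad x a b := forall Y, is_cvd e Y -> [|| x \in Y, a \in Y | b \in Y].

Lemma bad_path x a b : a != b -> e a x -> e x b -> ~~ e a b -> bad x a b.
Proof.
move=> ab eax exb nab Y /cvdP H; apply: contraT; rewrite !negb_or => /and3P[nx na nb].
by have := H a x b na nx nb ab eax exb; rewrite (negbTE nab).
Qed.

Lemma bad_end x a b : x != b -> e x a -> e a b -> ~~ e x b -> bad x a b.
Proof.
move=> xb exa eab nxb Y /cvdP H; apply: contraT; rewrite !negb_or => /and3P[nx na nb].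
by have := H x a b nx na nb xb exa eab; rewrite (negbTE nxb).
Qed.

End Cvd.

(** * Restoring a small deletion set after an edge update *)

Notation pA := 40 (only parsing).
Notation pB := 41 (only parsing).
Notation pF := 42 (only parsing).
Notation pM := 43 (only parsing).

Local Open Scope stm_scope.

(** A default cluster without neighbours of [gX] is given up. This flip is cheap, as it creates no
    exceptions. *)
Definition home_check : stm :=
  gC ::= aC@[#0, $gX] ;;
  Ite ($gC < $rP) (rdb rN ;; pM ::= $wR ;; rdb gX ;; Ite ($wR < $pM) Nop flip) Nop.

(** Without a default the exceptions are the neighbours. If the cluster of one of them also contains
    a non-neighbour, these two form an induced path ending at [gX]; otherwise this cluster becomes
    the default. If there are no neighbours, an empty cluster becomes the default, so that [gX] can
    form a cluster alone. *)
Definition home_find : stm :=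
  pF ::= #1 ;;
  Ite (aC@[#0, $gX] < $rP) Nop (
    Ite (aT@[$gX, #1]) (
      gR ::= #0 ;; selr ;; pA ::= $sI ;; gC ::= aC@[#0, $pA] ;;
      rdb rN ;; pM ::= $wR ;; rdb gX ;;
      Ite ($wR < $pM) (gR ::= #0 ;; selb 1 ;; pB ::= $sI ;; pF ::= #0) flip)
    (fempty ;; aC[< #0, $gX >] ::= $fC)).

(** A remaining exception gives an induced path with a neighbour in the default cluster: [gX] is an
    end of it if the exception is a non-neighbour in that cluster, and the middle if it is a
    neighbour in another one. *)
Definition home_test : stm :=
  Ite $pF (Ite (aT@[$gX, #1])
    (gC ::= aC@[#0, $gX] ;; gR ::= #0 ;; selb 1 ;; pA ::= $sI ;;
     gR ::= #0 ;; selr ;; pB ::= $sI ;; pF ::= #0) Nop) Nop.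

(* Either makes [gX] ready to join the cluster recorded in [aC], or finds an
   induced path through [gX], [pA] and [pB]. *)
Definition process : stm := home_check ;; home_find ;; home_test.

(** Positions are treated from the last one down. Entering vertices are appended, and a leaving one
    is replaced by the last, so the positions still to be treated do not change. *)
Definition rebuild : stm :=
  eK ::= $rX ;;
  Whl $eK (eK ::= $eK - #1 ;; gX ::= aX@[#0, $eK] ;; process ;;
    Ite $pF (eW ::= $gX ;; leave) (eW ::= $pA ;; enter ;; eW ::= $pB ;; enter)).

Definition toggle b : stm :=
  Ite (aI@[#0, $rU]) Nop (eW ::= $rU ;; enter) ;;
  Ite (aI@[#0, $rV]) Nop (eW ::= $rV ;; enter) ;;
  aA[< $rU, $rV >] ::= #b ;; aA[< $rV, $rU >] ::= #b.

Local Close Scope stm_scope.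

Section Process.

Variables (n L V : nat).
Notation P := (2 ^ L).
Notation rep := (@rep n L).
Notation rank := (@rank n L).
Notation below := (@below n L).
Notation core := (@core n L).
Hypothesis nP : n <= P.
Hypothesis hV : 64 * (P * P) + 64 <= V.
Implicit Types (cl : nat -> nat) (S : {set 'I_n}) (e : rel 'I_n) (xs : seq 'I_n).
Notation setof xs := [set x in xs].

Lemma core_edge s e xs (a b : 'I_n) : core s e xs -> a \notin xs -> b \notin xs -> a != b ->
  e a b = (ar s aC 0 a == ar s aC 0 b).
Proof.
move=> H na nb ab; have /setP/(_ b) := c_clu H na.
rewrite !inE nb eq_sym ab /= => /negbFE/eqP->; exact: eq_sym.
Qed.

Lemma core_cvd s e xs : symmetric e -> core s e xs -> is_cvd e (setof xs).
Proof.
move=> esym H; apply/cvdP => // a b c; rewrite !inE => na nb nc ac.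
case: (eqVneq a b) => [->//|ab]; case: (eqVneq b c) => [->//|bc].
by rewrite !(core_edge H) // => /eqP->.
Qed.


Lemma counts_spec s e xs (x : 'I_n) q M Q : core s e xs -> rg s gX = x -> rg s gC < P ->
  2 * L + 1 <= M ->
  (forall s', frame [:: wT; wG; wP; wR; pM] [::] s s' -> core s' e xs ->
     rg s' pM = #|[set w in ~: setof xs | ar s aC 0 w == rg s gC]| ->
     rg s' wR = #|[set w in Es e (setof xs) (ar s aC 0) x | ar s aC 0 w == rg s gC]| ->
     R V M q s' Q) ->
  R V M (Sq (rdb rN) (Sq (Asg pM (EVar wR)) (Sq (rdb gX) q))) s Q.
Proof.
move=> H eX' lc leM K; have [v1 [v2 [v3 v4]]] := nV nP hV; have xn := ltn_ord x.
have [eN eP] := (c_n H, c_p H).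
apply: R_seqm; [exact: leM|apply: (rdb_spec nP hV (cl := ar s aC 0) (S := ~: setof xs)) => //|].
- by rewrite eN; lia.
- by rewrite eN; exact: c_M H.
move=> s1 [F1 G1] r1.
apply: R_seqa; rewrite /= r1; first by rewrite -(cnt_block nP); apply: cntV0.
have [g1P g1X g1C] : [/\ rg s1 rP = P, rg s1 gX = x & rg s1 gC = rg s gC] by rewrite !F1.
apply: R_seqm; [exact: leM|apply: (rdb_spec nP hV (cl := ar s aC 0) (S := Es e (setof xs) (ar s aC 0) x)) => //|] => //=.
- by rewrite g1C.
- by rewrite g1X; lia.
- by rewrite g1X (G1 aT isT); exact: c_E H x.
move=> s2 [F2 G2] /= r2.
have Fr : frame [:: wT; wG; wP; wR; pM] [::] s s2.
  split=> [r|a _]; last by rewrite G2 //= G1.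
  rewrite !inE !negb_or => /and5P[n1 n2 n3 n4 n5].
  rewrite F2; last by rewrite /= !inE !negb_or n1 n2 n3 n4.
  by rewrite /= (negbTE n5) F1 // /= !inE !negb_or n1 n2 n3 n4.
apply: K => //.
- by apply: core_frame H Fr _ _.
- by rewrite F2 //=.
- by rewrite r2 g1C.
Qed.

Lemma blk_card e xs cl x c : #|blk e xs cl x c| =
  #|[set w in ~: setof xs | cl w == c]| - #|[set w in Es e (setof xs) cl x | cl w == c]|.
Proof.
by have := cntD L cl L (P + c) (Es_sub e (setof xs) cl x); rewrite !(cnt_block nP).
Qed.

Lemma home_check_spec s e xs (x : 'I_n) : core s e xs -> x \in xs -> rg s gX = x ->
  R V (2 * L + 1) home_check s (fun s' => core s' e xs /\
    (ar s' aC 0 x < P -> exists2 a, a \in blk e xs (ar s' aC 0) x (ar s' aC 0 x) & true)).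
Proof.
move=> H xin eX'; have [v1 [v2 [v3 v4]]] := nV nP hV.
have lP := c_clP H x.
apply: R_seqa; rewrite /= eX'; first lia.
set s1 := setr _ _ _.
have H1 : core s1 e xs by apply: core_frame H (_ : frame [:: gC] [::] s s1) _ _ => //;
  split=> // r; rewrite inE /s1 /= => /negbTE->.
apply: R_ite => /=; rewrite (c_p H); last first.
  by rewrite eqb0 -leqNgt => le; apply: R_nop; split=> //= lt; lia.
rewrite eqb0 negbK => lt.
apply: (counts_spec (e := e) (xs := xs) (x := x)) => //= s2 Fr H2 eM eR.
have hC : ar s2 aC = ar s aC by have [_ ->] := Fr.
apply: R_ite => /=; rewrite eM eR.
  rewrite eqb0 negbK => ltc; apply: R_nop; split=> // _; rewrite hC.
  have : 0 < #|blk e xs (ar s aC 0) x (ar s aC 0 x)| by rewrite blk_card subn_gt0.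
  by case/card_gt0P => a; exists a.
rewrite eqb0 -leqNgt => ge.
have [g2X g2C] : rg s2 gX = x /\ rg s2 gC = ar s aC 0 x by have [F _] := Fr; rewrite !F.
apply: R_call; first apply: (flip_spec nP hV (e := e) (xs := xs) (x := x)) => //.
- by rewrite g2C.
- by rewrite g2C hC; left.
- by rewrite g2C hC blk_card (eqP (_ : _ - _ == 0)) ?mul1n // subn_eq0.
- move=> s3 _ [H3 ec _]; split=> //; rewrite ec g2C hC eqxx; lia.
Qed.

Definition leaves s e xs (x : 'I_n) :=
  Es e (setof xs) (ar s aC 0) x = set0 /\ ar s aC 0 x < P.

Definition found s e xs (x : 'I_n) := exists a b : 'I_n,
  [/\ rg s pA = a, rg s pB = b, a \notin xs, b \notin xs & a != b /\ bad e x a b].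

Lemma blkP e xs cl x c w : w \in blk e xs cl x c ->
  [/\ w \notin xs, cl w = c & x \in xs -> e x w = (cl w == cl x)].
Proof.
rewrite !inE => /andP[/andP[nE nw] /eqP ec]; split=> // xin.
have nwx : w != x by apply: contraNneq nw => ->.
by move: nE; rewrite nw nwx /= => /negbNE/eqP.
Qed.

Lemma EsP e xs cl (x w : 'I_n) : w \in Es e (setof xs) cl x ->
  [/\ w \notin xs, w != x & e x w = (cl w != cl x)].
Proof. by rewrite !inE => /and3P[-> -> H]; split=> //; move: H; case: (e x w); case: (cl w == cl x). Qed.

Lemma home_find_spec s e xs (x : 'I_n) : symmetric e -> core s e xs -> x \in xs -> rg s gX = x ->
  (ar s aC 0 x < P -> exists2 a, a \in blk e xs (ar s aC 0) x (ar s aC 0 x) & true) ->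
  R V (2 * L + 1) home_find s (fun s' => core s' e xs /\
    (if rg s' pF == 0 then found s' e xs x else
      ar s' aC 0 x < P /\ (Es e (setof xs) (ar s' aC 0) x != set0 ->
        exists2 a, a \in blk e xs (ar s' aC 0) x (ar s' aC 0 x) & true))).
Proof.
move=> esym H xin eX' Hh; have [v1 [v2 [v3 v4]]] := nV nP hV.
have xn := ltn_ord x; set X := setof xs; set cl := ar s aC 0 in Hh *.
apply: R_seqa; rewrite //=; first lia.
set s1 := setr _ _ _.
have H1 : core s1 e xs by apply: core_frame H (_ : frame [:: pF] [::] s s1) _ _ => //;
  split=> // r; rewrite inE /s1 /= => /negbTE->.
apply: R_ite => /=; rewrite (c_p H) eX' -/cl.
  rewrite eqb0 negbK => lt; apply: R_nop; split=> //=; split=> // _; exact: Hh.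
rewrite eqb0 -leqNgt => ge.
have clx : cl x = P by apply/eqP; rewrite eqn_leq (c_clP H x).
have vE : valid L cl (Es e X cl x) by apply: core_valid H (Es_sub _ _ _ _).
have rt := rs_val (c_E H x); rewrite cnt_root // -/X -/cl in rt.
apply: R_ite => /=; rewrite eX' rt.
  rewrite -lt0n => E0.
  apply: R_seqa; rewrite //=.
  apply: R_seqm; [exact: leqnn|apply: (selr_spec nP hV (cl := cl) (E := Es e X cl x)) => //=|].
  - exact: c_n H.
  - exact: c_p H.
  - by rewrite eX'; lia.
  - by rewrite eX'; exact: c_E H x.
  move=> s2 [F2 G2] /= [b [eb bE _]].
  have hC2 : ar s2 aC = ar s aC by rewrite G2.
  have [nb nbx exb] := EsP bE.
  have lb : cl b < P by apply: c_cl H _ nb.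
  rewrite clx (ltn_eqF lb) /= in exb.
  apply: R_seqa; rewrite /= eb; first exact: (ordV nP hV).
  apply: R_seqa; rewrite /= hC2 -/cl; first by lia.
  set s3 := setr _ _ _.
  have g3X : rg s3 gX = x by rewrite /s3 /= F2.
  have H3 : core s3 e xs.
    have Fr : frame [:: pF; gR; wT; sT; sI; sR; sM; sE; sC; sB; sI; sR; sE; pA; gC] [::] s s3.
      split=> [r|a _]; last by rewrite /s3 /= G2.
      rewrite !inE !negb_or; do 14![case/andP => ?]; move=> ?; rewrite /s3 /=.
      rewrite !ifN // F2 /=; last by rewrite !inE !negb_or; do !(apply/andP; split).
      by rewrite !ifN.
    exact: core_frame H Fr _ _.
  apply: (counts_spec (e := e) (xs := xs) (x := x)) => //.
  move=> s4 Fr4 H4 eM eR; have [F4 G4] := Fr4.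
  have hC4 : ar s4 aC = ar s aC by rewrite G4 //= G2.
  have [g4X g4C g4A g4F] : [/\ rg s4 gX = x, rg s4 gC = cl b, rg s4 pA = b & rg s4 pF = 1].
    by rewrite !F4 //= !F2.
  rewrite /= G2 //= -/cl in eM eR.
  apply: R_ite => /=; rewrite eM eR eqb0 ?negbK -?leqNgt => ltc.
    apply: R_seqa; rewrite //=.
    have pos : 0 < #|blk e xs cl x (cl b)| by rewrite blk_card subn_gt0.
    apply: R_seqm; [exact: leqnn|apply: (selb_spec nP hV (m := 1) (cl := cl) (E := Es e X cl x) (S0 := ~: X :\: Es e X cl x)) => //=|].
    - exact: c_n H4.
    - exact: c_p H4.
    - by rewrite g4X; lia.
    - by rewrite g4C.
    - by rewrite g4X; have := c_E H4 x; rewrite hC4.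
    - by move=> w; rewrite inE => /andP[_]; apply: (core_valid H (subxx _)).
    - by right; exists (~: X); split=> //; [have := c_M H4; rewrite hC4|exact: Es_sub].
    - by rewrite g4C.
    move=> s5 [F5 G5] /= [c [ec]]; rewrite g4C => cA _.
    have [nc eclc exc] := blkP cA.
    have {}exc : e x c = false by rewrite exc // eclc clx (ltn_eqF lb).
    have bc : b != c by apply/eqP => E; rewrite E exc in exb.
    apply: R_seqa; rewrite /= ec; first exact: (ordV nP hV).
    apply: R_asg; rewrite //=; split=> /=.
      have Fr : frame (rmods (selb 1) ++ [:: gR; pB; pF]) [::] s4 (setr (setr s5 pB c) pF 0).
        split=> [r|a _]; last by rewrite /= G5.
        rewrite mem_cat negb_or => /andP[n1]; rewrite !inE !negb_or => /and3P[n2 n3 n4].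
        by rewrite /= (negbTE n4) (negbTE n3) F5 //= (negbTE n2).
      exact: core_frame H4 Fr _ _.
    exists b, c; split=> //=; first by rewrite F5.
    split=> //; apply: bad_end => //; rewrite ?exc //.
    - by apply: contraNneq nc => <-.
    - by rewrite (core_edge H) // -/cl eclc.
  apply: R_call; first apply: (flip_spec nP hV (e := e) (xs := xs) (x := x)) => //.
  - by rewrite g4C.
  - by rewrite g4C hC4 -/cl clx; right.
  - by rewrite g4C hC4 blk_card (eqP (_ : _ - _ == 0)) ?mul1n // subn_eq0.
  move=> s5 [F5 G5] [H5 ec oc]; split=> //; rewrite F5 // g4F /=.
  rewrite g4C hC4 -/cl clx (gtn_eqF lb) in ec; rewrite ec; split=> // _.
  have cb5 : ar s5 aC 0 b = cl b by rewrite oc ?hC4.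
  by exists b => //; rewrite !inE nb nbx ec cb5 exb eqxx.
rewrite cards_eq0 => /eqP E0.
have vM : valid L cl (~: X) := core_valid H (subxx _).
apply: R_seqm; [exact: leqnn|apply: (fempty_spec nP hV (cl := cl) (A := ~: X)) => //=|].
- exact: c_n H.
- exact: c_p H.
- exact: c_M H.
(* [x] itself is in the deletion set, so fewer than [n <= P] vertices occupy clusters. *)
- apply: leq_trans nP; rewrite -[X in _ < X](card_ord n) -cardsT; apply: proper_card.
  by apply/properP; split; [apply: subsetT|exists x; rewrite ?inE // xin].
move=> s2 [F2 G2] /= [lc Hc].
have [g2X g2F] : rg s2 gX = x /\ rg s2 pF = 1 by rewrite !F2.
have hC2 : ar s2 aC = ar s aC by rewrite G2.
apply: R_sto; rewrite /= ?g2X; first by lia.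
set c := rg s2 fC in lc Hc *; set s3 := seta _ _ _ _ _.
have cln w : w \notin xs -> upd (ar s aC 0) x c w = cl w.
  by move=> nw; rewrite updN //; apply: contraNneq nw => /val_inj->.
have Ey y : y != x -> Es e X (upd (ar s aC 0) x c) y = Es e X cl y.
  move=> ny; apply/setP => w; rewrite !inE; case wx: (w \in xs); first by [].
  by rewrite cln ?wx // [in upd _ _ _ y]updN // (inj_eq val_inj).
have Ex : Es e X (upd (ar s aC 0) x c) x = set0.
  apply/setP => w; rewrite [RHS]inE; case wx : (w \in xs); first by rewrite !inE wx.
  rewrite !inE wx cln ?wx // updE.
  have := Hc w; rewrite !inE wx => /(_ isT)/negbTE->.
  have /setP/(_ w) := E0; rewrite !inE wx clx /=.
  by rewrite (ltn_eqF (c_cl H (negbT wx))).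
have H3 : core s3 e xs.
  split; rewrite /s3 /= ?hC2 ?G2 //.
  - by rewrite F2 //= (c_n H).
  - by rewrite F2 //= (c_p H).
  - by rewrite F2 //= (c_x H).
  - exact: c_u H.
  - exact: c_xa H.
  - exact: c_adj H.
  - exact: c_in H.
  - apply: rep_eq (c_M H) => // w; rewrite !inE; exact: cln.
  - move=> y; case: (eqVneq y x) => [->|ny].
      rewrite Ex; have := c_E H x; rewrite E0; apply: rep_eq => // w; rewrite inE.
      by [].
    rewrite Ey //; apply: rep_eq (c_E H y) => // w.
    by rewrite !inE => /andP[nw _]; exact: cln.
  - by move=> w nw; have /= -> := cln w nw; apply: c_cl H w nw.
  - move=> w; case: eqP => _; first lia. exact: c_clP H w.
  - move=> w nw; rewrite Ey; first exact: c_clu H w nw.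
    by apply: contraNneq nw => ->.
split=> //=; rewrite g2F /= hC2 eqxx; split=> //.
by rewrite Ex eqxx.
Qed.

Lemma process_spec s e xs (x : 'I_n) : symmetric e -> core s e xs -> x \in xs -> rg s gX = x ->
  R V (2 * L + 1) process s (fun s' => core s' e xs /\
    if rg s' pF == 0 then found s' e xs x else leaves s' e xs x).
Proof.
move=> esym H xin eX'; have [v1 [v2 [v3 v4]]] := nV nP hV; have xn := ltn_ord x.
apply: R_seqm; [exact: leqnn|exact: home_check_spec H xin eX'|] => s1 [F1 G1] [H1 h1].
have g1X : rg s1 gX = x by rewrite F1.
apply: R_seqm; [exact: leqnn|exact: home_find_spec esym H1 xin g1X h1|] => s2 [F2 G2] [H2 b].
have g2X : rg s2 gX = x by rewrite F2.
set X := setof xs; set cl := ar s2 aC 0.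
apply: R_ite => /= f0; last by move: b; rewrite f0 => fnd; apply: R_nop; rewrite f0.
rewrite (negbTE f0) in b; have [lt Hh] := b.
have vE : valid L cl (Es e X cl x) by apply: core_valid H2 (Es_sub _ _ _ _).
have rt := rs_val (c_E H2 x); rewrite cnt_root // -/X -/cl in rt.
apply: R_ite => /=; rewrite g2X rt; last first.
  by rewrite cards_eq0 => /eqP E0; apply: R_nop; rewrite (negbTE f0).
rewrite -lt0n => E0.
have [|a aA _] := Hh; first by rewrite -card_gt0.
apply: R_seqa; rewrite /= g2X; first lia.
apply: R_seqa; rewrite //=.
apply: R_seqm; [exact: leqnn|apply: (selb_spec nP hV (m := 1) (cl := cl) (E := Es e X cl x) (S0 := ~: X :\: Es e X cl x)) => //=|].
- exact: c_n H2.
- exact: c_p H2.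
- by rewrite g2X; lia.
- by rewrite g2X; exact: c_E H2 x.
- by move=> w; rewrite inE => /andP[_]; apply: (core_valid H2 (subxx _)).
- by right; exists (~: X); split=> //; [exact: c_M H2|exact: Es_sub].
- by apply/card_gt0P; exists a.
move=> s3 [F3 G3] /= [c [ec cA _]].
have [nc eclc exc] := blkP cA; rewrite eclc eqxx in exc.
apply: R_seqa; rewrite /= ec; first exact: (ordV nP hV).
apply: R_seqa; rewrite //=.
apply: R_seqm; [exact: leqnn|apply: (selr_spec nP hV (cl := cl) (E := Es e X cl x)) => //=|].
- by rewrite F3 //= (c_n H2).
- by rewrite F3 //= (c_p H2).
- by rewrite F3 //= g2X; lia.
- by rewrite F3 //= g2X G3 //; exact: c_E H2 x.
move=> s4 [F4 G4] /= [b' [eb bE _]].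
have [nb nbx exb] := EsP bE.
apply: R_seqa; rewrite /= eb; first exact: (ordV nP hV).
apply: R_asg; rewrite //=; split=> /=.
  have Fr : frame (rmods (selb 1) ++ rmods selr ++ [:: gC; gR; pA; pB; pF]) [::] s2 (setr (setr s4 pB b') pF 0).
    split=> [r|z _]; last by rewrite /= G4 // G3.
    rewrite mem_cat negb_or => /andP[n1]; rewrite mem_cat negb_or => /andP[n2].
    rewrite !inE !negb_or => /and5P[n3 n4 n5 n6 n7].
    rewrite /= (negbTE n6) (negbTE n7) (F4 _ n2) /= (negbTE n4) (negbTE n5) (F3 _ n1) /=.
    by rewrite (negbTE n3) (negbTE n4).
  exact: core_frame H2 Fr _ _.
have cb : c != b'.
  apply/eqP => E; have := exc xin; rewrite E exb -E eclc eqxx.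
  by [].
exists c, b'; split=> //=; first by rewrite F4.
have exc' := exc xin.
split=> //; case cb' : (cl b' == cl x).
  rewrite cb' /= in exb; apply: bad_end; rewrite ?exb //.
  - by rewrite eq_sym.
  - by rewrite (core_edge H2) // -/cl eclc eq_sym.
rewrite cb' /= in exb; apply: bad_path; rewrite ?exb //.
- by rewrite esym.
- by rewrite (core_edge H2) // -/cl eclc eq_sym cb'.
Qed.

End Process.

Section Rebuild.

Variables (n L V : nat).
Notation P := (2 ^ L).
Notation rep := (@rep n L).
Notation core := (@core n L).
Hypothesis nP : n <= P.
Hypothesis hV : 64 * (P * P) + 64 <= V.
Implicit Types (e : rel 'I_n) (xs : seq 'I_n).
Notation setof xs := [set x in xs].

(** What a partition into triples met by every deletion set yields, in a form that forgets the
    triples: it survives permuting the list and appending a further triple. *)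
Definition packed e (q : seq 'I_n) := forall Y, is_cvd e Y -> size q <= 3 * count [in Y] q.

Lemma packed_cvd e q : uniq q -> packed e q -> size q <= 3 * cvd_number e.
Proof.
move=> uq H; have [X [cX <- _]] := cvd_numberP e.
apply: leq_trans (H X cX) _; rewrite leq_mul2l /= -size_filter.
rewrite -(card_uniqP (filter_uniq _ uq)); apply: subset_leq_card.
by apply/subsetP => x; rewrite mem_filter => /andP[].
Qed.

Lemma rebuild_spec s e xs M : symmetric e -> core s e xs ->
  (size xs).+1 * ((3 * size xs).+1 * (2 * L + 1).+1) <= M.+1 ->
  R V M rebuild s (fun s' => exists2 ys, core s' e ys & size ys <= 3 * cvd_number e).
Proof.
move=> esym H leM; have [v1 [v2 [v3 v4]]] := nV nP hV; set k0 := size xs in leM *.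
have szn : k0 <= n := core_size H.
apply: R_seqa; rewrite /= (c_x H); first by rewrite -/k0; lia.
rewrite -/k0; set s0 := setr _ _ _.
have H0 : core s0 e xs by apply: core_frame H (_ : frame [:: eK] [::] s s0) _ _ => //;
  split=> // r; rewrite inE /s0 /= => /negbTE->.
(* [p] is still to be treated and [q] has been kept; each of the [j] treated positions has
   contributed at most three vertices to [q]. *)
pose I j s' := [/\ j <= k0, rg s' eK = k0 - j & exists p q : seq 'I_n,
  [/\ core s' e (p ++ q), size p = k0 - j, size q <= 3 * j & packed e q]].
pose M' := ((3 * k0).+1 * (2 * L + 1).+1).-1.
have EM' : M'.+1 = (3 * k0).+1 * (2 * L + 1).+1 by [].
have leM' m : m <= (3 * k0).+1 -> m * (2 * L + 1).+1 <= M'.+1 by move=> le; rewrite EM' leq_mul2r le orbT.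
have le1 : 2 * L + 1 <= M' by rewrite -ltnS EM' leq_pmull.
apply: (@R_whl _ _ M' k0 _ _ _ I).
- by rewrite EM'.
- by rewrite /I subn0; split=> //; exists xs, [::]; rewrite cats0; split=> // Y _; lia.
- move=> j s1 [F1 G1] [p1 p2 [p [q [Hc szp szq pk]]]] /=; rewrite p2 => nz.
  have ltj : j < k0 by rewrite ltnNge; apply: contra nz; rewrite -subn_eq0.
  split=> //.
  have [h Eh Eh'] := subn_ex ltj.
  case/lastP: p szp Hc => [|p x]; first by rewrite Eh.
  rewrite size_rcons Eh cat_rcons => -[szp] Hc.
  set zs := p ++ x :: q in Hc.
  have szz : size zs = h + (size q).+1 by rewrite size_cat szp.
  have le2 : size zs + 2 <= 3 * k0 by lia.
  have szzn := core_size Hc.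
  apply: R_seqa; rewrite /= p2 Eh subn1 /=; first lia.
  have xe : ar s1 aX 0 h = x.
    have lth : h < size zs by rewrite szz addnS ltnS leq_addr.
    by rewrite (c_xa Hc x lth) /zs nth_cat szp ltnn subnn.
  apply: R_seqa; rewrite /= xe; first by have := ltn_ord x; lia.
  set s2 := setr _ _ _.
  have H2 : core s2 e zs by apply: core_frame Hc (_ : frame [:: eK; gX] [::] s1 s2) _ _ => //;
    split=> // r; rewrite !inE negb_or /s2 /= => /andP[/negbTE-> /negbTE->].
  have xz : x \in zs by rewrite mem_cat inE eqxx orbT.
  apply: R_seqm; [exact: le1|exact: (process_spec nP hV esym H2 xz)|] => s3 [F3 G3] [H3 b].
  have [g3X g3K] : rg s3 gX = x /\ rg s3 eK = h by rewrite !F3.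
  apply: R_ite => /= pf; last first.
    rewrite pf in b; have [a [c [eA eB na nc [ac bd]]]] := b.
    apply: R_seqa; rewrite /= eA; first by have := ltn_ord a; lia.
    set s4 := setr _ _ _.
    have H4 : core s4 e zs by apply: core_frame H3 (_ : frame [:: eW] [::] s3 s4) _ _ => //;
      split=> // r; rewrite inE /s4 /= => /negbTE->.
    apply: R_seqm; [exact: leqnn|apply: (enter_spec nP hV H4 na) => //|].
      by apply: leM'; lia.
    move=> s5 [F5 G5] H5.
    have g5B : rg s5 pB = c by rewrite F5.
    apply: R_seqa; rewrite /= g5B; first by have := ltn_ord c; lia.
    set s6 := setr _ _ _.
    have H6 : core s6 e (rcons zs a) by apply: core_frame H5 (_ : frame [:: eW] [::] s5 s6) _ _ => //;
      split=> // r; rewrite inE /s6 /= => /negbTE->.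
    have nc' : c \notin rcons zs a by rewrite mem_rcons inE negb_or eq_sym ac.
    apply: R_call; first apply: (enter_spec nP hV H6 nc') => //.
      by apply: leM'; rewrite size_rcons; lia.
    move=> s7 [F7 G7] H7; split=> //.
      by rewrite F7 // /s6 /= F5 // /s4 /= g3K Eh'.
    exists p, (rcons (rcons (x :: q) a) c); rewrite -rcons_cat -rcons_cat in H7 *.
    split=> //; rewrite ?Eh' //; first by rewrite !size_rcons /=; lia.
    move=> Y cY; have := pk Y cY; have := bd Y cY.
    rewrite -!cats1 !count_cat !size_cat /= /= !addn0.
    by case: (x \in Y); case: (a \in Y); case: (c \in Y) => //= _; clear; lia.
  rewrite (negbTE pf) in b; have [El lc] := b.
  apply: R_seqa; rewrite /= g3X; first by have := ltn_ord x; lia.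
  set s4 := setr _ _ _.
  have H4 : core s4 e zs by apply: core_frame H3 (_ : frame [:: eW] [::] s3 s4) _ _ => //;
    split=> // r; rewrite inE /s4 /= => /negbTE->.
  apply: R_call; first apply: (leave_spec nP hV esym H4) => //.
  + by rewrite szp.
  + by apply: leM'; rewrite -/zs; lia.
  move=> s5 [F5 G5] [q' pq H5]; split=> //; first by rewrite F5 // /s4 /= g3K Eh'.
  exists p, q'; split=> //; rewrite ?Eh' //; first by rewrite (perm_size pq) (leq_trans szq) // leq_mul2l leqnSn orbT.
  by move=> Y cY; rewrite (perm_size pq) (permP pq); apply: pk.
- move=> j s1 _ [p1 p2 [p [q [Hc szp szq pk]]]] /=; rewrite p2 => /eqP z.
  have p0 : p = [::] by apply: size0nil; rewrite szp.
  by rewrite p0 in Hc; exists q => //; apply: packed_cvd pk; exact: c_u Hc.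
Qed.

(** An edge with both ends in the deletion set concerns neither a cluster nor a set of exceptions,
    so only two entries of the adjacency matrix change. *)
Lemma toggle_edge_core s e e' xs (u v : 'I_n) b : core s e xs -> u \in xs -> v \in xs ->
  rg s rU = u -> rg s rV = v -> u != v ->
  (forall x y, e' x y = if ((x == u) && (y == v)) || ((x == v) && (y == u)) then b else e x y) ->
  R V 0 (Sq (Sto aA (EVar rU) (EVar rV) (ECst b)) (Sto aA (EVar rV) (EVar rU) (ECst b))) s
    (fun s' => core s' e' xs).
Proof.
move=> H uin vin eU eV uv He; have [v1 [v2 [v3 v4]]] := nV nP hV.
apply: R_seqs; rewrite /=; first by case: b {He}; lia.
apply: R_sto; rewrite /=; first by case: b {He}; lia.
rewrite eU eV; set s' := seta _ _ _ _ _.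
have Ee x : Es e' (setof xs) (ar s aC 0) x = Es e (setof xs) (ar s aC 0) x.
  apply/setP => w; rewrite !inE He; case wx: (w \in xs) => //=; case: ifP => //.
  by case/orP => /andP[_ /eqP E]; rewrite E ?uin ?vin in wx.
split; rewrite /s' /=; try by case: H.
- move=> x y; rewrite He.
  have val a c : (nat_of_ord a == nat_of_ord c) = (a == c :> 'I_n) by exact: (inj_eq val_inj).
  have vu : (v == u) = false by apply/negbTE; rewrite eq_sym.
  rewrite !val vu; case: (eqVneq x v) => [->|nv] /=.
    by rewrite vu val /=; case: ifP => // _; rewrite (c_adj H).
  rewrite orbF; case: (eqVneq x u) => [->|nu] /=; last exact: c_adj H _ _.
  by rewrite val; case: ifP => // _; rewrite (c_adj H).
- by move=> x; rewrite Ee; exact: c_E H x.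
- by move=> x nx; rewrite Ee; exact: c_clu H x nx.
Qed.

Lemma toggle_spec s e e' xs (u v : 'I_n) (b : bool) M : core s e xs ->
  rg s rU = u -> rg s rV = v -> u != v ->
  (forall x y, e' x y = if ((x == u) && (y == v)) || ((x == v) && (y == u)) then b else e x y) ->
  (size xs).+2 * (2 * L + 1).+1 <= M.+1 ->
  R V M (toggle b) s (fun s' => exists2 ys, core s' e' ys & size ys <= size xs + 2).
Proof.
move=> H eU eV uv He leM; have [v1 [v2 [v3 v4]]] := nV nP hV.
have lea m : m <= (size xs).+2 -> m * (2 * L + 1).+1 <= M.+1.
  by move=> le; apply: leq_trans leM; rewrite leq_mul2r le orbT.
have one s1 r (w : 'I_n) ys : core s1 e ys -> rg s1 r = w -> size ys <= (size xs).+1 ->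
   R V M (Ite (ELd aI (ECst 0) (EVar r)) Nop (Sq (Asg eW (EVar r)) enter)) s1
   (fun s' => exists zs, [/\ core s' e zs, w \in zs, {subset ys <= zs} & size zs <= (size ys).+1]).
  move=> H1 er sz; apply: R_ite; rewrite /= er (c_in H1).
    by case wy: (w \in ys) => //= _; apply: R_nop; exists ys; split; rewrite ?leqnSn.
  case wy: (w \in ys) => //= _.
  apply: R_seqa; rewrite /= er; first by have := ltn_ord w; lia.
  set s2 := setr _ _ _.
  have H2 : core s2 e ys by apply: core_frame H1 (_ : frame [:: eW] [::] s1 s2) _ _ => //;
    split=> // r'; rewrite inE /s2 /= => /negbTE->.
  apply: R_call; first apply: (enter_spec nP hV H2 (negbT wy)) => //; first by apply: lea.
  move=> s3 _ H3; exists (rcons ys w); split=> //.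
  - by rewrite mem_rcons inE eqxx.
  - by move=> z zy; rewrite mem_rcons inE zy orbT.
  - by rewrite size_rcons.
apply: R_seqm; [exact: leqnn|apply: (one _ _ u xs) => //|] => s1 [F1 G1] [ys [H1 uy sub1 sz1]].
apply: R_seqm; [exact: leqnn|apply: (one _ _ v ys) => //|] => [|s2 [F2 G2] [zs [H2 vz sub2 sz2]]].
  by rewrite F1.
apply: R_mono; [|apply: (toggle_edge_core (u := u) (v := v) (b := b) (e' := e') H2)|] => //.
- exact: sub2.
- by rewrite F2 // F1.
- by rewrite F2 // F1.
- by move=> s3 _ H3; exists zs => //; lia.
Qed.

End Rebuild.

(** * The kernel *)

Section TwinKernel.

Variables (T : finType) (e : rel T).
Hypothesis esym : symmetric e.
Implicit Types (F W S Y : {set T}).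

Definition path3 a b c := [&& a != c, e a b, e b c & ~~ e a c].

Definition cvd_on W S := forall a b c, path3 a b c -> a \in W -> b \in W -> c \in W ->
  [|| a \in S, b \in S | c \in S].

Lemma cvd_onT Y : is_cvd e Y <-> cvd_on setT Y.
Proof.
split=> [/cvdP H a b c /and4P[ac ab bc nac] _ _ _|H].
  apply: contraT; rewrite !negb_or => /and3P[na nb nc].
  by rewrite (H a b c) in nac.
apply/cvdP => // a b c na nb nc ac ab bc; apply: contraT => nac.
have := H a b c; rewrite /path3 ac ab bc nac !inE => /(_ isT isT isT isT).
by rewrite (negbTE na) (negbTE nb) (negbTE nc).
Qed.

Variables (F W S : {set T}) (K : nat).
Hypothesis WF : forall w, w \in W -> w \notin F.
Hypothesis forced : forall Y, is_cvd e Y -> #|Y| <= K -> F \subset Y.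
Hypothesis leK : cvd_number e <= K.

(* [Tw] consists of true twins of [v] in [e - F], whose other neighbours in [W]
   lie in [Nb]. *)
Hypothesis outer : forall v, v \notin W -> v \notin F ->
  (forall a b c, path3 a b c -> a \notin F -> b \notin F -> c \notin F ->
     [&& a != v, b != v & c != v]) \/
  exists Tw Nb : {set T}, [/\ Tw \subset W, #|Nb| < #|Tw|,
    forall u, u \in Tw -> e v u,
    forall u z, u \in Tw -> z \notin F -> z != u -> z != v -> e u z = e v z &
    forall u z, u \in Tw -> z \in W -> e u z -> (z \in Tw) || (z \in Nb)].

Hypothesis SW : S \subset W.
Hypothesis cvdS : cvd_on W S.
Hypothesis minS : forall S', cvd_on W S' -> #|S| <= #|S'|.

Lemma cvd_on_forced Y : is_cvd e Y -> #|Y| <= K -> cvd_on W (Y :\: F).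
Proof.
move=> /cvd_onT H le a b c p /WF aF /WF bF /WF cF; rewrite !inE aF bF cF /=.
by apply: H p _ _ _; rewrite inE.
Qed.

(** If [S] contained all of [Tw], trading [Tw] for the smaller [Nb] would contradict minimality: a
    path that only [Tw] had met and that avoids [Nb] would stay within the clique [Tw]. So some twin
    of [v] survives [S]. *)
Lemma twin_outside v : v \notin W -> v \notin F ->
  (exists a b c, path3 a b c /\ [/\ a \notin F, b \notin F, c \notin F & ~~ [&& a != v, b != v & c != v]]) ->
  exists2 u, u \in W :\: S & [/\ e v u & forall z, z \notin F -> z != u -> z != v -> e u z = e v z].
Proof.
move=> vW vF [a [b [c [p [aF bF cF hv]]]]].
case: (outer vW vF) => [/(_ a b c p aF bF cF) h|[Tw [Nb [sub lt adj tw nb]]]].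
  by rewrite h in hv.
case: (boolP (Tw \subset S)) => [TS|/subsetPn[u uT uS]]; last first.
  exists u; first by rewrite inE uS (subsetP sub).
  by split=> [|z]; [exact: adj|exact: tw].
have tclq x y : x \in Tw -> y \in Tw -> x != y -> e x y.
  move=> xT yT xy; rewrite tw ?adj //; first by apply: WF; apply: (subsetP sub).
    by rewrite eq_sym.
  by apply: contraNneq vW => <-; apply: (subsetP sub).
suff : #|S| <= #|S :\: Tw :|: (Nb :&: W)|.
  rewrite leqNgt => /negP[]; apply: leq_ltn_trans (leq_card_setU _ _) _.
  rewrite (cardsDS TS) -[X in _ < X](subnK (subset_leq_card TS)) ltn_add2l.
  exact: leq_ltn_trans (subset_leq_card (subsetIl Nb W)) lt.
apply: minS => x y z q xW yW zW; apply: contraT; rewrite !inE xW yW zW !andbT.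
rewrite !negb_or !negb_and !negbK => /and3P[/andP[hx nx] /andP[hy ny] /andP[hz nz]].
have /and4P[xz exy eyz nxz] := q.
have nbr r t : r \in Tw -> t \in W -> e r t -> t \notin Nb -> t \in Tw.
  by move=> rT tW ert /negbTE nN; have := nb r t rT tW ert; rewrite nN orbF.
have yT : y \in Tw.
  have := cvdS q xW yW zW.
  case/or3P => tS; move: hx hy hz; rewrite ?tS ?orbF => hx hy hz //.
    by apply: nbr exy ny.
  by apply: (nbr z) => //; rewrite esym.
have xT : x \in Tw by apply: (nbr y) => //; rewrite esym.
have zT : z \in Tw by apply: (nbr y).
by rewrite tclq in nxz.
Qed.

Lemma path3C a b c : path3 a b c = path3 c b a.
Proof. by rewrite /path3 eq_sym (esym a b) (esym b c) (esym a c) (andbCA (e b a)). Qed.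

Notation out a := ((a \notin F) && (a \notin S)).

Lemma replace_end a b c : path3 a b c -> out a -> out b -> out c ->
  exists2 a', path3 a' b c & out a' && (a' \in W).
Proof.
move=> p oa ob oc; case: (boolP (a \in W)) => aW; first by exists a; rewrite ?oa.
have /andP[aF aS] := oa; have /andP[bF bS] := ob; have /andP[cF cS] := oc.
have [|u] := @twin_outside a aW aF.
  by exists a, b, c; split=> //; rewrite eqxx.
rewrite inE => /andP[uS uW] [au tw].
have /and4P[ac ab bc nac] := p.
have uc : u != c by apply: contraNneq nac => <-.
have ba : b != a by apply: contraNneq nac => <-.
have [cu ca] : c != u /\ c != a by rewrite eq_sym uc eq_sym.
have ub : u != b by apply: contraNneq nac => E; rewrite -(tw c cF cu ca) E.
have bu : b != u by rewrite eq_sym.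
exists u; last by rewrite uS uW WF.
by rewrite /path3 uc (tw b bF bu ba) (tw c cF cu ca) ab bc.
Qed.

Lemma replace_mid a b c : path3 a b c -> out a -> out b -> out c ->
  exists2 b', path3 a b' c & out b' && (b' \in W).
Proof.
move=> p oa ob oc; case: (boolP (b \in W)) => bW; first by exists b; rewrite ?ob.
have /andP[aF aS] := oa; have /andP[bF bS] := ob; have /andP[cF cS] := oc.
have [|u] := @twin_outside b bW bF.
  by exists a, b, c; split=> //; rewrite eqxx andbF.
rewrite inE => /andP[uS uW] [bu tw].
have /and4P[ac ab bc nac] := p.
have cb : c != b by apply: contraNneq nac => ->.
have ab' : a != b by apply: contraNneq nac => ->.
have uc : c != u.
  by apply: contraNneq nac => E; rewrite -(E) in tw bu; rewrite esym (tw a) // 1?esym //.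
have ua : a != u.
  by apply: contraNneq nac => E; rewrite -(E) in tw; rewrite (tw c) // eq_sym.
exists u; last by rewrite uS uW WF.
by rewrite /path3 ac nac (esym a) (tw a aF ua ab') (tw c cF uc cb) (esym b a) ab bc.
Qed.

(** An induced path avoiding [S] and [F] is moved into [W] by replacing its middle and then its two
    ends with surviving twins, but there [S] meets it. For minimality, an optimal set contains [F],
    and what it has besides [F] solves the problem on [W]. *)
Lemma kernel_min : is_min_cvd e (S :|: F).
Proof.
have c2 : is_cvd e (S :|: F).
  apply/cvd_onT => a b c p _ _ _; apply: contraT; rewrite !inE !negb_or.
  rewrite (andbC (a \notin S)) (andbC (b \notin S)) (andbC (c \notin S)) => /and3P[oa ob oc].
  have [b' p1 /andP[ob' bW]] := replace_mid p oa ob oc.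
  have [a' p2 /andP[oa' aW]] := replace_end p1 oa ob' oc.
  rewrite path3C in p2.
  have [c' p3 /andP[oc' cW]] := replace_end p2 oc ob' oa'.
  have := cvdS p3 cW bW aW.
  have /andP[_ /negbTE->] := oa'; have /andP[_ /negbTE->] := ob'.
  by have /andP[_ /negbTE->] := oc'.
apply/min_cvd_card; split=> //.
have [Y [cY eY _]] := cvd_numberP e.
have lY : #|Y| <= K by rewrite eY.
have FY := forced cY lY.
rewrite -eY; apply: leq_trans (leq_card_setU S F) _.
have := minS (cvd_on_forced cY lY); have := cardsD Y F; rewrite (setIidPr FY).
by have := subset_leq_card FY; lia.
Qed.

Lemma kernel_card : #|S| <= cvd_number e.
Proof.
have [Y [cY eY _]] := cvd_numberP e.
have lY : #|Y| <= K by rewrite eY.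
by rewrite -eY; apply: leq_trans (minS (cvd_on_forced cY lY)) (subset_leq_card (subsetDl Y F)).
Qed.

End TwinKernel.

(** * Choosing defaults and recognising forced vertices *)

Notation vT := 44 (only parsing).
Notation vF := 45 (only parsing).
Notation vQ := 46 (only parsing).
Notation vI := 49 (only parsing).

Local Open Scope stm_scope.

(** A default with more than [|X|] exceptions is replaced by none only if this creates at most [|X|]
    new ones. Otherwise no default is good: any other one would make exceptions of the more than
    [|X|] neighbours in this cluster. *)
Definition eval_home : stm :=
  Ite ($vT < aT@[$gX, #1])
    (gC ::= aC@[#0, $gX] ;;
     Ite ($gC < $rP) (rdb rN ;; pM ::= $wR ;; rdb gX ;;
       Ite ($vT < $pM - $wR) Nop flip) Nop) Nop.

(** Without a default the exceptions are the neighbours. A default cluster with at most [|X|]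
    exceptions misses at most [|X|] neighbours, so it contains one of any [|X| + 1] of them, and it
    suffices to try their clusters. [vQ] is the successor of the cluster found, [0] meaning none. *)
Definition eval_search : stm :=
  vQ ::= #0 ;;
  Ite ($vT < aT@[$gX, #1])
    (Ite (aC@[#0, $gX] < $rP) Nop (
      gR ::= #0 ;;
      Whl ($gR < $vT + #1) (
        selr ;; gC ::= aC@[#0, $sI] ;; rdb rN ;; pM ::= $wR ;; rdb gX ;;
        Ite ($vT < (aT@[$gX, #1] - $wR) + ($pM - $wR)) Nop (vQ ::= $gC + #1) ;;
        gR ::= $gR + #1))) Nop.

(* Looks for a default cluster for [gX] with few exceptions. *)
Definition evaluate : stm :=
  vT ::= $rX ;; eval_home ;; eval_search ;;
  Ite $vQ (gC ::= $vQ - #1 ;; flip) Nop ;;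
  vF ::= aT@[$gX, #1] < $vT + #1.

Definition evaluate_all : stm :=
  vI ::= #0 ;;
  Whl ($vI < $rX) (gX ::= aX@[#0, $vI] ;; evaluate ;; aO[< #0, $vI >] ::= $vF ;; vI ::= $vI + #1).

Local Close Scope stm_scope.

Section Eval.

Variables (n L V : nat).
Notation P := (2 ^ L).
Notation rep := (@rep n L).
Notation rank := (@rank n L).
Notation core := (@core n L).
Hypothesis nP : n <= P.
Hypothesis hV : 64 * (P * P) + 64 <= V.
Implicit Types (cl : nat -> nat) (e : rel 'I_n) (xs : seq 'I_n).
Notation setof xs := [set x in xs].

Definition dev e xs cl (x : 'I_n) h : {set 'I_n} :=
  [set w | (w \notin xs) && (e x w != (cl w == h))].

Lemma Es_dev e xs cl x : x \in xs -> Es e (setof xs) cl x = dev e xs cl x (cl x).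
Proof.
move=> xin; apply/setP => w; rewrite !inE; case wx : (w \in xs) => //=.
by rewrite (_ : w != x) //; apply: contraFneq wx => ->.
Qed.

Lemma dev_ext e xs cl cl' x h : (forall w : 'I_n, w \notin xs -> cl' w = cl w) ->
  dev e xs cl' x h = dev e xs cl x h.
Proof.
by move=> E; apply/setP => w; rewrite !inE; case wx : (w \in xs) => //=; rewrite E ?wx.
Qed.

Definition heavy e xs cl x := forall h, size xs < #|dev e xs cl x h|.

(* In [G - Y] the neighbours of [x] form a clique, hence meet at most one
   cluster, to which [x] is then completely joined: [dev] is contained in [Y]. *)
Lemma heavy_forced s e xs (x : 'I_n) Y : symmetric e -> core s e xs -> x \in xs ->
  heavy e xs (ar s aC 0) x -> is_cvd e Y -> #|Y| <= size xs -> x \in Y.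
Proof.
move=> esym H xin hx cY le; apply: contraT => nx; set cl := ar s aC 0 in hx.
move/cvdP: cY => cY.
have nwx w : w \notin xs -> w != x by apply: contraNneq => ->.
case: (pickP [pred w : 'I_n | [&& w \notin xs, w \notin Y & e x w]]) => [a /and3P[na aY xa]|Hn].
  have := hx (cl a); rewrite ltnNge => /negP[]; apply: leq_trans le.
  apply: subset_leq_card; apply/subsetP => w; rewrite !inE => /andP[nw dw].
  apply: contraT => wY; case: (eqVneq w a) => [E|wa]; first by rewrite E xa eqxx in dw.
  have eaw : e a w = (cl w == cl a) by rewrite (core_edge H) // 1?eq_sym // eq_sym.
  case xw : (e x w) dw => /=; rewrite -eaw.
    by rewrite (cY a x w) // 1?eq_sym // esym.
  case aw : (e a w) => // _.
  by have := cY x a w nx aY wY; rewrite eq_sym nwx // xw; auto.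
(* All neighbours outside [xs] lie in [Y]. They are the exceptions to having no default, which is
   what [P] stands for. *)
have := hx P; rewrite ltnNge => /negP[]; apply: leq_trans le.
apply: subset_leq_card; apply/subsetP => w; rewrite !inE => /andP[nw].
rewrite (ltn_eqF (c_cl H nw)); case xw : (e x w) => // _.
by apply: contraT => wY; have := Hn w; rewrite /= nw wY xw.
Qed.

Lemma card_block_split cl (A : {set 'I_n}) c :
  #|A| = #|[set w : 'I_n in A | cl w == c]| + #|[set w : 'I_n in A | cl w != c]|.
Proof. exact: card_sep. Qed.

(** The neighbours outside cluster [c] stay exceptions and the non-neighbours inside become
    exceptions; the right side consists of counts that the program reads off the trees. *)
Lemma dev_card s e xs (x : 'I_n) c : core s e xs -> x \in xs -> ar s aC 0 x = P -> c < P ->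
  #|dev e xs (ar s aC 0) x c| =
  (#|Es e (setof xs) (ar s aC 0) x| - #|[set w in Es e (setof xs) (ar s aC 0) x | ar s aC 0 w == c]|)
  + #|blk e xs (ar s aC 0) x c|.
Proof.
move=> H xin; set cl := ar s aC 0 => eP lc.
rewrite {1}(card_block_split cl (Es _ _ _ _) c) addKn (card_block_split cl (dev _ _ _ _ _) c) addnC.
congr (_ + _); apply: eq_card => w; rewrite !inE.
  case wx : (w \in xs) => //=; rewrite eP (ltn_eqF (c_cl H (negbT wx))).
  rewrite (_ : w != x) /=; last by apply: contraFneq wx => ->.
  by case: (cl w == c); rewrite ?andbF //= !andbT.
case wx : (w \in xs) => //=; rewrite ?andbF // eP (ltn_eqF (c_cl H (negbT wx))).
rewrite (_ : w != x) /=; last by apply: contraFneq wx => ->.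
by case: (cl w == c); rewrite ?andbF //= !andbT; case: (e x w).
Qed.

Lemma eval_home_spec s e xs (x : 'I_n) M : core s e xs -> x \in xs -> rg s gX = x ->
  rg s vT = size xs -> (size xs).+1 * (2 * L + 1).+1 <= M.+1 ->
  R V M eval_home s (fun s' => [/\ core s' e xs, forall y : 'I_n, y != x -> ar s' aC 0 y = ar s aC 0 y &
    [\/ #|Es e (setof xs) (ar s' aC 0) x| <= size xs, ar s' aC 0 x = P |
        ar s' aC 0 x < P /\ heavy e xs (ar s' aC 0) x]]).
Proof.
move=> H xin eX' eT leM; have [v1 [v2 [v3 v4]]] := nV nP hV; have xn := ltn_ord x.
set cl := ar s aC 0; set X := setof xs.
have vE : valid L cl (Es e X cl x) by apply: core_valid H (Es_sub _ _ _ _).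
have rt := rs_val (c_E H x); rewrite cnt_root // -/X -/cl in rt.
have le1 : 2 * L + 1 <= M by rewrite -ltnS; apply: leq_trans leM; rewrite leq_pmull.
apply: R_ite => /=; rewrite eT eX' rt eqb0 ?negbK -?leqNgt => lt; last first.
  by apply: R_nop; split=> //; apply: Or31.
have lP := c_clP H x; rewrite -/cl in lP.
apply: R_seqa; rewrite /= eX'; first by rewrite -/cl; lia.
rewrite -/cl; set s1 := setr _ _ _.
have H1 : core s1 e xs by apply: core_frame H (_ : frame [:: gC] [::] s s1) _ _ => //;
  split=> // r; rewrite inE /s1 /= => /negbTE->.
apply: R_ite => /=; rewrite (c_p H) eqb0 ?negbK -?leqNgt => lc; last first.
  by apply: R_nop; split=> //; apply: Or32; apply/eqP; rewrite eqn_leq lP lc.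
apply: (counts_spec nP hV (e := e) (xs := xs) (x := x)) => //= s2 Fr H2 eM eR.
rewrite -/cl in eM eR; have [F2 G2] := Fr.
have hC : ar s2 aC = ar s aC by rewrite G2.
have [g2X g2C g2T] : [/\ rg s2 gX = x, rg s2 gC = cl x & rg s2 vT = size xs] by rewrite !F2.
have eB := blk_card nP e xs cl x (cl x).
apply: R_ite => /=; rewrite g2T eM eR -eB eqb0 ?negbK -?leqNgt => ltb.
  apply: R_nop; split; rewrite ?hC //; apply: Or33; split=> // h.
  case: (eqVneq h (cl x)) => [->|nh]; first by rewrite -Es_dev.
  apply: leq_trans ltb _; apply: subset_leq_card; apply/subsetP => w /blkP[nw ec exw].
  by rewrite inE nw exw // -/cl ec eqxx [_ == h]eq_sym (negbTE nh).
apply: R_call; first apply: (flip_spec nP hV (e := e) (xs := xs) (x := x)) => //.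
- by rewrite g2C.
- by rewrite g2C hC; left.
- by apply: leq_trans leM; rewrite g2C hC leq_mul2r ltnS ltb orbT.
- move=> s3 _ [H3 ec oc]; split=> //; first by move=> y /oc->; rewrite hC.
  by apply: Or32; rewrite ec g2C hC eqxx.
Qed.

Lemma eval_search_spec s e xs (x : 'I_n) M : core s e xs -> x \in xs -> rg s gX = x ->
  rg s vT = size xs -> (size xs).+2 * (2 * L + 1).+1 <= M.+1 ->
  [\/ #|Es e (setof xs) (ar s aC 0) x| <= size xs, ar s aC 0 x = P |
        ar s aC 0 x < P /\ heavy e xs (ar s aC 0) x] ->
  R V M eval_search s (fun s' => core s' e xs /\
    ((rg s' vQ = 0 /\ (size xs < #|Es e (setof xs) (ar s aC 0) x| -> heavy e xs (ar s aC 0) x)) \/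
     exists c, [/\ rg s' vQ = c.+1, c < P, ar s aC 0 x = P & #|dev e xs (ar s aC 0) x c| <= size xs])).
Proof.
move=> H xin eX' eT leM Hc; have [v1 [v2 [v3 v4]]] := nV nP hV; have xn := ltn_ord x.
set cl := ar s aC 0 in Hc *; set X := setof xs in Hc *.
have szn : size xs <= n := core_size H.
have vE : valid L cl (Es e X cl x) by apply: core_valid H (Es_sub _ _ _ _).
have rt := rs_val (c_E H x); rewrite cnt_root // -/X -/cl in rt.
apply: R_seqa; rewrite //=; set s1 := setr _ _ _.
have H1 : core s1 e xs by apply: core_frame H (_ : frame [:: vQ] [::] s s1) _ _ => //;
  split=> // r; rewrite inE /s1 /= => /negbTE->.
apply: R_ite => /=; rewrite eT eX' rt eqb0 ?negbK -?leqNgt => lt; last first.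
  by apply: R_nop; split=> //; left; split=> //; rewrite ltnNge lt.
apply: R_ite => /=; rewrite eX' (c_p H) eqb0 ?negbK -?leqNgt => lc.
  apply: R_nop; split=> //; left; split=> // _.
  case: Hc => [le|E|[_ //]]; first by rewrite ltnNge le in lt.
  by move: lc; rewrite -/cl E ltnn.
have clx : cl x = P by apply/eqP; rewrite eqn_leq lc (c_clP H x).
apply: R_seqa; rewrite //=; set s2 := setr _ _ _.
have H2 : core s2 e xs by apply: core_frame H1 (_ : frame [:: gR] [::] s1 s2) _ _ => //;
  split=> // r; rewrite inE /s2 /= => /negbTE->.
pose I j s' := [/\ core s' e xs, rg s' gR = j, j <= (size xs).+1 &
  (rg s' vQ = 0 /\ forall w : 'I_n, w \in Es e X cl x -> rank cl (Es e X cl x) w < j ->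
     size xs < #|dev e xs cl x (cl w)|) \/
  exists c, [/\ rg s' vQ = c.+1, c < P & #|dev e xs cl x c| <= size xs]].
apply: (@R_whl _ _ (2 * L + 1) (size xs).+1 _ _ _ I) => //.
- by split=> //; left.
- move=> j s3 [F3 G3] [H3 p1 p2 p3] /=.
  have [g3X g3T] : rg s3 gX = x /\ rg s3 vT = size xs by rewrite !F3.
  have hC3 : ar s3 aC = ar s aC by rewrite G3.
  have hT3 : ar s3 aT = ar s aT by rewrite G3.
  rewrite p1 g3T addn1 eqb0 negbK => ltj; split=> //.
  apply: R_seqm; [exact: leqnn|apply: (selr_spec nP hV (cl := cl) (E := Es e X cl x)) => //=|].
  + exact: c_n H3.
  + exact: c_p H3.
  + by rewrite g3X; lia.
  + by rewrite p1; lia.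
  + by rewrite g3X hT3; exact: c_E H x.
  + by rewrite p1; apply: leq_trans lt.
  move=> s4 [F4 G4] [w [ew wE rw]]; rewrite p1 in rw.
  have hC4 : ar s4 aC = ar s aC by rewrite G4.
  have [nw nwx exw] := EsP wE.
  have lcw : cl w < P by exact: c_cl H w nw.
  apply: R_seqa; rewrite /= ew hC4 -/cl; first by lia.
  set s5 := setr _ _ _.
  have H5 : core s5 e xs.
    have Fr : frame (rmods selr ++ [:: gC]) [::] s3 s5.
      split=> [r|z _]; last by rewrite /s5 /= G4.
      rewrite mem_cat negb_or => /andP[n1]; rewrite inE => n2.
      by rewrite /s5 /= (negbTE n2) F4.
    exact: core_frame H3 Fr _ _.
  have g5X : rg s5 gX = x by rewrite /s5 /= F4.
  apply: (counts_spec nP hV (e := e) (xs := xs) (x := x)) => // s6 Fr6 H6 eM eR.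
  have [F6 G6] := Fr6.
  have hC5 : ar s5 aC 0 = cl by rewrite /s5 /= hC4.
  rewrite hC5 /= in eM eR.
  have [g6X g6T [g6C g6R g6Q]] : [/\ rg s6 gX = x, rg s6 vT = size xs &
      [/\ rg s6 gC = cl w, rg s6 gR = j & rg s6 vQ = rg s3 vQ]].
    by rewrite !F6 //= !F4.
  have rt6 : ar s6 aT x 1 = #|Es e X cl x| by rewrite G6 //= G4 // hT3.
  have eD : (ar s6 aT x 1 - rg s6 wR) + (rg s6 pM - rg s6 wR) = #|dev e xs cl x (cl w)|.
    by rewrite (dev_card H) // -/cl -/X rt6 eR eM (blk_card nP).
  apply: (@R_seqm _ _ 0 _ _ _ _ (fun s7 => core s7 e xs /\
     (if #|dev e xs cl x (cl w)| <= size xs then rg s7 vQ = (cl w).+1 else rg s7 vQ = rg s3 vQ))) => //.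
    apply: R_ite => /=; rewrite g6T g6X eD eqb0 ?negbK -?leqNgt => ltd.
      by apply: R_nop; rewrite leqNgt ltd.
    apply: R_asg; rewrite /= g6C addn1; first by lia.
    rewrite ltd; split=> //; apply: core_frame H6 (_ : frame [:: vQ] [::] s6 _) _ _ => //.
    by split=> // r; rewrite inE /= => /negbTE->.
  move=> s7 [F7 G7] [H7 q7].
  have g7R : rg s7 gR = j by rewrite F7.
  apply: R_asg; rewrite /= g7R addn1; first by lia.
  have Hf : core (setr s7 gR j.+1) e xs.
    apply: core_frame H7 (_ : frame [:: gR] [::] s7 _) _ _ => //.
    by split=> // r; rewrite inE /= => /negbTE->.
  split=> //=; case: leqP q7 => [le|gt] ->; first by right; exists (cl w).
  case: p3 => [[e0 H0]|[c Hcc]]; last by right; exists c.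
  left; split=> // w' wE'; rewrite ltnS leq_eqVlt => /orP[/eqP E|]; last exact: H0.
  by have <- := rank_inj nP vE wE wE' (etrans rw (esym E)).
- move=> j s3 [F3 G3] [H3 p1 p2 p3] /=.
  have g3T : rg s3 vT = size xs by rewrite F3.
  rewrite p1 g3T addn1 eqb0 -leqNgt => le; split=> //.
  have Ej : j = (size xs).+1 by apply/eqP; rewrite eqn_leq p2.
  case: p3 => [[e0 H0]|[c [q1 q2 q3]]]; last by right; exists c.
  left; split=> // _ h; rewrite ltnNge; apply/negP => led.
  have [w wE [rw wh]] : exists2 w : 'I_n, w \in Es e X cl x & rank cl (Es e X cl x) w < j /\ cl w = h.
    pose B := below L cl (Es e X cl x) j.
    have cB : size xs < #|B|.
      by rewrite /B card_below // Ej.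
    case: (pickP [pred w | (w \in B) && (cl w == h)]) => [w /andP[wB /eqP wh]|Hn].
      by move: wB; rewrite inE => /andP[wE rw]; exists w.
    have : #|B| <= #|dev e xs cl x h|; last by move/(leq_trans cB); rewrite ltnNge led.
    apply: subset_leq_card; apply/subsetP => w wB.
    have := Hn w; rewrite /= wB /= => nh; move: wB; rewrite inE => /andP[wE _].
    have [nw _] := EsP wE; rewrite -/cl clx (ltn_eqF (c_cl H nw)) => exw.
    by rewrite inE nw exw nh.
  by have := H0 w wE rw; rewrite wh ltnNge led.
Qed.


Definition light e xs cl (x : 'I_n) := #|Es e (setof xs) cl x| <= size xs.

Lemma evaluate_spec s e xs (x : 'I_n) M : core s e xs -> x \in xs -> rg s gX = x ->
  (size xs).+2 * (2 * L + 1).+1 <= M.+1 ->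
  R V M evaluate s (fun s' => [/\ core s' e xs, forall y : 'I_n, y != x -> ar s' aC 0 y = ar s aC 0 y,
    rg s' vF = light e xs (ar s' aC 0) x &
    ~~ light e xs (ar s' aC 0) x -> heavy e xs (ar s' aC 0) x]).
Proof.
move=> H xin eX' leM; have [v1 [v2 [v3 v4]]] := nV nP hV; have xn := ltn_ord x.
have szn := core_size H; set X := setof xs.
have leM' : (size xs).+1 * (2 * L + 1).+1 <= M.+1.
  by apply: leq_trans leM; rewrite leq_mul2r leqnSn orbT.
apply: R_seqa; rewrite /= (c_x H); first by lia.
set s1 := setr _ _ _.
have H1 : core s1 e xs by apply: core_frame H (_ : frame [:: vT] [::] s s1) _ _ => //;
  split=> // r; rewrite inE /s1 /= => /negbTE->.
apply: R_seqm; [exact: leqnn|exact: (eval_home_spec H1 xin)|] => s2 [F2 G2] [H2 o2 h2].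
have [g2X g2T] : rg s2 gX = x /\ rg s2 vT = size xs by rewrite !F2.
apply: R_seqm; [exact: leqnn|exact: (eval_search_spec H2 xin)|] => s3 [F3 G3] [H3 h3].
have [g3X g3T] : rg s3 gX = x /\ rg s3 vT = size xs by rewrite !F3.
have hC3 : ar s3 aC = ar s2 aC by rewrite G3.
apply: (@R_seqm _ _ M _ _ _ _ (fun s4 => [/\ core s4 e xs, forall y : 'I_n, y != x -> ar s4 aC 0 y = ar s aC 0 y &
   ~~ light e xs (ar s4 aC 0) x -> heavy e xs (ar s4 aC 0) x])) => //.
  apply: R_ite => /= q; case: h3 => [[q0 h3]|[c [qc lc clx ldev]]]; rewrite ?q0 ?qc // in q.
    apply: R_seqa; rewrite /= qc subn1 /=; first by lia.
    set s5 := setr _ _ _.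
    have H5 : core s5 e xs by apply: core_frame H3 (_ : frame [:: gC] [::] s3 s5) _ _ => //;
      split=> // r; rewrite inE /s5 /= => /negbTE->.
    apply: R_call; first apply: (flip_spec nP hV H5 xin) => //.
    - by rewrite /s5 /= hC3 clx; right.
    - rewrite /s5 /= hC3; apply: leq_trans leM'; rewrite leq_mul2r ltnS; apply/orP; right.
      by apply: leq_trans ldev; rewrite (dev_card H2 xin clx lc) leq_addl.
    move=> s6 _ [H6 ec oc]; rewrite /s5 /= hC3 clx (gtn_eqF lc) in ec.
    split=> //; first by move=> y ny; rewrite oc //= hC3 o2.
    rewrite /light Es_dev // ec (@dev_ext e xs (ar s2 aC 0)) ?ldev //.
    move=> w nw; rewrite oc /s5 /= ?hC3 //; by apply: contraNneq nw => ->.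
  apply: R_nop; rewrite hC3; split=> // nl; apply: h3.
  by rewrite ltnNge.
move=> s4 [F4 G4] [H4 o4 h4].
have [g4X g4T] : rg s4 gX = x /\ rg s4 vT = size xs by rewrite !F4.
have vE : valid L (ar s4 aC 0) (Es e X (ar s4 aC 0) x) by apply: core_valid H4 (Es_sub _ _ _ _).
have rt := rs_val (c_E H4 x); rewrite cnt_root // -/X in rt.
apply: R_asg; rewrite /= g4X g4T rt addn1 ltnS; first by apply: leq_trans (leq_b1 _) _; lia.
by split=> //; apply: core_frame H4 (_ : frame [:: vF] [::] s4 _) _ _ => //;
  split=> // r; rewrite inE /= => /negbTE->.
Qed.

Lemma Es_ext e xs cl cl' (x : 'I_n) : (forall w : 'I_n, w \notin xs -> cl' w = cl w) -> cl' x = cl x ->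
  Es e (setof xs) cl' x = Es e (setof xs) cl x.
Proof.
by move=> E Ex; apply/setP => w; rewrite !inE; case wx : (w \in xs) => //=; rewrite E ?wx // Ex.
Qed.

Lemma evaluate_all_spec s e xs M : core s e xs ->
  (size xs).+1 * ((size xs).+2 * (2 * L + 1).+1) <= M.+1 ->
  R V M evaluate_all s (fun s' => core s' e xs /\ forall i x0, i < size xs ->
    ar s' aO 0 i = light e xs (ar s' aC 0) (nth x0 xs i) /\
    (~~ light e xs (ar s' aC 0) (nth x0 xs i) -> heavy e xs (ar s' aC 0) (nth x0 xs i))).
Proof.
move=> H leM; have [v1 [v2 [v3 v4]]] := nV nP hV.
have szn := core_size H; set X := setof xs.
apply: R_seqa; rewrite //=; set s1 := setr _ _ _.
have H1 : core s1 e xs by apply: core_frame H (_ : frame [:: vI] [::] s s1) _ _ => //;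
  split=> // r; rewrite inE /s1 /= => /negbTE->.
pose I j s' := [/\ core s' e xs, rg s' vI = j, j <= size xs & forall i x0, i < j ->
    ar s' aO 0 i = light e xs (ar s' aC 0) (nth x0 xs i) /\
    (~~ light e xs (ar s' aC 0) (nth x0 xs i) -> heavy e xs (ar s' aC 0) (nth x0 xs i))].
pose M' := ((size xs).+2 * (2 * L + 1).+1).-1.
apply: (@R_whl _ _ M' (size xs) _ _ _ I) => //.
- move=> j s2 [F2 G2] [H2 p1 p2 p3] /=.
  rewrite (c_x H2) p1 eqb0 negbK => ltj; split=> //.
  have [x0 _] : exists x0 : 'I_n, x0 \in xs by case: (xs) ltj => // x0 ys _; exists x0; rewrite inE eqxx.
  set x := nth x0 xs j; have xin : x \in xs by apply: mem_nth.
  apply: R_seqa; rewrite /= p1 (c_xa H2 x0) // -/x; first by have := ltn_ord x; lia.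
  set s3 := setr _ _ _.
  have H3 : core s3 e xs by apply: core_frame H2 (_ : frame [:: gX] [::] s2 s3) _ _ => //;
    split=> // r; rewrite inE /s3 /= => /negbTE->.
  apply: R_seqm; [exact: leqnn|exact: (evaluate_spec H3 xin)|] => s4 [F4 G4] [H4 o4 f4 h4].
  have g4I : rg s4 vI = j by rewrite F4.
  apply: R_seqs; rewrite /= f4; first by apply: leq_trans (leq_b1 _) _; lia.
  apply: R_asg; rewrite /= g4I addn1; first by lia.
  split=> //.
    apply: core_frame H4 (_ : frame [:: vI] [:: aO] s4 _) _ _ => //.
    by split=> r; rewrite inE /= => /negbTE->.
  move=> i y0; rewrite ltnS leq_eqVlt => /orP[/eqP->|lti] /=.
    by rewrite !eqxx !(set_nth_default x0 y0) // -/x.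
  rewrite (ltn_eqF lti); have ni : nth y0 xs i != x.
    rewrite (set_nth_default x0) ?(ltn_trans lti) // nth_uniq ?(ltn_trans lti) ?(ltn_eqF lti) //.
    exact: c_u H.
  have E1 : forall w : 'I_n, w \notin xs -> ar s4 aC 0 w = ar s2 aC 0 w.
    by move=> w nw; rewrite o4 //; apply: contraNneq nw => ->.
  have [q1 q2] := p3 i y0 lti.
  rewrite /light (Es_ext e E1 (o4 _ ni)) G4 //= q1; split=> // /q2 hv h.
  by rewrite (dev_ext _ _ _ E1).
- move=> j s2 _ [H2 p1 p2 p3] /=; rewrite (c_x H2) p1 eqb0 -leqNgt => le; split=> // i x0 lti.
  by apply: p3; apply: leq_trans le.
Qed.

End Eval.

(** * Collecting the vertices of the kernel *)

Notation kI := 50 (only parsing).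
Notation kX := 51 (only parsing).
Notation kJ := 52 (only parsing).
Notation kR := 53 (only parsing).
Notation kA := 54 (only parsing).
Notation kB := 55 (only parsing).

Local Open Scope stm_scope.

Definition push : stm :=
  Ite (aW@[#0, $kI]) Nop
    (aV[< #0, $rW >] ::= $kI ;; rW ::= $rW + #1 ;; aW[< #0, $kI >] ::= #1).

(* Puts the next vertex of cluster [gC] into the kernel. *)
Definition tok1 : stm :=
  gR ::= aP@[#0, $gC] ;; rdb rN ;;
  Ite ($gR < $wR)
    (gX ::= $rN ;; selb 0 ;; kI ::= $sI ;; push ;; aP[< #0, $gC >] ::= $gR + #1) Nop.

Definition tok3 : stm := tok1 ;; tok1 ;; tok1.

(** Three vertices are requested of a cluster once for each exception in it, and three more of the
    default cluster. A cluster may be requested many times, by the same vertex or by several; the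
    requests add up. *)
Definition build_light : stm :=
  kI ::= $kX ;; push ;; gC ::= aC@[#0, $kX] ;;
  Ite ($gC < $rP) tok3 Nop ;;
  kR ::= #0 ;;
  Whl ($kR < aT@[$kX, #1]) (
    gX ::= $kX ;; gR ::= $kR ;; selr ;; kI ::= $sI ;; push ;;
    gC ::= aC@[#0, $kI] ;; tok3 ;; kR ::= $kR + #1).

Definition build : stm :=
  rW ::= #0 ;; rH ::= #0 ;; kJ ::= #0 ;;
  Whl ($kJ < $rX) (
    kX ::= aX@[#0, $kJ] ;;
    Ite (aO@[#0, $kJ]) build_light (aH[< #0, $rH >] ::= $kX ;; rH ::= $rH + #1) ;;
    kJ ::= $kJ + #1).

Local Close Scope stm_scope.

Section Build.

Variables (n L V : nat).
Notation P := (2 ^ L).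
Notation rep := (@rep n L).
Notation rank := (@rank n L).
Notation below := (@below n L).
Notation core := (@core n L).
Hypothesis nP : n <= P.
Hypothesis hV : 64 * (P * P) + 64 <= V.
Implicit Types (cl : nat -> nat) (e : rel 'I_n) (xs kv : seq 'I_n) (tk : seq nat).
Notation setof xs := [set x in xs].

Definition clu xs cl c : {set 'I_n} := [set w in ~: setof xs | cl w == c].

(* [tk] is the list of the clusters requested so far. *)
Record kst (s : hst) e xs kv tk : Prop := Kst {
  k_w : rg s rW = size kv;
  k_u : uniq kv;
  k_v : forall i x0, i < size kv -> ar s aV 0 i = nth x0 kv i;
  k_i : forall v : 'I_n, ar s aW 0 v = (v \in kv);
  k_p : forall c, c < P -> ar s aP 0 c = minn (count_mem c tk) #|clu xs (ar s aC 0) c|;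
  k_r : forall w : 'I_n, w \notin xs ->
    rank (ar s aC 0) (clu xs (ar s aC 0) (ar s aC 0 w)) w < ar s aP 0 (ar s aC 0 w) -> w \in kv;
  k_l : forall w, w \in kv -> w \in xs -> light e xs (ar s aC 0) w }.

Lemma kst_frame s s' e xs kv tk rs as_ : kst s e xs kv tk -> frame rs as_ s s' ->
  rW \notin rs -> all (fun a => a \notin as_) [:: aV; aW; aP; aC] -> kst s' e xs kv tk.
Proof.
move=> H [F G] r1 /= /and5P[a1 a2 a3 a4 _].
by case: H => *; split; rewrite ?F ?G.
Qed.

Lemma kst_size s e xs kv tk : kst s e xs kv tk -> size kv <= n.
Proof.
by move=> H; rewrite -(card_uniqP (k_u H)) -[X in _ <= X](card_ord n) max_card.
Qed.

Definition grows kv kv' m := {subset kv <= kv'} /\ size kv' <= size kv + m.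

Lemma grows_refl kv m : grows kv kv m.
Proof. by split=> //; apply: leq_addr. Qed.

Lemma grows_trans kv1 kv2 kv3 m m' : grows kv1 kv2 m -> grows kv2 kv3 m' -> grows kv1 kv3 (m + m').
Proof.
move=> [s1 z1] [s2 z2]; split=> [w /s1/s2 //|].
by apply: leq_trans z2 _; rewrite addnA leq_add2r.
Qed.

Lemma push_spec s e xs kv tk (w : 'I_n) M : kst s e xs kv tk -> rg s kI = w ->
  (w \in xs -> light e xs (ar s aC 0) w) ->
  R V M push s (fun s' => exists kv', [/\ kst s' e xs kv' tk, w \in kv' & grows kv kv' 1]).
Proof.
move=> H eI lw; have [v1 [v2 [v3 v4]]] := nV nP hV; have wn := ltn_ord w.
have szn := kst_size H.
apply: R_ite; rewrite /= eI (k_i H); case wk : (w \in kv) => //= _.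
  by apply: R_nop; exists kv; split=> //; apply: grows_refl.
apply: R_seqs; rewrite /= eI; first by lia.
apply: R_seqa; rewrite /= (k_w H); first by lia.
apply: R_sto; rewrite /= ?eI; first by lia.
exists (rcons kv w); split; last by split; [move=> z zk; rewrite mem_rcons inE zk orbT|rewrite size_rcons addn1].
  split; rewrite /= ?size_rcons ?addn1 //.
  - by rewrite rcons_uniq wk (k_u H).
  - move=> i x0; rewrite nth_rcons ltnS leq_eqVlt; case: eqP => [->|_] /= lt; first by rewrite ltnn.
    by rewrite lt (k_v H x0 lt).
  - move=> v; rewrite mem_rcons inE (inj_eq val_inj); case: eqP => //= _; exact: k_i H v.
  - exact: k_p H.
  - by move=> v nv lt; rewrite mem_rcons inE (k_r H nv lt) orbT.
  - by move=> v; rewrite mem_rcons inE => /orP[/eqP->|vk]; [|exact: k_l H v vk].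
by rewrite mem_rcons inE eqxx.
Qed.

Lemma cluE xs cl (w : 'I_n) : w \notin xs -> w \in clu xs cl (cl w).
Proof. by move=> nw; rewrite !inE nw eqxx. Qed.

Lemma tok1_spec s e xs kv tk : core s e xs -> kst s e xs kv tk -> rg s gC < P ->
  R V (2 * L + 1) tok1 s (fun s' => core s' e xs /\
    exists2 kv', kst s' e xs kv' (rg s gC :: tk) & grows kv kv' 1).
Proof.
move=> H Hk lc; have [v1 [v2 [v3 v4]]] := nV nP hV; set c := rg s gC in lc *.
set cl := ar s aC 0.
suff : R V (2 * L + 1) tok1 s (fun s' => exists2 kv', kst s' e xs kv' (c :: tk) & grows kv kv' 1).
  move=> /R_call; apply=> s' FG [kv' Hk' g]; split; last by exists kv'.
  exact: core_frame H FG _ _.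
have mle : #|clu xs cl c| <= n by rewrite -[X in _ <= X](card_ord n) max_card.
have [eN eP] := (c_n H, c_p H).
have vC : valid L cl (clu xs cl c).
  by apply: core_valid H _; apply/subsetP => w; rewrite inE => /andP[].
have gp := k_p Hk lc; rewrite -/cl in gp; set g := ar s aP 0 c in gp.
have gle : g <= n by rewrite gp geq_min mle orbT.
apply: R_seqa; rewrite /= -/c -/g; first by lia.
apply: R_seqm; [exact: leqnn|apply: (rdb_spec nP hV (cl := cl) (S := ~: setof xs)) => //=|].
- by rewrite eN; lia.
- by rewrite eN; exact: c_M H.
move=> s1 [F1 G1] /= r1; rewrite -/c -/(clu xs cl c) in r1.
have [g1N g1P [g1C g1R g1W]] : [/\ rg s1 rN = n, rg s1 rP = P & [/\ rg s1 gC = c, rg s1 gR = g & rg s1 rW = size kv]].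
  by rewrite !F1 //= (k_w Hk).
have G1' a : ar s1 a = ar s a by rewrite G1.
have Hk1 : kst s1 e xs kv tk.
  apply: kst_frame Hk (_ : frame (rmods (rdb rN) ++ [:: gR]) [::] s s1) _ _ => //.
  split=> [r|a _]; last by rewrite G1'.
  by rewrite mem_cat negb_or => /andP[n1]; rewrite inE => n2; rewrite F1 //= (negbTE n2).
apply: R_ite; rewrite /= g1R r1; case: ltnP => //= lt _; last first.
  apply: R_nop; exists kv; last exact: grows_refl.
  case: (Hk1) => *; split=> // c' lc'; rewrite (k_p Hk1 lc') /= ; case: (c =P c') => //= <-.
  have := gp; rewrite G1' -/cl add1n; move: lt; rewrite -/(clu xs cl c); move: #|clu xs cl c| (count_mem c tk) => m t.
  by lia.
apply: R_seqa; rewrite /= g1N; first by lia.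
set s2 := setr _ _ _.
apply: R_seqm; [exact: leqnn|apply: (selb_spec nP hV (m := 0) (cl := cl) (E := ~: setof xs) (S0 := ~: setof xs)) => //=|].
- by lia.
- by rewrite g1R; lia.
- by rewrite g1C.
- by rewrite G1'; exact: c_M H.
- by apply: core_valid H (subxx _).
- by left.
- by rewrite g1R g1C.
move=> s3 [F3 G3] /= [w [ew wC rw]]; rewrite g1C -/(clu xs cl c) in wC rw; rewrite g1R in rw.
have /andP[nw /eqP clw] : (w \notin xs) && (cl w == c) by move: wC; rewrite !inE.
apply: R_seqa; rewrite /= ew; first exact: (ordV nP hV).
set s4 := setr _ _ _.
have Hk4 : kst s4 e xs kv tk.
  apply: kst_frame Hk1 (_ : frame (rmods (selb 0) ++ [:: gX; kI]) [::] s1 s4) _ _ => //.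
  split=> [r|a _]; last by rewrite /s4 /= G3.
  rewrite mem_cat negb_or => /andP[n1]; rewrite !inE negb_or => /andP[n2 n3].
  by rewrite /s4 /= (negbTE n3) F3 //= (negbTE n2).
apply: R_seqm; [exact: leq0n|apply: (push_spec _ (w := w) Hk4) => //|].
  by move=> wx; rewrite wx in nw.
move=> s5 [F5 G5] [kv' [Hk5 wk g5]].
have [g5C g5R] : rg s5 gC = c /\ rg s5 gR = g by rewrite !F5 // /s4 /= !F3.
have hC5 : ar s5 aC 0 = cl by rewrite G5 // /s4 /= G3 //= G1'.
have hP5 : ar s5 aP 0 c = g by rewrite G5 // /s4 /= G3 //= G1'.
apply: R_sto; rewrite /= g5R addn1; first by lia.
rewrite g5C; exists kv' => //.
case: (Hk5) => *; split=> //=.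
- move=> c' lc'; rewrite /= ; case: (eqVneq c' c) => [->|nc].
    rewrite ?eqxx hC5 add1n; have := gp; move: lt; rewrite -/(clu xs cl c); move: #|clu xs cl c| (count_mem c tk) => m t.
    by lia.
  by rewrite (k_p Hk5 lc').
- move=> v nv /=; rewrite hC5; case: (eqVneq (cl v) c) => [ec|nc]; last first.
    by have := k_r Hk5 nv; rewrite hC5; exact.
  rewrite ec ltnS leq_eqVlt => /orP[/eqP E|lt'].
    have vCv : v \in clu xs cl c by rewrite -ec cluE.
    by rewrite (rank_inj nP vC vCv wC (etrans E (esym rw))).
  by have := k_r Hk5 nv; rewrite hC5 ec hP5; exact.
Qed.

Lemma tok3_spec s e xs kv tk : core s e xs -> kst s e xs kv tk -> rg s gC < P ->
  R V (2 * L + 1) tok3 s (fun s' => core s' e xs /\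
    exists2 kv', kst s' e xs kv' [:: rg s gC, rg s gC, rg s gC & tk] & grows kv kv' 3).
Proof.
move=> H Hk lc.
apply: R_seqm; [exact: leqnn|exact: tok1_spec H Hk lc|] => s1 [F1 G1] [H1 [kv1 Hk1 g1]].
have e1 : rg s1 gC = rg s gC by rewrite F1.
apply: R_seqm; [exact: leqnn|apply: (tok1_spec H1 Hk1)|]; rewrite e1 // => s2 [F2 G2] [H2 [kv2 Hk2 g2]].
have e2 : rg s2 gC = rg s gC by rewrite F2.
apply: R_call; first apply: (tok1_spec H2 Hk2); rewrite e2 // => s3 _ [H3 [kv3 Hk3 g3]].
split=> //; exists kv3 => //.
exact: grows_trans g1 (grows_trans g2 g3).
Qed.

(** The weight of [x] at cluster [c]. Summed over the light vertices it bounds the exceptions in [c]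
    together with the light vertices whose default is [c], that is, all that distinguishes vertices
    of [c] or is adjacent to it from outside. *)
Definition need e xs cl (x : 'I_n) c := #|[set w in Es e (setof xs) cl x | cl w == c]| + (cl x == c).

Lemma build_light_spec s e xs kv tk (x : 'I_n) M : core s e xs -> kst s e xs kv tk ->
  rg s kX = x -> x \in xs -> light e xs (ar s aC 0) x ->
  (size xs).+1 * (2 * L + 1).+1 <= M.+1 ->
  R V M build_light s (fun s' => core s' e xs /\
    exists kv' tk', [/\ kst s' e xs kv' tk', grows kv kv' (4 * (size xs).+1), x \in kv',
      forall w, w \in Es e (setof xs) (ar s aC 0) x -> w \in kv' &
      forall c, c < P -> count_mem c tk + 3 * need e xs (ar s aC 0) x c <= count_mem c tk']).
Proof.
move=> H Hk eX' xin lx leM; have [v1 [v2 [v3 v4]]] := nV nP hV; have xn := ltn_ord x.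
set cl := ar s aC 0 in lx *; set X := setof xs.
have le1 : 2 * L + 1 <= M by rewrite -ltnS; apply: leq_trans leM; rewrite leq_pmull.
have lP := c_clP H x; rewrite -/cl in lP.
apply: R_seqa; rewrite /= eX'; first by lia.
set s1 := setr _ _ _.
have Fr1 : frame [:: kI] [::] s s1 by split=> // r; rewrite inE /s1 /= => /negbTE->.
have H1 : core s1 e xs by apply: core_frame H Fr1 _ _.
have Hk1 : kst s1 e xs kv tk by apply: kst_frame Hk Fr1 _ _.
apply: R_seqm; [exact: leq0n|apply: (push_spec _ (w := x) Hk1) => //|] => s2 FG2 [kv2 [Hk2 xk2 g2]].
have H2 : core s2 e xs by apply: core_frame H1 FG2 _ _.
have [F2 G2] := FG2.
have g2X : rg s2 kX = x by rewrite F2.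
have hC2 : ar s2 aC = ar s aC by rewrite G2.
apply: R_seqa; rewrite /= g2X hC2 -/cl; first by lia.
set s3 := setr _ _ _.
have Fr3 : frame [:: gC] [::] s2 s3 by split=> // r; rewrite inE /s3 /= => /negbTE->.
have H3 : core s3 e xs by apply: core_frame H2 Fr3 _ _.
have Hk3 : kst s3 e xs kv2 tk by apply: kst_frame Hk2 Fr3 _ _.
apply: (@R_seqm _ _ (2 * L + 1) _ _ _ _ (fun s4 => core s4 e xs /\ exists kv4 tk4,
   [/\ kst s4 e xs kv4 tk4, grows kv kv4 4, x \in kv4 &
     forall c, c < P -> count_mem c tk + 3 * (cl x == c) <= count_mem c tk4])) => //.
  apply: R_ite => /=; rewrite (c_p H2) eqb0 ?negbK -?leqNgt => lc.
    apply: R_call; first exact: (tok3_spec H3 Hk3).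
    move=> s4 _ [H4 [kv4 Hk4 g4]]; split=> //; exists kv4; eexists; split; [exact: Hk4| | |].
    - exact: grows_trans g2 g4.
    - by apply: (proj1 g4).
    - by move=> c _ /=; move: (cl x == c) => b; lia.
  apply: R_nop; split=> //; exists kv2, tk; split=> //.
  - by have := grows_trans g2 (grows_refl kv2 3).
  - by move=> c lc'; rewrite (gtn_eqF (leq_trans lc' lc)) addn0.
move=> s4 [F4 G4] [H4 [kv4 [tk4 [Hk4 g4 xk4 ct4]]]].
have g4X : rg s4 kX = x by rewrite F4 //= F2.
have hC4 : ar s4 aC = ar s aC by rewrite G4 //= G2.
apply: R_seqa; rewrite //=; set s5 := setr _ _ _.
have Fr5 : frame [:: kR] [::] s4 s5 by split=> // r; rewrite inE /s5 /= => /negbTE->.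
have H5 : core s5 e xs by apply: core_frame H4 Fr5 _ _.
have Hk5 : kst s5 e xs kv4 tk4 by apply: kst_frame Hk4 Fr5 _ _.
set E := Es e X cl x in lx.
have vE : valid L cl E by apply: core_valid H (Es_sub _ _ _ _).
have cE : #|E| <= size xs by exact: lx.
pose I j s' := [/\ core s' e xs, rg s' kR = j, j <= #|E| & exists kv' tk',
  [/\ kst s' e xs kv' tk', grows kv kv' (4 * j.+1), x \in kv',
      {subset below cl E j <= kv'} &
      forall c, c < P -> count_mem c tk + 3 * (#|[set w in below cl E j | cl w == c]| + (cl x == c))
        <= count_mem c tk']].
apply: (@R_whl _ _ (2 * L + 1) #|E| _ _ _ I).
- by apply: leq_trans leM; rewrite leq_mul2r ltnS cE orbT.
- split=> //; exists kv4, tk4; split=> //; first by move=> w; rewrite below0 inE.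
  move=> c lc; rewrite below0 (_ : [set w in set0 | _] = set0) ?cards0 ?add0n; first exact: ct4.
  by apply/setP => w; rewrite !inE.
- move=> j s6 [F6 G6] [H6 p1 p2 [kv6 [tk6 [Hk6 g6 xk6 sb6 ct6]]]] /=.
  have g6X : rg s6 kX = x by rewrite F6.
  have hC6 : ar s6 aC = ar s aC by rewrite G6.
  have rt6 := rs_val (c_E H6 x); rewrite hC6 -/cl -/X -/E cnt_root // in rt6.
  rewrite g6X rt6 p1 eqb0 negbK => ltj; split=> //.
  have szn := core_size H.
  apply: R_seqa; rewrite /= g6X; first by lia.
  apply: R_seqa; rewrite /= p1; first by lia.
  set s7 := setr _ _ _.
  apply: R_seqm; [exact: leqnn|apply: (selr_spec nP hV (cl := cl) (E := E)) => //=|].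
  + exact: c_n H6.
  + exact: c_p H6.
  + by lia.
  + by lia.
  + by have := c_E H6 x; rewrite hC6.
  move=> s8 [F8 G8] /= [w [ew wE rw]].
  have [nw _ _] := EsP wE.
  have hC8 : ar s8 aC = ar s aC by rewrite G8.
  apply: R_seqa; rewrite /= ew; first exact: (ordV nP hV).
  set s9 := setr _ _ _.
  have Fr9 : frame (rmods selr ++ [:: gX; gR; kI]) [::] s6 s9.
    split=> [r|a _]; last by rewrite /s9 /= G8.
    rewrite mem_cat negb_or => /andP[n1]; rewrite !inE !negb_or => /and3P[n2 n3 n4].
    by rewrite /s9 /= (negbTE n4) F8 // /s7 /= (negbTE n3) (negbTE n2).
  have H9 : core s9 e xs by apply: core_frame H6 Fr9 _ _.
  have Hk9 : kst s9 e xs kv6 tk6 by apply: kst_frame Hk6 Fr9 _ _.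
  have g9 : rg s9 kX = x /\ rg s9 kR = j by rewrite !(proj1 Fr9).
  apply: R_seqm; [exact: leq0n|apply: (push_spec _ (w := w) Hk9) => //|].
    by move=> wx; rewrite wx in nw.
  move=> s10 FG10 [kv10 [Hk10 wk10 g10]].
  have H10 : core s10 e xs by apply: core_frame H9 FG10 _ _.
  have [F10 G10] := FG10.
  have hC10 : ar s10 aC = ar s aC by rewrite G10.
  have g10I : rg s10 kI = w by rewrite F10 // /s9 /= ew.
  have lcw : cl w < P by exact: c_cl H w nw.
  apply: R_seqa; rewrite /= g10I hC10 -/cl; first by clear -lcw v2; lia.
  set s11 := setr _ _ _.
  have Fr11 : frame [:: gC] [::] s10 s11 by split=> // r; rewrite inE /s11 /= => /negbTE->.
  have H11 : core s11 e xs by apply: core_frame H10 Fr11 _ _.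
  have Hk11 : kst s11 e xs kv10 tk6 by apply: kst_frame Hk10 Fr11 _ _.
  apply: R_seqm; [exact: leqnn|apply: (tok3_spec H11 Hk11) => //|].
  move=> s12 [F12 G12] [H12 [kv12 Hk12 g12]].
  have g12R : rg s12 kR = j by rewrite F12 // /s11 /= F10 //; case: g9.
  apply: R_asg; rewrite /= g12R addn1; first by apply: leq_trans (leq_trans ltj cE) _; lia.
  set s13 := setr _ _ _.
  have Fr13 : frame [:: kR] [::] s12 s13 by split=> // r; rewrite inE /s13 /= => /negbTE->.
  have [eb nb] := belowS nP vE wE rw.
  split=> //; first by apply: core_frame H12 Fr13 _ _.
  have cE' : rg s11 gC = cl w by [].
  exists kv12; eexists; split; [exact: (kst_frame Hk12 Fr13)| | | |].
  + have := grows_trans g6 (grows_trans g10 g12).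
    by rewrite (_ : 4 * j.+1 + (1 + 3) = 4 * j.+2) // [4 * j.+2]mulnS addnC.
  + by apply: (proj1 g12); apply: (proj1 g10).
  + move=> z; rewrite eb inE => /orP[|zb]; first by rewrite inE => /eqP->; apply: (proj1 g12).
    by apply: (proj1 g12); apply: (proj1 g10); apply: sb6.
  + move=> c lc; rewrite cE' /=; have := ct6 c lc.
    have : #|[set w0 in below cl E j.+1 | cl w0 == c]| <= #|[set w0 in below cl E j | cl w0 == c]| + (cl w == c).
      have [ec|nc] := eqVneq (cl w) c.
        apply: leq_trans (_ : #|w |: [set w0 in below cl E j | cl w0 == c]| <= _).
          apply: subset_leq_card; apply/subsetP => z; rewrite inE eb !in_setU1 => /andP[/orP[->//|zb] zc].
          by apply/orP; right; rewrite inE zb zc.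
        by rewrite cardsU1 addnC leq_add2l leq_b1.
      rewrite addn0; apply: subset_leq_card; apply/subsetP => z.
      rewrite inE eb in_setU1 => /andP[/orP[/eqP->|zb] zc]; first by rewrite zc in nc.
      by rewrite inE zb.
    move: (cl w == c) (cl x == c) (#|_|) (#|_|) (count_mem c tk) (count_mem c tk6); clear; lia.
- move=> j s6 [F6 G6] [H6 p1 p2 [kv6 [tk6 [Hk6 g6 xk6 sb6 ct6]]]] /=.
  have g6X : rg s6 kX = x by rewrite F6.
  have hC6 : ar s6 aC = ar s aC by rewrite G6.
  have rt6 := rs_val (c_E H6 x); rewrite hC6 -/cl -/X -/E cnt_root // in rt6.
  rewrite g6X rt6 p1 eqb0 -leqNgt => le.
  rewrite below_all // in sb6 ct6; split=> //; exists kv6, tk6; split=> //.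
  case: g6 => z1 z2; split=> //; apply: leq_trans z2 _.
  by rewrite leq_add2l leq_mul2l /= ltnS (leq_trans p2).
Qed.

End Build.

(** * Writing the kernel graph, clearing scratch data, and correctness of the kernel *)

Local Open Scope stm_scope.

Definition edges : stm :=
  rE ::= #0 ;; kA ::= #0 ;;
  Whl ($kA < $rW) (
    kB ::= #0 ;;
    Whl ($kB < $kA) (
      Ite (aA@[aV@[#0, $kA], aV@[#0, $kB]])
        (aK[< #0, #2 + #2 * $rE >] ::= $kA ;; aK[< #0, #3 + #2 * $rE >] ::= $kB ;; rE ::= $rE + #1) Nop ;;
      kB ::= $kB + #1) ;;
    kA ::= $kA + #1) ;;
  aK[< #0, #0 >] ::= $rW ;; aK[< #0, #1 >] ::= $rE.

(** Only the entries of kernel vertices and of their clusters are cleared, since sweeping the arrays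
    would take time linear in [n]. Likewise [wipe] clears exactly the cells that the previous kernel
    graph occupies. *)
Definition reset : stm :=
  kA ::= #0 ;;
  Whl ($kA < $rW) (
    kB ::= aV@[#0, $kA] ;; aW[< #0, $kB >] ::= #0 ;; aP[< #0, aC@[#0, $kB] >] ::= #0 ;;
    kA ::= $kA + #1).

Definition wipe : stm :=
  kA ::= #0 ;;
  Whl ($kA < #2 + #2 * $rE) (aK[< #0, $kA >] ::= #0 ;; kA ::= $kA + #1).

Local Close Scope stm_scope.

Section Build2.

Variables (n L V : nat).
Notation P := (2 ^ L).
Notation rep := (@rep n L).
Notation rank := (@rank n L).
Notation below := (@below n L).
Notation core := (@core n L).
Notation kst := (@kst n L).
Hypothesis nP : n <= P.
Hypothesis hV : 64 * (P * P) + 64 <= V.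
Implicit Types (cl : nat -> nat) (e : rel 'I_n) (xs kv : seq 'I_n) (tk : seq nat).
Notation setof xs := [set x in xs].

Definition flags s e xs := forall i x0, i < size xs ->
    ar s aO 0 i = light e xs (ar s aC 0) (nth x0 xs i) /\
    (~~ light e xs (ar s aC 0) (nth x0 xs i) -> heavy e xs (ar s aC 0) (nth x0 xs i)).

Lemma build_spec s e xs M : core s e xs -> flags s e xs ->
  (forall c, c < P -> ar s aP 0 c = 0) -> (forall v : 'I_n, ar s aW 0 v = 0) ->
  (size xs).+1 * ((size xs).+1 * (2 * L + 1).+1) <= M.+1 ->
  R V M build s (fun s' => core s' e xs /\ exists kv tk,
    let cl := ar s' aC 0 in let hv := [seq x <- xs | ~~ light e xs cl x] in
    [/\ kst s' e xs kv tk, rg s' rH = size hv /\ (forall i x0, i < size hv -> ar s' aH 0 i = nth x0 hv i),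
      (forall x, x \in xs -> light e xs cl x -> x \in kv /\ {subset Es e (setof xs) cl x <= kv}),
      (forall c, c < P -> 3 * \sum_(x <- xs | light e xs cl x) need e xs cl x c <= count_mem c tk) &
      size kv <= size xs * (4 * (size xs).+1)]).
Proof.
move=> H Hf Hp Hw leM; have [v1 [v2 [v3 v4]]] := nV nP hV.
have szn := core_size H; set X := setof xs; set cl := ar s aC 0.
do 3!(apply: R_seqa; rewrite //=).
set s1 := setr _ _ _.
have Fr1 : frame [:: rW; rH; kJ] [::] s s1.
  by split=> // r; rewrite !inE !negb_or /s1 /= => /and3P[/negbTE-> /negbTE-> /negbTE->].
have H1 : core s1 e xs by apply: core_frame H Fr1 _ _.
pose hv j := [seq x <- take j xs | ~~ light e xs cl x].
pose I j s' := [/\ core s' e xs, rg s' kJ = j, j <= size xs & exists kv tk,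
    [/\ kst s' e xs kv tk, rg s' rH = size (hv j) /\ (forall i x0, i < size (hv j) -> ar s' aH 0 i = nth x0 (hv j) i),
      (forall x, x \in take j xs -> light e xs cl x -> x \in kv /\ {subset Es e X cl x <= kv}),
      (forall c, c < P -> 3 * \sum_(x <- take j xs | light e xs cl x) need e xs cl x c <= count_mem c tk) &
      size kv <= j * (4 * (size xs).+1)]].
pose M' := ((size xs).+1 * (2 * L + 1).+1).-1.
apply: (@R_whl _ _ M' (size xs) _ _ _ I) => //.
- split=> //; exists [::], [::]; rewrite /hv take0; split=> //.
  + split=> //.
    * by move=> c lc; rewrite min0n; exact: Hp.
    * by move=> w nw; rewrite /s1 /= Hp //; exact: c_cl H w nw.
  + by move=> c lc; rewrite big_nil muln0.
- move=> j s2 [F2 G2] [H2 p1 p2 [kv2 [tk2 [Hk2 [ph1 ph2] pl pc pz]]]] /=.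
  rewrite (c_x H2) p1 eqb0 negbK => ltj; split=> //.
  have [x0 _] : exists x0 : 'I_n, x0 \in xs by case: (xs) ltj => // x0 ys _; exists x0; rewrite inE eqxx.
  set x := nth x0 xs j; have xin : x \in xs by apply: mem_nth.
  have hC2 : ar s2 aC = ar s aC by rewrite G2.
  have hO2 : ar s2 aO = ar s aO by rewrite G2.
  apply: R_seqa; rewrite /= p1 (c_xa H2 x0) // -/x; first by have := ltn_ord x; lia.
  set s3 := setr _ _ _.
  have Fr3 : frame [:: kX] [::] s2 s3 by split=> // r; rewrite inE /s3 /= => /negbTE->.
  have H3 : core s3 e xs by apply: core_frame H2 Fr3 _ _.
  have Hk3 : kst s3 e xs kv2 tk2 by apply: kst_frame Hk2 Fr3 _ _.
  have [fO hO] := Hf j x0 ltj; rewrite -/x -/cl in fO hO.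
  have tkx : take j.+1 xs = rcons (take j xs) x by rewrite (take_nth x0).
  have hvS : hv j.+1 = if light e xs cl x then hv j else rcons (hv j) x.
    by rewrite /hv tkx filter_rcons; case: light.
  have hvn : size (hv j) <= size xs.
    by rewrite size_filter (leq_trans (count_size _ _)) // size_take; case: ltnP => // /ltnW.
  apply: (@R_seqm _ _ M' _ _ _ _ (fun s' => core s' e xs /\ exists kv tk,
    [/\ kst s' e xs kv tk, rg s' rH = size (hv j.+1) /\ (forall i y0, i < size (hv j.+1) -> ar s' aH 0 i = nth y0 (hv j.+1) i),
      (forall y, y \in take j.+1 xs -> light e xs cl y -> y \in kv /\ {subset Es e X cl y <= kv}),
      (forall c, c < P -> 3 * \sum_(y <- take j.+1 xs | light e xs cl y) need e xs cl y c <= count_mem c tk) &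
      size kv <= j.+1 * (4 * (size xs).+1)])) => //.
    apply: R_ite => /=; rewrite p1 hO2 fO hvS; case: (boolP (light e xs cl x)) => lx //= _.
      apply: R_call; first apply: (build_light_spec nP hV H3 Hk3 (x := x)) => //.
        by rewrite /s3 /= hC2.
      move=> s4 [F4 G4] [H4 [kv4 [tk4 [Hk4 g4 xk4 sb4 ct4]]]]; split=> //; exists kv4, tk4.
      rewrite /s3 /= hC2 -/cl -/X in sb4 ct4.
      split=> //.
      + split; first by rewrite F4.
        by move=> i y0 lti; rewrite G4 //; apply: ph2.
      + move=> y; rewrite tkx mem_rcons inE => /orP[/eqP->|yt] ly; first by split=> // w /sb4.
        have [a1 a2] := pl y yt ly; split; first exact: (proj1 g4).
        by move=> w /a2; apply: (proj1 g4).
      + move=> c lc; rewrite tkx -cats1 big_cat /= big_cons lx big_nil addn0.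
        by rewrite mulnDr; apply: leq_trans (ct4 c lc); rewrite leq_add2r; apply: pc.
      + apply: leq_trans (proj2 g4) _; rewrite mulSn addnC leq_add2l.
        exact: pz.
    have nx : x \notin take j xs.
      have : uniq (take j xs ++ x :: drop j.+1 xs) by rewrite -drop_nth // cat_take_drop (c_u H).
      by rewrite cat_uniq /= negb_or => /and3P[_ /andP[-> _] _].
    apply: R_seqs; rewrite /= ?eqxx; first by have := ltn_ord x; lia.
    apply: R_asg; rewrite /= ph1; first by lia.
    set s4 := setr _ _ _.
    have Fr4 : frame [:: rH] [:: aH] s3 s4 by split=> r; rewrite inE /s4 /= => /negbTE->.
    split; first by apply: core_frame H3 Fr4 _ _.
    exists kv2, tk2; split=> //.
    + by apply: kst_frame Hk3 Fr4 _ _.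
    + rewrite /= size_rcons addn1; split=> // i y0; rewrite nth_rcons ltnS leq_eqVlt.
      case: eqP => [->|_] /= lt; first by rewrite ltnn.
      by rewrite lt (ph2 i y0).
    + move=> y; rewrite tkx mem_rcons inE => /orP[/eqP->|]; first by rewrite (negbTE lx).
      exact: pl.
    + by move=> c lc; rewrite tkx -cats1 big_cat /= big_cons (negbTE lx) big_nil addn0; apply: pc.
    + by apply: leq_trans pz _; rewrite leq_mul2r leqnSn orbT.
  move=> s4 [F4 G4] [H4 h4].
  have g4J : rg s4 kJ = j by rewrite F4.
  apply: R_asg; rewrite /= g4J addn1; first by lia.
  set s5 := setr _ _ _.
  have Fr5 : frame [:: kJ] [::] s4 s5 by split=> // r; rewrite inE /s5 /= => /negbTE->.
  split=> //; first by apply: core_frame H4 Fr5 _ _.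
  have [kv4 [tk4 [Hk4 [h41 h42] h43 h44 h45]]] := h4.
  by exists kv4, tk4; split=> //; apply: kst_frame Hk4 Fr5 _ _.
- move=> j s2 [F2 G2] [H2 p1 p2 [kv2 [tk2 [Hk2 [ph1 ph2] pl pc pz]]]] /=.
  rewrite (c_x H2) p1 eqb0 -leqNgt => le; split=> //.
  have hC2 : ar s2 aC = ar s aC by rewrite G2.
  have Ej : j = size xs by apply/eqP; rewrite eqn_leq p2.
  exists kv2, tk2; rewrite /= hC2 -/cl.
  by move: ph1 ph2 pl pc pz; rewrite /hv Ej take_size.
Qed.

Definition pairs (E : rel nat) k := flatten [seq [seq (a, b) | b <- iota 0 a & E a b] | a <- iota 0 k].

Definition flat (es : seq (nat * nat)) := flatten [seq [:: p.1; p.2] | p <- es].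

Lemma flat_cat es1 es2 : flat (es1 ++ es2) = flat es1 ++ flat es2.
Proof. by rewrite /flat map_cat flatten_cat. Qed.

Lemma size_flat es : size (flat es) = 2 * size es.
Proof. by elim: es => //= p es IH; rewrite IH; lia. Qed.

Lemma pairs_size E k : size (pairs E k) <= k * k.
Proof.
elim: k => [|k IH] //; rewrite /pairs -addn1 iotaD map_cat flatten_cat size_cat /= cats0.
rewrite -/(pairs E k) size_map size_filter add0n.
have := count_size (E k) (iota 0 k); rewrite size_iota => le.
by apply: leq_trans (leq_add IH le) _; rewrite addn1 mulSn mulnS; move: (k * k) => q; lia.
Qed.

Lemma mem_pairs E k a b : ((a, b) \in pairs E k) = [&& b < a, a < k & E a b].
Proof.
apply/flatten_mapP/and3P => [[a' ai /mapP[b']]|[ba ak Eab]].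
  rewrite mem_filter mem_iota => /andP[E' /andP[_ lb]] [-> ->].
  by move: ai; rewrite mem_iota => /andP[_ la].
by exists a; rewrite ?mem_iota //; apply/mapP; exists b; rewrite // mem_filter Eab mem_iota.
Qed.

Lemma uniq_pairs E k : uniq (pairs E k).
Proof.
elim: k => [|k IH] //; rewrite /pairs -addn1 iotaD map_cat flatten_cat /= cats0.
rewrite -/(pairs E k) cat_uniq IH map_inj_uniq ?filter_uniq ?iota_uniq //; last by move=> ? ? [].
rewrite andbT; apply/hasPn => -[a b] /mapP[b' _ [-> _]]; rewrite /= mem_pairs.
by rewrite add0n ltnn andbF.
Qed.

(** Cells [0] and [1] stay free for the two counts, which are written after the loops. *)
Definition row0 (T : nat -> nat) es := forall j, T j = if j < 2 then 0 else nth 0 (flat es) (j - 2).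

Lemma row0_rcons T T' es a b : row0 T es ->
  T' = upd (upd T (2 + 2 * size es) a) (3 + 2 * size es) b -> row0 T' (rcons es (a, b)).
Proof.
move=> HT -> j; rewrite -cats1 flat_cat nth_cat size_flat /= HT.
set z := size es; case: (ltnP j 2) => j2.
  have f3 : (j == 3 + 2 * z) = false by rewrite ltn_eqF // (leq_trans j2).
  have f2 : (j == 2 + 2 * z) = false by rewrite ltn_eqF // (leq_trans j2).
  by rewrite f3 f2.
have e3 : (j == 3 + 2 * z) = (j - 2 - 2 * z == 1) && (2 * z <= j - 2) by lia.
have e2 : (j == 2 + 2 * z) = (j - 2 - 2 * z == 0) && (2 * z <= j - 2) by lia.
rewrite e3 e2; case: ltnP => le; rewrite ?andbT ?andbF //.
rewrite nth_default ?size_flat //.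
by case: (j - 2 - 2 * z) => [|[|k]] //=; rewrite nth_nil.
Qed.

Lemma edges_spec s e xs kv M : core s e xs -> rg s rW = size kv -> uniq kv ->
  (forall i x0, i < size kv -> ar s aV 0 i = nth x0 kv i) ->
  (forall j, ar s aK 0 j = 0) -> (size kv).+1 * (size kv).+1 <= M.+1 ->
  R V M edges s (fun s' =>
    let es := pairs (fun a b => ar s aA (ar s aV 0 a) (ar s aV 0 b) != 0) (size kv) in
    rg s' rE = size es /\ forall j, ar s' aK 0 j = nth 0 [:: size kv, size es & flat es] j).
Proof.
move=> H eW ukv Hv Hz leM; have [v1 [v2 [v3 v4]]] := nV nP hV.
have szk : size kv <= n by rewrite -(card_uniqP ukv) -[X in _ <= X](card_ord n) max_card.
set E := fun a b : nat => ar s aA (ar s aV 0 a) (ar s aV 0 b) != 0.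
have V2 : size kv * size kv + 60 <= V.
  by apply: leq_trans (_ : P * P + 60 <= _); [rewrite leq_add2r leq_mul ?(leq_trans szk)|lia].
do 2!(apply: R_seqa; rewrite //=).
pose I j s' := [/\ rg s' kA = j, j <= size kv, rg s' rE = size (pairs E j) & row0 (ar s' aK 0) (pairs E j)].
apply: (@R_seqm _ _ M _ _ _ _ (I (size kv))) => //.
  apply: (@R_whl _ _ (size kv) (size kv) _ _ _ I) => //.
  - by split=> // j; rewrite /= Hz nth_nil if_same.
  - move=> j s1 [F1 G1] [p1 p2 p3 p4] /=.
    have g1W : rg s1 rW = size kv by rewrite F1.
    rewrite p1 g1W eqb0 negbK => ltj; split=> //.
    apply: R_seqa; rewrite //=.
    pose es i := pairs E j ++ [seq (j, b) | b <- iota 0 i & E j b].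
    have esn i : i <= j -> size (es i) <= size kv * size kv.
      move=> le; rewrite size_cat size_map size_filter.
      have := pairs_size E j; have := count_size (E j) (iota 0 i); rewrite size_iota => h1 h2.
      apply: leq_trans (leq_add h2 (leq_trans h1 le)) _.
      apply: leq_trans (_ : j * j.+1 <= _); first by rewrite mulnS addnC.
      by apply: leq_mul => //; apply: ltnW.
    pose J i s' := [/\ rg s' kB = i, i <= j, rg s' rE = size (es i) & row0 (ar s' aK 0) (es i)].
    apply: (@R_seqm _ _ (size kv) _ _ _ _ (J j)) => //.
      apply: (@R_whl _ _ 0 j _ _ _ J).
      + by rewrite muln1 ltnS ltnW.
      + by rewrite /J /es /= cats0.
      + move=> i s2 [F2 G2] [q1 q2 q3 q4] /=.
        have g2A : rg s2 kA = j by rewrite F2 //= p1.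
        rewrite q1 g2A eqb0 negbK => lti; split=> //.
        have hA : ar s2 aA = ar s aA by rewrite G2 //= G1.
        have hV2 : ar s2 aV = ar s aV by rewrite G2 //= G1.
        have esS : es i.+1 = if E j i then rcons (es i) (j, i) else es i.
          rewrite /es -addn1 iotaD filter_cat map_cat /= add0n; case: (E j i); rewrite /= ?cats0 //.
          by rewrite catA cats1.
        have esz := esn i q2.
        apply: (@R_seqm _ _ 0 _ _ _ _ (fun s3 => rg s3 rE = size (es i.+1) /\ row0 (ar s3 aK 0) (es i.+1))) => //.
          have dE : E j i = (ar s aA (ar s aV 0 j) (ar s aV 0 i) != 0) by [].
          apply: R_ite => /=; rewrite g2A q1 hA hV2 esS dE; last by move=> /eqP-> /=; apply: R_nop.
          move=> ->; apply: R_seqs; rewrite /= g2A; first by lia.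
          apply: R_seqs; rewrite /= q1; first by lia.
          apply: R_asg; rewrite /= q3; first by rewrite addn1; lia.
          split; first by rewrite size_rcons addn1.
          by apply: row0_rcons q4 _; rewrite ?g2A.
        move=> s3 [F3 G3] [r1 r2].
        have g3B : rg s3 kB = i by rewrite F3.
        by apply: R_asg; rewrite /= g3B addn1; first by lia.
      + move=> i s2 [F2 G2] [q1 q2 q3 q4] /=.
        have g2A : rg s2 kA = j by rewrite F2 //= p1.
        rewrite q1 g2A eqb0 -leqNgt => le.
        by have -> : j = i by apply/eqP; rewrite eqn_leq q2 le.
    move=> s2 [F2 G2] [q1 q2 q3 q4].
    have g2A : rg s2 kA = j by rewrite F2 //= p1.
    have EE : pairs E j.+1 = es j.
      by rewrite /pairs -addn1 iotaD map_cat flatten_cat /= cats0.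
    by apply: R_asg; rewrite /= g2A addn1; [lia|split; rewrite ?EE].
  - move=> j s1 [F1 G1] Ij /=; have [p1 p2 p3 p4] := Ij.
    have g1W : rg s1 rW = size kv by rewrite F1.
    rewrite p1 g1W eqb0 -leqNgt => le.
    by have -> : size kv = j by apply/eqP; rewrite eqn_leq p2 le.
move=> s1 [F1 G1] [p1 p2 p3 p4].
have g1W : rg s1 rW = size kv by rewrite F1.
have psz := pairs_size E (size kv).
apply: R_seqs; rewrite /= g1W; first by lia.
apply: R_sto; rewrite /= p3; first by lia.
by split=> // -[|[|j]] //=; rewrite p4 /= subn2.
Qed.

Lemma reset_spec s e xs kv tk M : core s e xs -> kst s e xs kv tk -> (size kv).+1 <= M.+1 ->
  R V M reset s (fun s' => (forall v : 'I_n, ar s' aW 0 v = 0) /\ forall c, c < P -> ar s' aP 0 c = 0).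
Proof.
move=> H Hk leM; have [v1 [v2 [v3 v4]]] := nV nP hV.
have szk := kst_size Hk; set cl := ar s aC 0.
apply: R_seqa; rewrite //=.
pose I j s' := [/\ rg s' kA = j, j <= size kv,
   forall v : 'I_n, ar s' aW 0 v = (v \in drop j kv) &
   forall c, c < P -> ar s' aP 0 c = 0 \/ exists2 v, v \in drop j kv & cl v = c].
apply: (@R_whl _ _ 0 (size kv) _ _ _ I).
- by rewrite muln1.
- split=> //=; rewrite drop0; first exact: k_i Hk.
  move=> c lc; rewrite (k_p Hk lc); have [->|pos] := posnP #|clu xs (ar s aC 0) c|; first by left; rewrite minn0.
  have [->|tpos] := posnP (count_mem c tk); first by left; rewrite min0n.
  have vC : valid L cl (clu xs cl c).
    by apply: core_valid H _; apply/subsetP => w; rewrite inE => /andP[].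
  (* If [aP] is not [0] at [c], the vertex of rank [0] in this cluster is in the kernel, so the loop
     comes across [c]. *)
  have [w wC rw] := rank_ex nP vC pos.
  have /andP[nw /eqP ec] : (w \notin xs) && (cl w == c) by move: wC; rewrite !inE.
  right; exists w => //; apply: (k_r Hk nw).
  by rewrite -/cl ec rw (k_p Hk lc) leq_min tpos.
- move=> j s1 [F1 G1] [p1 p2 p3 p4] /=.
  have g1W : rg s1 rW = size kv by rewrite F1 //= (k_w Hk).
  rewrite p1 g1W eqb0 negbK => ltj; split=> //.
  have [x0 _] : exists x0 : 'I_n, x0 \in kv by case: (kv) ltj => // x0 ys _; exists x0; rewrite inE eqxx.
  have hV1 : ar s1 aV = ar s aV by rewrite G1.
  have hC1 : ar s1 aC 0 = cl by rewrite G1.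
  have dn := drop_nth x0 ltj; set x := nth x0 kv j in dn.
  have nx : x \notin drop j.+1 kv.
    by have := drop_uniq j (k_u Hk); rewrite dn /= => /andP[].
  apply: R_seqa; rewrite /= p1 hV1 (k_v Hk x0) // -/x; first by have := ltn_ord x; lia.
  apply: R_seqs; rewrite //=.
  apply: R_seqs; rewrite //=.
  apply: R_asg; rewrite /= p1 addn1; first by lia.
  split=> //= [v|c lc].
    rewrite (inj_eq val_inj); case: eqP => [->|/eqP ne]; first by rewrite (negbTE nx).
    by rewrite p3 dn inE (negbTE ne).
  rewrite hC1; case: eqP => [_|/eqP ne]; first by left.
  have [->|[v vd ec]] := p4 c lc; first by left.
  right; exists v => //; move: vd; rewrite dn inE => /orP[/eqP E|//].
  by rewrite -ec E eqxx in ne.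
- move=> j s1 [F1 G1] [p1 p2 p3 p4] /=.
  have g1W : rg s1 rW = size kv by rewrite F1 //= (k_w Hk).
  rewrite p1 g1W eqb0 -leqNgt => le; rewrite drop_oversize // in p3 p4.
  split=> [v|c lc]; first by rewrite p3.
  by have [//|[v]] := p4 c lc.
Qed.

Lemma wipe_spec s M : rg s rE * 2 + 2 <= M -> rg s rE * 2 + 4 <= V ->
  (forall j, 2 * rg s rE + 2 <= j -> ar s aK 0 j = 0) ->
  R V M wipe s (fun s' => forall j, ar s' aK 0 j = 0).
Proof.
move=> leM leV Hz.
apply: R_seqa; rewrite //=.
pose I i s' := [/\ rg s' kA = i, i <= 2 + 2 * rg s rE & forall j, j < i \/ 2 * rg s rE + 2 <= j -> ar s' aK 0 j = 0].
apply: (@R_whl _ _ 0 (2 + 2 * rg s rE) _ _ _ I).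
- by rewrite muln1 ltnS; lia.
- by split=> // j [//|le]; rewrite /= Hz.
- move=> i s1 [F1 G1] [p1 p2 p3] /=.
  have g1E : rg s1 rE = rg s rE by rewrite F1.
  rewrite p1 g1E eqb0 negbK => lti; split=> //.
  apply: R_seqs; rewrite //=.
  apply: R_asg; rewrite /= p1 addn1; first by lia.
  split=> //= j Hj; case: eqP => // ne; apply: p3; lia.
- move=> i s1 [F1 G1] [p1 p2 p3] /=.
  have g1E : rg s1 rE = rg s rE by rewrite F1.
  rewrite p1 g1E eqb0 -leqNgt => le j; apply: p3; lia.
Qed.

End Build2.

Local Open Scope stm_scope.

Definition kernel : stm := evaluate_all ;; build ;; edges ;; reset.

Definition update b : stm := wipe ;; toggle b ;; rebuild ;; kernel.

Local Close Scope stm_scope.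

Section Good.

Variables (n L V : nat).
Notation P := (2 ^ L).
Notation rank := (@rank n L).
Notation below := (@below n L).
Notation core := (@core n L).
Notation kst := (@kst n L).
Hypothesis nP : n <= P.
Hypothesis hV : 64 * (P * P) + 64 <= V.
Implicit Types (cl : nat -> nat) (e : rel 'I_n) (xs kv : seq 'I_n) (tk : seq nat).
Notation setof xs := [set x in xs].

Section Correct.

Variables (s : hst) (e : rel 'I_n) (xs kv : seq 'I_n) (tk : seq nat).
Hypotheses (esy : symmetric e) (eirr : irreflexive e).
Hypotheses (H : core s e xs) (Hk : kst s e xs kv tk).
Notation cl := (ar s aC 0).
Notation lgt := (light e xs cl).
Notation Ex := (Es e (setof xs) cl).
Hypothesis Hf : forall x, x \in xs -> ~~ lgt x -> heavy e xs cl x.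
Hypothesis Hl : forall x, x \in xs -> lgt x -> x \in kv /\ {subset Ex x <= kv}.
Hypothesis Ht : forall c, c < P -> 3 * \sum_(x <- xs | lgt x) need e xs cl x c <= count_mem c tk.

Notation hv := [seq x <- xs | ~~ lgt x].

(** For [r = xs] this is the set [Nb] used for a vertex of cluster [c]: the exceptions in [c] of
    light vertices, and the light vertices with default [c]. The list is a parameter for the sake of
    induction. *)
Definition nbc c (r : seq 'I_n) : {set 'I_n} :=
  [set z | (z \in clu xs cl c) && has [pred x | lgt x && (z \in Ex x)] r
        || [&& z \in r, lgt z & cl z == c]].

Lemma nbc_card c r : #|nbc c r| <= \sum_(x <- r | lgt x) need e xs cl x c.
Proof.
elim: r => [|x r IH]; first by rewrite big_nil leqn0 cards_eq0; apply/eqP/setP => z; rewrite !inE andbF.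
rewrite big_cons; case lx : (lgt x); last first.
  apply: leq_trans IH; apply: subset_leq_card; apply/subsetP => z.
  rewrite /nbc !in_set /= lx /= => /orP[->//|/and3P[]].
  rewrite inE => /orP[/eqP->|->] lz ->; last by rewrite lz orbT.
  by rewrite lx in lz.
pose A := [set w in Ex x | cl w == c] :|: (if cl x == c then [set x] else set0).
apply: leq_trans (_ : #|A :|: nbc c r| <= _).
  apply: subset_leq_card; apply/subsetP => z; rewrite {1}/nbc in_set /A !in_setU /= lx /=.
  case/orP => [/andP[zC /orP[zE|zh]]|/and3P[]].
  - have zc : cl z == c by move: zC; rewrite !inE => /andP[].
    by apply/orP; left; apply/orP; left; rewrite inE zE zc.
  - by apply/orP; right; rewrite inE zC zh.
  - rewrite inE => /orP[/eqP->|zr] lz zc; first by apply/orP; left; apply/orP; right; rewrite zc inE.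
    by apply/orP; right; rewrite inE zr lz zc orbT.
apply: leq_trans (leq_card_setU _ _) (leq_add _ IH).
apply: leq_trans (leq_card_setU _ _) _; rewrite leq_add2l.
by case: eqP => _; rewrite ?cards1 ?cards0.
Qed.

Lemma not_light x : x \in xs -> x \notin hv -> lgt x.
Proof. by rewrite mem_filter => ->; rewrite andbT negbK. Qed.

Lemma light_edge x u : x \in xs -> lgt x -> u \notin xs -> u \notin Ex x -> e x u = (cl u == cl x).
Proof.
move=> xin lx nu; rewrite !inE nu /=; have -> : u != x by apply: contraNneq nu => ->.
by rewrite /= negbK => /eqP.
Qed.

(** Let [t] be the total [need] at the cluster of [v]. If [t = 0], this cluster is a component of
    the graph without the forced vertices, and [v] lies on no induced path there. Otherwise, as [v]
    was left out, the cluster is not exhausted and the kernel contains at least [3 * t] of its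
    vertices; at most [t] of them are exceptions, so at least [2 * t] twins face at most [t]
    vertices of [nbc]. *)
Lemma kernel_outer v : v \notin setof kv -> v \notin setof hv ->
  (forall a b c, path3 e a b c -> a \notin setof hv -> b \notin setof hv -> c \notin setof hv ->
     [&& a != v, b != v & c != v]) \/
  exists Tw Nb : {set 'I_n}, [/\ Tw \subset setof kv, #|Nb| < #|Tw|,
    forall u, u \in Tw -> e v u,
    forall u z, u \in Tw -> z \notin setof hv -> z != u -> z != v -> e u z = e v z &
    forall u z, u \in Tw -> z \in setof kv -> e u z -> (z \in Tw) || (z \in Nb)].
Proof.
rewrite !in_set => vk vh.
have nv : v \notin xs.
  by apply: contra vk => vx; case: (Hl vx (not_light vx vh)).
set c := cl v; have lc : c < P by exact: c_cl H v nv.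
set t := \sum_(x <- xs | lgt x) need e xs cl x c.
have nvE x : x \in xs -> lgt x -> v \notin Ex x.
  by move=> xin lx; apply: contra vk; apply: (proj2 (Hl xin lx)).
have ne a b : e a b -> a != b by move=> eab; apply: contraTneq eab => ->; rewrite eirr.
case: (posnP t) => [t0|tpos].
  left=> a b d /and4P[ad eab ebd nad]; rewrite !in_set => ah bh dh.
  have need0 x : x \in xs -> lgt x -> need e xs cl x c = 0.
    move=> xin lx; move/eqP: t0; rewrite /t sum_nat_seq_eq0 => /allP/(_ x xin).
    by rewrite lx /= => /eqP.
  have nbr u z : u \notin xs -> cl u = c -> z \notin hv -> e u z -> z \notin xs /\ cl z = c.
    move=> nu ec zh euz; case: (boolP (z \in xs)) => zx.
      have lz := not_light zx zh; have /eqP := need0 z zx lz.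
      rewrite addn_eq0 cards_eq0 eqb0 => /andP[/eqP/setP/(_ u)]; rewrite [RHS]inE => hu nzc.
      have nuE : u \notin Ex z by apply/negP => uE; move: hu; rewrite inE uE ec eqxx.
      by have := light_edge zx lz nu nuE; rewrite esy euz ec eq_sym (negbTE nzc).
    by have := core_edge H nu zx (ne _ _ euz); rewrite euz ec => /esym/eqP.
  have clq p q : p \notin xs -> cl p = c -> q \notin xs -> cl q = c -> p != q -> e p q.
    by move=> np cp nq cq pq; rewrite (core_edge H) // cp cq.
  apply/and3P; split; apply/eqP => E; move/negP: nad; apply.
  - rewrite E in ah eab ad *; have [nb cb] := nbr v b nv erefl bh eab.
    by have [nd cd] := nbr b d nb cb dh ebd; apply: clq.
  - rewrite E in bh eab ebd; rewrite esy in eab.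
    have [na ca] := nbr v a nv erefl ah eab; have [nd cd] := nbr v d nv erefl dh ebd.
    exact: clq.
  - rewrite E in dh ebd ad *; rewrite esy in ebd; have [nb cb] := nbr v b nv erefl bh ebd.
    by rewrite esy in eab; have [na ca] := nbr b a nb cb ah eab; apply: clq.
right.
pose inD z := has [pred x | lgt x && (z \in Ex x)] xs.
pose Tw := [set w in clu xs cl c | (w \in kv) && ~~ inD w].
exists Tw, (nbc c xs).
have uP u : u \in Tw -> [/\ u \notin xs, cl u = c, u \in kv & forall x, x \in xs -> lgt x -> u \notin Ex x].
  rewrite !inE => /andP[/andP[nu /eqP ec] /andP[uk nD]]; split=> // x xin lx.
  by apply: contra nD => uE; apply/hasP; exists x => //=; rewrite lx.
split.
- by apply/subsetP => u /uP[_ _ uk _]; rewrite inE.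
- have vC : v \in clu xs cl c by apply: cluE.
  have val : valid L cl (clu xs cl c).
    by apply: core_valid H _; apply/subsetP => w; rewrite inE => /andP[].
  have lem : ar s aP 0 c <= rank cl (clu xs cl c) v.
    by rewrite leqNgt; apply: contra vk => lt; exact: (k_r Hk nv).
  have ltm : ar s aP 0 c < #|clu xs cl c| by exact: leq_ltn_trans lem (rank_lt _ _ vC).
  have ge3 : 3 * t <= ar s aP 0 c.
    have E := k_p Hk lc; rewrite {1}E in ltm; rewrite E.
    by have := Ht lc; move: ltm; rewrite /minn -/t; case: (ltnP (count_mem c tk)) => // _; rewrite ltnn.
  have le1 := nbc_card c xs; rewrite -/t in le1.
  suff : #|below cl (clu xs cl c) (ar s aP 0 c)| <= #|Tw :|: nbc c xs|.
    rewrite (card_below nP) //; last exact: ltnW.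
    move=> le2; have := leq_trans le2 (leq_card_setU _ _); have := leq_trans ge3 (leqnn _).
    move: #|_| #|_| (ar s aP 0 c) le1 tpos {lem ltm ge3 le2} => a b p; clear; lia.
  apply: subset_leq_card; apply/subsetP => w; rewrite inE => /andP[wC rw].
  have [nw ec] : w \notin xs /\ cl w = c by move: wC; rewrite !inE => /andP[? /eqP].
  have wk : w \in kv by apply: (k_r Hk nw); rewrite ec.
  by rewrite in_setU !inE -/(inD w) nw ec eqxx wk /=; case: (inD w); rewrite ?orbT.
- move=> u /uP[nu ec uk _]; rewrite (core_edge H) ?ec //.
  by apply: contraNneq vk => ->.
- move=> u z /uP[nu ec uk nE] zh zu zv; rewrite in_set in zh.
  case: (boolP (z \in xs)) => zx.
    have lz := not_light zx zh.
    by rewrite !(esy _ z) (light_edge zx lz nu (nE z zx lz)) (light_edge zx lz nv (nvE z zx lz)) ec.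
  by rewrite !(core_edge H) ?ec // 1?eq_sym.
- move=> u z /uP[nu ec uk nE]; rewrite in_set => zk euz.
  case: (boolP (z \in xs)) => zx.
    have lz := k_l Hk zk zx.
    have := light_edge zx lz nu (nE z zx lz); rewrite esy euz ec => /esym/eqP cz.
    by apply/orP; right; rewrite inE zx lz -cz eqxx orbT.
  have cz : cl z = c by have := core_edge H nu zx (ne _ _ euz); rewrite euz ec => /esym/eqP.
  by rewrite !inE -/(inD z) zx cz eqxx zk /=; case: (inD z); rewrite ?orbT.
Qed.

Lemma kernel_correct (S : {set 'I_n}) : S \subset setof kv -> cvd_on e (setof kv) S ->
  (forall S', cvd_on e (setof kv) S' -> #|S| <= #|S'|) ->
  is_min_cvd e (S :|: setof hv) /\ #|S| <= cvd_number e.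
Proof.
move=> SW cS mS.
have WF w : w \in setof kv -> w \notin setof hv.
  rewrite !in_set mem_filter => wk; apply/negP => /andP[nl wx].
  by rewrite (k_l Hk wk wx) in nl.
have forced Y : is_cvd e Y -> #|Y| <= size xs -> setof hv \subset Y.
  move=> cY le; apply/subsetP => x; rewrite in_set mem_filter => /andP[nl xin].
  exact: heavy_forced esy H xin (Hf xin nl) cY le.
have leK : cvd_number e <= size xs.
  apply: leq_trans (cvd_number_le (core_cvd esy H)) _.
  by rewrite cardsE card_size.
split.
  by apply: (kernel_min esy WF forced leK _ SW cS mS) => v; exact: kernel_outer.
exact: kernel_card WF leK mS.
Qed.

Lemma kernel_disjoint w : w \in kv -> w \notin hv.
Proof.
move=> wk; rewrite mem_filter; apply/negP => /andP[nl wx].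
by rewrite (k_l Hk wk wx) in nl.
Qed.

End Correct.

Definition kedge s := fun a b => ar s aA (ar s aV 0 a) (ar s aV 0 b) != 0.

(** [s_ok] is all that a query has to know: it no longer refers to clusters or to light vertices.
    [s_W], [s_P] and the zeros that [s_K] gives beyond the kernel graph let the next update start
    with clean arrays. *)
Record stored (s : hst) e xs kv (hv : seq 'I_n) : Prop := Stored {
  s_core : core s e xs;
  s_xs : size xs <= 3 * cvd_number e;
  s_w : rg s rW = size kv;
  s_u : uniq kv;
  s_v : forall i x0, i < size kv -> ar s aV 0 i = nth x0 kv i;
  s_size : size kv <= size xs * (4 * (size xs).+1);
  s_h : rg s rH = size hv;
  s_hu : uniq hv;
  s_hv : forall i x0, i < size hv -> ar s aH 0 i = nth x0 hv i;
  s_disj : forall w, w \in kv -> w \notin hv;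
  s_e : rg s rE = size (pairs (kedge s) (size kv));
  s_K : forall j, ar s aK 0 j =
          nth 0 [:: size kv, size (pairs (kedge s) (size kv)) & flat (pairs (kedge s) (size kv))] j;
  s_W : forall v : 'I_n, ar s aW 0 v = 0;
  s_P : forall c, c < P -> ar s aP 0 c = 0;
  s_ok : forall S : {set 'I_n}, S \subset setof kv -> cvd_on e (setof kv) S ->
    (forall S', cvd_on e (setof kv) S' -> #|S| <= #|S'|) ->
    is_min_cvd e (S :|: setof hv) /\ #|S| <= cvd_number e }.

Definition good s e := exists xs kv hv, stored s e xs kv hv.

(** The first summand covers the evaluation of defaults and the collection of vertices. The second
    one counts pairs of kernel vertices, of which there are at most [x * (4 * x.+1)], since all
    pairs are tested for adjacency. *)
Definition kcost x := x.+2 * (x.+2 * (2 * L + 1).+1) + (x * (4 * x.+1)).+1 * (x * (4 * x.+1)).+1.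

Lemma kernel_spec s e xs M : symmetric e -> irreflexive e -> core s e xs -> size xs <= 3 * cvd_number e ->
  (forall v : 'I_n, ar s aW 0 v = 0) -> (forall c, c < P -> ar s aP 0 c = 0) ->
  (forall j, ar s aK 0 j = 0) -> kcost (size xs) <= M.+1 ->
  R V M kernel s (fun s' => good s' e).
Proof.
move=> esy eirr H szx HW HP HK; rewrite /kcost; set x := size xs => leM.
have leA : x.+1 * (x.+2 * (2 * L + 1).+1) <= M.+1.
  by apply: leq_trans (leq_trans (leq_addr _ _) leM); rewrite leq_mul2r leqnSn orbT.
have leB : x.+1 * (x.+1 * (2 * L + 1).+1) <= M.+1.
  by apply: leq_trans leA; rewrite leq_mul2l leq_mul2r leqnSn !orbT.
have leC k : k <= x * (4 * x.+1) -> k.+1 * k.+1 <= M.+1.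
  by move=> le; apply: leq_trans (leq_trans (leq_addl _ _) leM); rewrite leq_mul.
apply: R_seqm; [exact: leqnn|exact: (evaluate_all_spec nP hV H leA)|] => s1 [F1 G1] [H1 fl].
apply: R_seqm; [exact: leqnn|apply: (build_spec nP hV H1 fl _ _ leB)|].
- by move=> c lc; rewrite G1 //; apply: HP.
- by move=> v; rewrite G1 //; apply: HW.
move=> s2 [F2 G2] [H2 [kv [tk [Hk2 [rh2 hv2] lt2 ct2 sz2]]]].
have hC2 : ar s2 aC = ar s1 aC by rewrite G2.
have K2 j : ar s2 aK 0 j = 0 by rewrite G2 // G1.
apply: R_seqm; [exact: leqnn|apply: (edges_spec nP hV H2 (k_w Hk2) (k_u Hk2) (k_v Hk2) K2 (leC _ sz2))|].
move=> s3 [F3 G3] [e3 k3].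
have H3 : core s3 e xs by apply: core_frame H2 (conj F3 G3) _ _.
have Hk3 : kst s3 e xs kv tk by apply: kst_frame Hk2 (conj F3 G3) _ _.
apply: R_call; first apply: (reset_spec nP hV H3 Hk3).
  by apply: leq_trans (leC _ sz2); rewrite leq_pmulr.
move=> s4 [F4 G4] [w4 p4].
have hC4 : ar s4 aC = ar s2 aC by rewrite G4 // G3.
have H4 : core s4 e xs by apply: core_frame H3 (conj F4 G4) _ _.
have ked : kedge s4 = (fun a b => ar s2 aA (ar s2 aV 0 a) (ar s2 aV 0 b) != 0).
  by rewrite /kedge !G4 // !G3.
have Hf y : y \in xs -> ~~ light e xs (ar s2 aC 0) y -> heavy e xs (ar s2 aC 0) y.
  by rewrite hC2 => /(nthP y)[i lti <-] nl; apply: (proj2 (fl i y lti)).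
exists xs, kv, [seq y <- xs | ~~ light e xs (ar s2 aC 0) y]; split=> //.
- by rewrite F4 // F3 // (k_w Hk2).
- exact: k_u Hk2.
- by rewrite G4 // G3 //; exact: k_v Hk2.
- by rewrite F4 // F3.
- by rewrite filter_uniq // (c_u H).
- by rewrite G4 // G3.
- exact: kernel_disjoint Hk2.
- by rewrite F4 // e3 ked.
- by rewrite G4 // ked.
- exact: kernel_correct esy eirr H2 Hk2 Hf lt2 ct2.
Qed.

Lemma cvd_bound e : cvd_number e <= n.
Proof.
have [X [_ <- _]] := cvd_numberP e.
by rewrite -[X in _ <= X](card_ord n) max_card.
Qed.

(** [9 * k + 6] is [3 * (3 * k + 2)]: the old deletion set has at most [3 * k] vertices, the
    endpoints add two, and [rebuild] may triple the size while it runs. *)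
Definition ucost k := let x := 9 * k + 6 in kcost x.

Lemma kcost_mono x y : x <= y -> kcost x <= kcost y.
Proof. by move=> le; rewrite /kcost leq_add // leq_mul // ?leq_mul // !ltnS // leq_mul // leq_mul. Qed.

Lemma update_spec s e e' (u v : 'I_n) (b : bool) k : good s e ->
  symmetric e' -> irreflexive e' ->
  rg s rU = u -> rg s rV = v -> u != v ->
  (forall x y, e' x y = if ((x == u) && (y == v)) || ((x == v) && (y == u)) then b else e x y) ->
  cvd_number e <= k -> cvd_number e' <= k ->
  R V (ucost k) (update b) s (fun s' => good s' e').
Proof.
move=> [xs [kv [hv Hs]]] esy' eirr' eU eV uv He lk lk'.
have H := s_core Hs; have [v1 [v2 [v3 v4]]] := nV nP hV.
set ps := pairs (kedge s) (size kv).
have le_ps : size ps <= size kv * size kv by apply: pairs_size nP hV _ _.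
have le_kv : size kv <= n by rewrite -[X in _ <= X]card_ord -(card_uniqP (s_u Hs)) max_card.
have le_xs : size xs <= 3 * k by apply: leq_trans (s_xs Hs) _; rewrite leq_mul2l lk.
set x := 9 * k + 6.
have kvx : (size kv).*2 <= x * (4 * x.+1).
  apply: (@leq_trans ((3 * k) * (4 * (3 * k).+1)).*2); last by rewrite /x; lia.
  rewrite leq_double; apply: leq_trans (s_size Hs) _.
  by rewrite leq_mul // leq_mul.
apply: R_seqm; [exact: leqnn|apply: (wipe_spec nP hV)|].
- rewrite (s_e Hs) -/ps; apply: leq_trans (_ : (x * (4 * x.+1)).+1 * (x * (4 * x.+1)).+1 <= _); last exact: leq_addl.
  have : 0 < x * (4 * x.+1) by rewrite /x; lia.
  move: (x * _) (size kv) (size ps) kvx le_ps; clear => y a b; nia.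
- rewrite (s_e Hs) -/ps; have := leq_mul le_kv le_kv; have := leq_mul nP nP.
  by move: (size ps) (size kv * _) (n * n) (P * P) hV le_ps; clear; lia.
- move=> j; rewrite (s_e Hs) (s_K Hs) -/ps => le; rewrite nth_default //=.
  by rewrite (size_flat nP hV); lia.
move=> s1 [F1 G1] K1.
have H1 : core s1 e xs by apply: core_frame H (conj F1 G1) _ _.
apply: R_seqm; [exact: leqnn|apply: (toggle_spec nP hV H1 _ _ uv He)|].
- by rewrite F1.
- by rewrite F1.
- apply: leq_trans (_ : x.+2 * (x.+2 * (2 * L + 1).+1) <= _); last by rewrite ltnW // ltnS leq_addr.
  rewrite mulnA leq_mul2r; apply/orP; right; rewrite -[(size xs).+2]mul1n leq_mul //.
  by rewrite /x; lia.
move=> s2 [F2 G2] [ys H2 szy].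
have ley : size ys <= 3 * k + 2 by lia.
apply: R_seqm; [exact: leqnn|apply: (rebuild_spec nP hV esy' H2)|].
  apply: leq_trans (_ : x.+2 * (x.+2 * (2 * L + 1).+1) <= _); last by rewrite ltnW // ltnS leq_addr.
  by rewrite !leq_mul // /x; lia.
move=> s3 [F3 G3] [zs H3 szz].
apply: (kernel_spec esy' eirr' H3 szz).
- by move=> w; rewrite G3 // G2 // G1 // (s_W Hs).
- by move=> c lc; rewrite G3 // G2 // G1 // (s_P Hs).
- by move=> j; rewrite G3 // G2.
- apply: leqW; apply: kcost_mono; apply: leq_trans szz _.
  by rewrite /x; lia.
Qed.

End Good.

(** * Initialisation with the edgeless graph *)

Local Open Scope stm_scope.

(** Each vertex is a cluster named after itself, so the deletion set and the kernel are empty and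
    only [aC] and row [rN] have to be filled. *)
Definition start : stm :=
  rN ::= $rU ;; rP ::= #1 ;;
  Whl ($rP < $rN) (rP ::= #2 * $rP) ;;
  eW ::= #0 ;;
  Whl ($eW < $rN) (aC[< #0, $eW >] ::= $eW ;; eW ::= $eW + #1) ;;
  eW ::= #0 ;;
  Whl ($eW < $rN) (wset rN 1 0 ;; eW ::= $eW + #1).

Local Close Scope stm_scope.

Definition hinit n := Hst (fun r => if r == 0 then n else 0) (fun _ _ _ => 0) (fun _ => 0).

(** The quantities to be stored are quadratic in [n]. The base [n + 2] is at least [2], so eight of
    the ten factors absorb constants up to [2 ^ 8], also for [n = 0]. *)
Definition Vn n := (n + 2) ^ 10.

Definition logb n L := n <= 2 ^ L /\ (L = 0 \/ 2 ^ L.-1 < n).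

Lemma logb_V n L : logb n L -> 64 * (2 ^ L * 2 ^ L) + 64 <= Vn n.
Proof.
move=> [_ h].
have lP : 2 ^ L <= 2 * n + 1.
  by case: h => [->|]; [lia|case: (L) => [|l] /=; rewrite ?expnS; lia].
apply: (@leq_trans (256 * (n + 2) ^ 2)).
  have := leq_mul lP lP; move: (2 ^ L * 2 ^ L) => z; rewrite expnS expn1; nia.
rewrite /Vn (expnD _ 8 2) leq_mul2r; apply/orP; right.
by apply: (@leq_trans (2 ^ 8)) => //; rewrite leq_exp2r //; lia.
Qed.

Lemma logb_log n L : logb n L -> L <= trunc_log 2 n + 1.
Proof.
move=> [_ [->//|lt]]; rewrite addn1; case: (L) lt => // l /= lt.
by rewrite ltnS; apply: trunc_log_max => //; exact: ltnW.
Qed.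

Lemma edgeless_cvd n : is_cvd (@edgeless 'I_n) set0.
Proof.
apply/cvdP => a b c _ _ _; exact.
Qed.

Lemma rep0 n L T cl : (forall i, T i = 0) -> @rep n L T cl set0.
Proof.
move=> T0; have c0 h i : @cnt n L cl set0 h i = 0.
  by apply/eqP; rewrite cards_eq0; apply/eqP/setP => w; rewrite !inE.
by rewrite /rep; case: (2 * L) => [|h] /=; rewrite T0 c0.
Qed.

Lemma start_spec n :
  exists M, R (Vn n) M start (hinit n) (fun s => exists2 L, logb n L & good L s (@edgeless 'I_n)).
Proof.
exists (n.+1 * (2 * n + 1).+1); set M := n.+1 * _.
have v1 : 2 * n + 1 <= Vn n.
  rewrite /Vn (expnD _ 9 1) expn1; have : 2 ^ 9 <= (n + 2) ^ 9 by rewrite leq_exp2r //; lia.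
  by move: ((n + 2) ^ 9) => z; rewrite -[2 ^ 9]/512; nia.
have lM : n.+1 * 1 <= M.+1 by rewrite /M; nia.
apply: R_seqa; first by rewrite /=; lia.
apply: R_seqa; first by rewrite /=; lia.
apply: (@R_seqm _ _ M _ _ _ _ (fun s => exists2 L, logb n L & rg s rP = 2 ^ L)) => //.
  apply: (@R_whl _ _ 0 n _ _ _ (fun j s => rg s rP = 2 ^ j /\ (j = 0 \/ 2 ^ j.-1 < n))) => //.
  - by split; last left.
  - move=> j s [F G] [p1 p2] /=; rewrite p1 (F 2 isT) /= eqb0 negbK => lt.
    split; first by apply: ltn_trans lt; exact: ltn_expl.
    by apply: R_asg; rewrite /= p1 -?expnS ?expnS //; [lia|split=> //; right].
  - move=> j s [F G] [p1 p2] /=; rewrite p1 (F 2 isT) /= eqb0 -leqNgt => le.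
    by exists j.
move=> s [F G] [L hL eP].
have nP := proj1 hL; have hV := logb_V hL.
have lL : L <= n.
  by case: hL => _ [->//|]; case: (L) => // l /=; have := ltn_expl l (ltnSn 1); lia.
have eN : rg s rN = n by rewrite F.
have z a i j : ar s a i j = 0 by rewrite G.
have z0 r : r \notin [:: 0; 2; 3] -> rg s r = 0.
  by rewrite !inE !negb_or => /and3P[a1 a2 a3]; rewrite F ?inE //= (negbTE a1) (negbTE a2) (negbTE a3).
apply: R_seqa; first by [].
set s1 := setr _ _ _.
apply: (@R_seqm _ _ M _ _ _ _ (fun s => forall v : 'I_n, ar s aC 0 v = v)) => //.
  apply: (@R_whl _ _ 0 n _ _ _ (fun j s => [/\ rg s eW = j, j <= n & forall v : 'I_n, v < j -> ar s aC 0 v = v])) => //.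
  - move=> j s' [F' G'] [p1 p2 p3] /=; rewrite p1 (F' 2 isT) /= eN eqb0 negbK => lt; split=> //.
    apply: R_seqs; rewrite /= p1; first lia.
    apply: R_asg; rewrite /= p1; first lia.
    split=> //; rewrite ?addn1 // => v; rewrite ltnS leq_eqVlt; case: eqP => //= _ /p3.
    by [].
  - move=> j s' [F' G'] [p1 p2 p3] /=; rewrite p1 (F' 2 isT) /= eN eqb0 -leqNgt => le.
    by move=> v; apply: p3; apply: leq_trans le.
move=> s2 [F2 G2] c2.
apply: R_seqa; first by [].
set s3 := setr _ _ _.
pose S j : {set 'I_n} := [set v : 'I_n | v < j].
have vl j : valid L (ar s3 aC 0) (S j).
  by move=> w _; rewrite /s3 /= c2; apply: leq_trans nP.
apply: (@R_whl _ _ (2 * L + 1) n _ _ _ (fun j s => [/\ rg s eW = j, j <= n, rep L (ar s aT n) (ar s3 aC 0) (S j) &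
    forall x : 'I_n, forall i, ar s aT x i = 0])) => //.
- by apply: leqW; rewrite leq_mul // ltnS leq_add2r leq_mul2l.
- split=> //.
  + suff -> : S 0 = set0 by apply: rep0 => i; rewrite /s3 /= G2 // z.
    by apply/setP => v; rewrite !inE.
  + by move=> x i; rewrite /s3 /= G2 // z.
- move=> j s' [F' G'] [p1 p2 p3 p4] /=; rewrite p1 (F' 2 isT) /= (F2 2 isT) /= eN eqb0 negbK => lt; split=> //.
  have eC' : ar s' aC = ar s3 aC by rewrite G'.
  have eN' : rg s' rN = n by rewrite F' //= F2.
  apply: (@R_seqm _ _ (2 * L + 1) _ _ _ _ (fun s'' => ar s'' aT n = walkf 1 0 (lf L (ar s3 aC 0) j) (2 * L).+1 (ar s' aT n) /\
      forall y, y != n -> ar s'' aT y = ar s' aT y)) => //.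
    have := (@wset_spec n L (Vn n) nP hV s' rN 1 0 (Ordinal lt) (S j)); rewrite eN' eC'; apply=> //.
    + by rewrite F' //= F2.
    + by lia.
    + by rewrite /s3 /= (c2 (Ordinal lt)) /=; apply: leq_trans nP.
  move=> s'' [F'' G''] [h1 h2]; apply: R_asg; rewrite /= F'' // p1; first by lia.
  rewrite addn1; split=> //.
  + rewrite /= h1; have -> : S j.+1 = Ordinal lt |: S j.
      by apply/setP => v; rewrite !inE ltnS leq_eqVlt -val_eqE.
    apply: (rep_ins nP (w := Ordinal lt)) => //; last by rewrite inE ltnn.
    by move=> w _; rewrite /s3 /= c2; apply: leq_trans nP.
  + by move=> x i; rewrite /= h2 // neq_ltn ltn_ord.
- move=> j s' [F' G'] [p1 p2 p3 p4] /=; rewrite p1 (F' 2 isT) /= (F2 2 isT) /= eN eqb0 -leqNgt => le.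
  exists L => //.
  have eC : ar s' aC = ar s3 aC by rewrite G'.
  have eC' (v : 'I_n) : ar s' aC 0 v = v by rewrite eC /s3 /= c2.
  have z' a : a \in [:: aK; aA; aI; aP; aW] -> forall i j, ar s' a i j = 0.
    by rewrite !inE => /or4P[|||/orP[]] /eqP-> i k; rewrite G' //= G2 //= z.
  have zr r : r \in [:: rX; rE; rW; rH] -> rg s' r = 0.
    by rewrite !inE => /or4P[] /eqP->; rewrite F' //= F2 //= z0.
  have E0 (x : 'I_n) : Es (@edgeless 'I_n) [set v in [::]] (ar s' aC 0) x = set0.
    apply/setP => w; rewrite !inE !eC'; case: (altP (w =P x)) => //= ne.
    by rewrite val_eqE (negbTE ne).
  exists [::], [::], [::]; split=> //; try by rewrite zr.
  + split=> //; try by rewrite zr.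
    * by rewrite F' //= F2.
    * by rewrite F' //= F2.
    * by move=> u v; rewrite z'.
    * by move=> v; rewrite z'.
    * rewrite eC; suff -> : ~: [set v in [::]] = S j by [].
      by apply/setP => v; rewrite !inE (leq_trans (ltn_ord v) le).
    * by move=> x; rewrite E0; apply: rep0 => i; apply: p4.
    * by move=> v _; rewrite eC'; apply: leq_trans nP.
    * by move=> v; rewrite eC'; apply: leq_trans (ltnW _) nP.
  + by move=> i; rewrite z' //; case: i => [|[|i]] //=; rewrite nth_nil.
  + by move=> v; rewrite z'.
  + by move=> c _; rewrite z'.
  + move=> T; rewrite set_nil subset0 => /eqP-> _ _; rewrite setU0 cards0; split=> //.
    by split=> [|Y _]; [exact: edgeless_cvd|rewrite cards0].
Qed.

(** * A lower bound for static algorithms *)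

Lemma exec_pos B p s t s' : exec B p s t s' -> 0 < t.
Proof. by elim=> //= *; lia. Qed.

(** Time bounds the number of cells changed; for an arbitrary program this is the source of the
    lower bound. *)
Lemma exec_writes B p s t s' : exec B p s t s' ->
  exists2 w : seq nat, size w <= t & forall j, j \notin w -> Defs.mem s' j = Defs.mem s j.
Proof.
elim=> {p s t s'}.
- by exists [::].
- by exists [::].
- by exists [::].
- by exists [::].
- move=> s x y _; exists [:: reg s x] => // j; rewrite inE /= => /negbTE ->.
  by [].
- move=> p q s1 s2 s3 t1 t2 _ [w1 l1 h1] _ [w2 l2 h2]; exists (w1 ++ w2).
    by rewrite size_cat leq_add.
  by move=> j; rewrite mem_cat negb_or => /andP[n1 n2]; rewrite h2 ?h1.
- by move=> x p q s t s' _ _ [w l h]; exists w => //; apply: leqW.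
- by move=> x p q s t s' _ _ [w l h]; exists w => //; apply: leqW.
- by exists [::].
- move=> x p s1 s2 s3 t1 t2 _ _ [w1 l1 h1] _ [w2 l2 h2]; exists (w1 ++ w2).
    by rewrite size_cat leqW // leq_add.
  by move=> j; rewrite mem_cat negb_or => /andP[n1 n2]; rewrite h2 ?h1.
Qed.

Lemma edge_list_size n (e : rel 'I_n) es : edge_list e es -> graph_size e <= n + size es.
Proof.
move=> [_ _ he]; rewrite /graph_size leq_add2l.
pose f (q : 'I_n * 'I_n) := if q.1 < q.2 then q else (q.2, q.1).
apply: (@leq_trans #|[seq f q | q <- es]|); last by rewrite -(size_map f) card_size.
apply: subset_leq_card; apply/subsetP => -[a b]; rewrite inE /= he => /andP[lt].
case/orP=> inn; apply/mapP; [exists (a, b)|exists (b, a)] => //; rewrite /f /= ?lt //.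
by rewrite ltnNge ltnW.
Qed.

Section Claws.

Variable k : nat.

Lemma claw_ltn (g : 'I_k) (l : 'I_4) : 4 * g + l < 4 * k.
Proof. by have := ltn_ord g; have := ltn_ord l; lia. Qed.

Definition vert (g : 'I_k) (l : 'I_4) : 'I_(4 * k) := Ordinal (claw_ltn g l).

Definition ctr g := vert g ord_max.

Lemma claw_div (v : 'I_(4 * k)) : v %/ 4 < k.
Proof. by have := ltn_ord v; lia. Qed.

Definition home v := Ordinal (claw_div v).

Definition claws : rel 'I_(4 * k) :=
  [rel u v | [&& home u == home v, u != v & (u %% 4 == 3) || (v %% 4 == 3)]].

Lemma home_vert g l : home (vert g l) = g.
Proof. by apply: val_inj; rewrite /=; have := ltn_ord l; lia. Qed.

Lemma mod_vert g l : vert g l %% 4 = l.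
Proof. by rewrite /=; have := ltn_ord l; lia. Qed.

Lemma claws_simple : simple_graph claws.
Proof.
split=> [u v|u]; rewrite /claws /=; last by rewrite !eqxx.
by rewrite eq_sym [u == v]eq_sym orbC.
Qed.

Definition leaf (l : 'I_3) : 'I_4 := widen_ord (leqnSn 3) l.

(** With the centre first in each pair, the odd cells of the input from [3] on hold leaves only. *)
Definition claw_edges := [seq (ctr g, vert g (leaf l)) | g <- enum 'I_k, l <- enum 'I_3].

Lemma size_claw_edges : size claw_edges = 3 * k.
Proof. by rewrite size_allpairs !size_enum_ord mulnC. Qed.

Lemma claw_edgesP u v : reflect [/\ home u = home v, u %% 4 = 3 & v %% 4 != 3] ((u, v) \in claw_edges).
Proof.
apply: (iffP allpairsP) => [[[g l] [_ _ [-> ->]]]|[hu u3 v3]].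
  rewrite !home_vert !mod_vert; split=> //.
  by rewrite /= neq_ltn ltn_ord.
have lt : v %% 4 < 3 by have := ltn_mod v 4; lia.
exists (home u, Ordinal lt); split; rewrite ?mem_enum //=.
congr (_, _); apply: val_inj; rewrite /=; first by lia.
by have := congr1 val hu; rewrite /=; lia.
Qed.

Lemma claws_edge_list : edge_list claws claw_edges.
Proof.
split.
- apply: allpairs_uniq; rewrite ?enum_uniq // => -[g l] [g' l'] _ _ /= [E1 E2].
  have Eg : g = g' by apply: val_inj => /=; lia.
  by rewrite Eg in E2 *; congr (_, _); apply: val_inj => /=; lia.
- move=> u v /claw_edgesP[_ u3 v3]; apply/claw_edgesP => -[_ v3' _].
  by rewrite v3' in v3.
- move=> u v; apply/idP/idP => [/and3P[/eqP h uv /orP[]/eqP m]|/orP[]/claw_edgesP[h m m']] /=.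
  + apply/orP; left; apply/claw_edgesP; split=> //; apply: contra uv => /eqP E.
    by apply/eqP/val_inj; have := congr1 val h; rewrite /=; lia.
  + apply/orP; right; apply/claw_edgesP; split=> //; apply: contra uv => /eqP E.
    by apply/eqP/val_inj; have := congr1 val h; rewrite /=; lia.
  + apply/and3P; split; [by apply/eqP| |by rewrite m].
    by apply: contraNneq m' => <-; rewrite m.
  + apply/and3P; split; [by rewrite h| |by rewrite m orbT].
    by apply: contraNneq m' => ->; rewrite m.
Qed.

Definition centers := [set ctr g | g in 'I_k].

Lemma centersE v : (v \in centers) = (v %% 4 == 3).
Proof.
apply/imsetP/eqP => [[g _ ->]|E]; first by rewrite mod_vert.
by exists (home v) => //; apply: val_inj => /=; lia.
Qed.

Lemma card_centers : #|centers| = k.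
Proof.
rewrite card_imset ?card_ord // => g g' /(congr1 home).
by rewrite !home_vert.
Qed.

Lemma centers_cvd : is_cvd claws centers.
Proof.
apply/cvdP => a b c; rewrite !centersE => na nb _ _ /and3P[_ _].
by rewrite (negbTE na) (negbTE nb).
Qed.

(** Every claw meets [X], and since the centers form a deletion set of size [k], each claw does so
    in one vertex only. If this were not the centre, the centre would survive with two leaves. *)
Lemma claws_min X : is_min_cvd claws X -> X = centers.
Proof.
move=> [cX mX].
have P3 g (l l' : 'I_3) : l != l' -> ctr g \notin X -> (vert g (leaf l) \in X) || (vert g (leaf l') \in X).
  move=> ll nc; apply/negPn/negP; rewrite negb_or => /andP[n1 n2].
  have ne : vert g (leaf l) != vert g (leaf l').
    by apply: contraNneq ll => /(congr1 val); rewrite /leaf /= => E; apply/eqP/val_inj => /=; lia.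
  have ec m : claws (ctr g) (vert g (leaf m)).
    have [_ _ ->] := claws_edge_list; apply/orP; left; apply/allpairsP.
    by exists (g, m); rewrite !mem_enum.
  have := elimT (cvdP _ _) cX _ _ _ n1 nc n2 ne; rewrite ec claws_simple.1 ec.
  move=> /(_ isT isT) /and3P[_ _]; rewrite !mod_vert /= => /orP[]/eqP E.
    by have := ltn_ord l; rewrite E.
  by have := ltn_ord l'; rewrite E.
have hX g : exists2 v, v \in X & home v = g.
  case: (boolP (ctr g \in X)) => [cin|nc]; first by exists (ctr g); rewrite ?home_vert.
  by have /orP[] := P3 g ord0 ord_max isT nc => vin; eexists; eauto; rewrite home_vert.
have hT : home @: X = setT.
  apply/setP => g; rewrite inE; apply/imsetP; have [v vin E] := hX g.
  by exists v.
have inj : {in X &, injective home}.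
  apply/imset_injP; rewrite eqn_leq leq_imset_card /= hT cardsT card_ord -[X in _ <= X]card_centers.
  exact: mX centers_cvd.
have sub : centers \subset X.
  apply/subsetP => v /imsetP[g _ ->]; apply/negPn/negP => nc.
  have two (l l' : 'I_3) : l != l' -> vert g (leaf l) \in X -> vert g (leaf l') \in X -> False.
    move=> ll i1 i2; have := inj _ _ i1 i2; rewrite !home_vert => /(_ erefl) /(congr1 val); rewrite /leaf /= => E.
    by move/eqP: ll; apply; apply: val_inj => /=; lia.
  pose l1 : 'I_3 := inord 1.
  have n1 : (ord0 : 'I_3) != l1 by rewrite -val_eqE /= inordK.
  have n2 : (ord_max : 'I_3) != l1 by rewrite -val_eqE /= inordK.
  have n3 : (ord0 : 'I_3) != ord_max by [].
  move: (two _ _ n1) (two _ _ n2) (two _ _ n3) (P3 g _ _ n1 nc) (P3 g _ _ n2 nc) (P3 g _ _ n3 nc).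
  by case: (vert g (leaf ord0) \in X); case: (vert g (leaf l1) \in X);
    case: (vert g (leaf ord_max) \in X) => //; auto.
apply/esym/eqP; rewrite eqEcard sub; exact: mX centers_cvd.
Qed.

End Claws.

Lemma nth_flatten_odd n (es : seq ('I_n * 'I_n)) (p : pred nat) : p 0 ->
  (forall q, q \in es -> p q.2) ->
  forall i, p (nth 0 (flatten [seq [:: val q.1; val q.2] | q <- es]) (2 * i).+1).
Proof.
move=> p0; elim: es => [|q es IH] H i; first by rewrite nth_nil.
case: i => [|i]; first exact: H (mem_head _ _).
rewrite (_ : (2 * i.+1).+1 = (2 * i).+3); last by lia.
by apply: IH => q' q'in; apply: H; rewrite inE q'in orbT.
Qed.

(** The graph without vertices satisfies every bound on size and parameter, and no program halts in
    time [0]. *)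
Lemma static_time_gt0 A f m k : static_cvd_algorithm A f -> 0 < f m k.
Proof.
move=> [c Hc]; have [||||t [s [ex le _]]] := Hc 0 (@edgeless 'I_0) [::] m k.
- by split.
- by split=> // -[].
- rewrite /graph_size (_ : [set p | _] = set0) ?cards0 //.
  by apply/setP => -[[]].
- by apply: leq_trans (cvd_bound _) _.
- exact: leq_trans (exec_pos ex) le.
Qed.

(* On [k] disjoint claws the answer consists of the centers, which are the vertices
   [3] modulo [4]. They occupy [k] consecutive cells, and initially no odd cell but
   cell [1] holds such a number. *)
Lemma static_time_lower A f k : static_cvd_algorithm A f -> k <= 5 * f (k ^ 5) k.
Proof.
move=> HA; have pos := static_time_gt0 (k ^ 5) k HA.
(* The claws have size at most [7 * k], which is at most [k ^ 5] once [k > 5]; for smaller [k] a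
   positive running time is enough. *)
case: (leqP k 5) => [le|gt5]; first by lia.
have [c Hc] := HA.
have eL := claws_edge_list k.
have [||t [s [ex le [X [out mX]]]]] := Hc (4 * k) (@claws k) (claw_edges k) (k ^ 5) k (claws_simple k) eL.
- apply: leq_trans (edge_list_size eL) _; rewrite size_claw_edges -mulnDl expnSr leq_mul2r.
  by apply/orP; right; apply: (@leq_trans (6 ^ 4)) => //; rewrite leq_exp2r.
- by apply: leq_trans (cvd_number_le (centers_cvd k)) _; rewrite card_centers.
apply: leq_trans (_ : 5 * t <= _); last by rewrite leq_mul2l le orbT.
rewrite (claws_min mX) in out.
have sz : reg s 0 = k.
  by have := perm_size out; rewrite !size_map size_iota -cardE card_centers.
have [w lw same] := exec_writes ex.
(* [b] is odd, greater than [a], at least [3] and at most [a + 3]. So cell [1] is avoided, and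
   [b + 2 * i] stays within the [k] output cells for [i < (k - 2)./2]. *)
set a := reg s 1; set b := a %/ 2 * 2 + 3.
have inw i : i < (k - 2)./2 -> b + 2 * i \in w.
  move=> lti; apply/negPn/negP => nw.
  have : Defs.mem s (b + 2 * i) %% 4 = 3.
    have : Defs.mem s (b + 2 * i) \in [seq Defs.mem s (reg s 1 + i) | i <- iota 0 (reg s 0)].
      apply/mapP; exists (b + 2 * i - a); first by rewrite mem_iota sz /b; lia.
      by congr Defs.mem; rewrite -/a /b; lia.
    by rewrite (perm_mem out) => /mapP[v]; rewrite mem_enum centersE => /eqP + ->.
  rewrite same //.
  have -> : b + 2 * i = (2 * (a %/ 2 + i)).+3 by rewrite /b; lia.
  rewrite /=; apply/eqP.
  apply: (@nth_flatten_odd _ _ (fun x => x %% 4 != 3)) => // -[u v] /claw_edgesP[_ _].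
  by [].
have : size [seq b + 2 * i | i <- iota 0 (k - 2)./2] <= size w.
  apply: uniq_leq_size; first by rewrite map_inj_uniq ?iota_uniq // => i j; lia.
  by move=> _ /mapP[i + ->]; rewrite mem_iota add0n => /inw.
rewrite size_map size_iota; lia.
Qed.

(** * Queries *)

Notation qC := 64 (only parsing).
Notation qI := 65 (only parsing).
Notation qB := 66 (only parsing).
Notation qJ := 67 (only parsing).
Notation off := 70 (only parsing).

Local Open Scope stm_scope.

(* Runs [A] on the memory [aK[0, _]], its registers being shifted by [off];
   the array [aL] records how to undo the writes. *)
Fixpoint lift (A : cmd) : stm :=
  match A with
  | Skip => Nop
  | Const x a => (off + x)%N ::= #a
  | Op x o y z => (off + x)%N ::= EBin o $(off + y)%N $(off + z)%N
  | Read x y => (off + x)%N ::= aK@[#0, $(off + y)%N]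
  | Write x y =>
      aL[< #0, $qC >] ::= $(off + x)%N ;; aL[< #1, $qC >] ::= aK@[#0, $(off + x)%N] ;;
      qC ::= $qC + #1 ;; aK[< #0, $(off + x)%N >] ::= $(off + y)%N
  | Seq p q => lift p ;; lift q
  | If x p q => Ite ($(off + x)%N) (lift p) (lift q)
  | While x p => Whl ($(off + x)%N) (lift p)
  end.

Definition emit : stm :=
  qB ::= #16 * ($rN * $rN + $rN + #1) ;; qI ::= #0 ;;
  Whl ($qI < $off) (Raw ($qB + $qI) (aV@[#0, aK@[#0, $(off + 1)%N + $qI]]) ;; qI ::= $qI + #1) ;;
  qJ ::= #0 ;;
  Whl ($qJ < $rH) (Raw ($qB + ($qI + $qJ)) (aH@[#0, $qJ]) ;; qJ ::= $qJ + #1).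

Definition undo : stm :=
  Whl ($qC) (
    qC ::= $qC - #1 ;; aK[< #0, aL@[#0, $qC] >] ::= aL@[#1, $qC] ;;
    aL[< #0, $qC >] ::= #0 ;; aL[< #1, $qC >] ::= #0).

Definition answer : stm :=
  emit ;; undo ;; rU ::= $off + $rH ;; rV ::= $qB.

Local Close Scope stm_scope.

Fixpoint regs_bound (A : cmd) : nat :=
  match A with
  | Skip => 0
  | Const x _ => x.+1
  | Op x _ y z => maxn x.+1 (maxn y.+1 z.+1)
  | Read x y | Write x y => maxn x.+1 y.+1
  | Seq p q => maxn (regs_bound p) (regs_bound q)
  | If x p q => maxn x.+1 (maxn (regs_bound p) (regs_bound q))
  | While x p => maxn x.+1 (regs_bound p)
  end.

Lemma wf_lift tau A : off + regs_bound A <= tau -> wf tau (lift A).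
Proof.
elim: A => //=.
- by move=> x a le; rewrite andbT; lia.
- by move=> x o y z; lia.
- by move=> x y; lia.
- by move=> x y; lia.
- by move=> p IHp q IHq le; rewrite IHp ?IHq //; lia.
- by move=> x p IHp q IHq le; rewrite IHp ?IHq //; lia.
- by move=> x p IHp le; rewrite IHp //; lia.
Qed.

(** The log is chronological, and this fold reverts the latest write first, so repeated writes to a
    cell end with its oldest value. *)
Definition undone (l : seq (nat * nat)) (m : nat -> nat) := foldr (fun p m => upd m p.1 p.2) m l.

Lemma undone_eq l m m' : m =1 m' -> undone l m =1 undone l m'.
Proof. by move=> E; elim: l => //= p l IH j /=; rewrite IH. Qed.

Definition logged a i := ((a == aK) && (i == 0)) || ((a == aL) && (i < 2)).

(** [h0] is the state before the run, [h] the present one, and [s] the state of the static algorithm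
    that [h] imitates. By [l_u] the log [l] leads from the present memory of the algorithm back to
    the stored kernel graph. *)
Record lifted (h0 h : hst) (s : state) (l : seq (nat * nat)) : Prop := Lifted {
  l_r : forall r, rg h (off + r) = reg s r;
  l_k : forall j, ar h aK 0 j = Defs.mem s j;
  l_c : rg h qC = size l;
  l_a : forall i, ar h aL 0 i = (nth (0, 0) l i).1;
  l_v : forall i, ar h aL 1 i = (nth (0, 0) l i).2;
  l_o : forall a i j, ~~ logged a i -> ar h a i j = ar h0 a i j;
  l_g : forall r, r < 64 -> rg h r = rg h0 r;
  l_w : rw h = rw h0;
  l_u : undone l (Defs.mem s) =1 ar h0 aK 0 }.

Lemma lifted_set h0 h s l x a : lifted h0 h s l -> lifted h0 (setr h (off + x) a) (set_reg s x a) l.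
Proof.
move=> [r k c a0 v o g w u]; split=> // [r'|r' lt] /=.
- by rewrite eqn_add2l r.
- by rewrite ifN ?g //; apply/eqP; lia.
Qed.

Lemma undone_write l m x a : undone (rcons l (x, m x)) (upd m x a) =1 undone l m.
Proof.
rewrite /undone foldr_rcons; apply: undone_eq => j /=.
by case: eqP => // ->.
Qed.

(** The factor [4] comes from a write, which becomes four statements. The log grows by one entry per
    write, so undoing the run takes no longer than the run, up to a constant. *)
Lemma lift_exec B V A s t s' : exec B A s t s' -> B <= V ->
  forall h0 h l, lifted h0 h s l -> bdd V h -> size l + t <= V ->
  exists t' h' l', [/\ hexec V (lift A) h t' h', t' <= 4 * t, lifted h0 h' s' l' & size l' <= size l + t].
Proof.
move=> ex leB; elim: ex => {A s t s'}.
- move=> s h0 h l Hl _ _; exists 1, h, l; split=> //; first exact: HNop.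
  exact: leq_addr.
- move=> s x a lea h0 h l Hl _ _; exists 1, (setr h (off + x) a), l; split=> //.
  + by apply: HAsg => /=; apply: leq_trans leB.
  + exact: lifted_set.
  + exact: leq_addr.
- move=> s x o y z le h0 h l Hl _ _; exists 1, (setr h (off + x) (eval_op o (reg s y) (reg s z))), l; split=> //.
  + by rewrite -!(l_r Hl); apply: (@HAsg _ _ _ (EBin o _ _)); rewrite /= !(l_r Hl); apply: leq_trans leB.
  + exact: lifted_set.
  + exact: leq_addr.
- move=> s x y le h0 h l Hl [_ bA] _; exists 1, (setr h (off + x) (Defs.mem s (reg s y))), l; split=> //.
  + by rewrite -(l_k Hl) -(l_r Hl); apply: (@HAsg _ _ _ (ELd _ _ _)); apply: bA.
  + exact: lifted_set.
  + exact: leq_addr.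
- move=> s x y le h0 h l Hl [bR bA] lt.
  do 2 eexists; exists (rcons l (reg s x, Defs.mem s (reg s x))); split.
  + apply: (@HSq _ _ _ _ _ _ 1 3); first by apply: HSto; exact: bR.
    apply: (@HSq _ _ _ _ _ _ 1 2); first by apply: HSto; exact: bA.
    apply: (@HSq _ _ _ _ _ _ 1 1); first by apply: HAsg; rewrite /= (l_c Hl); lia.
    by apply: HSto; exact: bR.
  + by [].
  + case: Hl => r k c a v o g w u; split=> //=.
    * by move=> j; rewrite !r; case: eqP.
    * by rewrite c size_rcons addn1.
    * move=> i; rewrite nth_rcons c; case: (ltngtP i (size l)) => //= lt'; rewrite ?a //.
      by rewrite nth_default // ltnW.
    * move=> i; rewrite nth_rcons c; case: (ltngtP i (size l)) => //= lt'; rewrite ?v ?k ?r //.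
      by rewrite nth_default // ltnW.
    * move=> a' i j; rewrite /logged negb_or !negb_and => /andP[n1 n2].
      have {}o : ar h a' i j = ar h0 a' i j by apply: o; rewrite /logged negb_or !negb_and n1.
      move: n1 n2 o; case: (a' =P aK) => [->|_]; first by move=> /= /negbTE->.
      by case: (a' =P aL) => [->|//]; case: i => [|[|i]].
    * by move=> r' lr; rewrite ifN ?g //; apply/eqP; lia.
    * by move=> j; rewrite undone_write u.
  + by rewrite size_rcons addn1.
- move=> p q s1 s2 s3 t1 t2 _ IH1 _ IH2 h0 h l Hl Hb lt.
  have [|t1' [h1 [l1 [e1 le1 H1 z1]]]] := IH1 h0 h l Hl Hb; first by lia.
  have [|t2' [h2 [l2 [e2 le2 H2 z2]]]] := IH2 h0 h1 l1 H1 (hexec_bdd e1 Hb); first by lia.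
  by exists (t1' + t2'), h2, l2; split=> //; [exact: HSq e1 e2|lia|lia].
- move=> x p q s t s' nz _ IH h0 h l Hl Hb lt.
  have [|t1 [h1 [l1 [e1 le1 H1 z1]]]] := IH h0 h l Hl Hb; first by lia.
  exists t1.+1, h1, l1; split=> //; [|lia|lia].
  by apply: HIteT e1; rewrite /= (l_r Hl).
- move=> x p q s t s' nz _ IH h0 h l Hl Hb lt.
  have [|t1 [h1 [l1 [e1 le1 H1 z1]]]] := IH h0 h l Hl Hb; first by lia.
  exists t1.+1, h1, l1; split=> //; [|lia|lia].
  by apply: HIteF e1; rewrite /= (l_r Hl).
- move=> x p s z h0 h l Hl _ _; exists 1, h, l; split=> //; last exact: leq_addr.
  by apply: HWhlF; rewrite /= (l_r Hl).
- move=> x p s1 s2 s3 t1 t2 nz _ IH1 _ IH2 h0 h l Hl Hb lt.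
  have [|t1' [h1 [l1 [e1 le1 H1 z1]]]] := IH1 h0 h l Hl Hb; first by lia.
  have [|t2' [h2 [l2 [e2 le2 H2 z2]]]] := IH2 h0 h1 l1 H1 (hexec_bdd e1 Hb); first by lia.
  exists (t1' + t2').+1, h2, l2; split=> //; [|lia|lia].
  by apply: HWhlT e1 e2; rewrite /= (l_r Hl).
Qed.

(** The start of a stretch of [16 * n] cells used by no array, given by the values that the pairing
    misses below [(n + 1) ^ 2]. It has room for any answer. *)
Definition obase n := 16 * (n * n + n + 1).

Lemma gap_obase n i : i < n -> gap (obase n + i).
Proof.
rewrite /gap /addr /obase => lt a x y la; apply/eqP => E.
have {}E : (x + y) * (x + y) + x = n * n + n + 1 + i %/ 16 by lia.
have : i %/ 16 < n by lia.
have : x <= x + y by rewrite leq_addr.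
move: (x + y) (i %/ 16) E => s q E h1 h2.
case: (leqP s n) => h; first by have := leq_mul h h; lia.
by have := leq_mul h h; lia.
Qed.

Lemma emit_spec V M h n c kvs hs : rg h rN = n -> rg h off = c -> rg h rH = size hs ->
  obase n + n <= V -> c + size hs <= n -> c.+1 <= M.+1 -> (size hs).+1 <= M.+1 ->
  size kvs = c -> (forall i, i < c -> ar h aV 0 (ar h aK 0 (rg h (off + 1) + i)) = nth 0 kvs i) ->
  (forall i, i < size hs -> ar h aH 0 i = nth 0 hs i) ->
  R V M emit h (fun h' => rg h' qB = obase n /\
    forall i, i < c + size hs -> rw h' (obase n + i) = nth 0 (kvs ++ hs) i).
Proof.
move=> eN ec eH lV ln lM1 lM2 sk hk hh.
have bV : obase n <= V by lia.
apply: R_seqa; rewrite /= eN; first by move: bV; rewrite /obase.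
rewrite -/(obase n); apply: R_seqa; first by [].
set h1 := setr _ _ _.
apply: (@R_seqm _ _ M _ _ _ _ (fun h' => rg h' qI = c /\ forall i, i < c -> rw h' (obase n + i) = nth 0 kvs i)) => //.
  apply: (@R_whl _ _ 0 c _ _ _ (fun j h' => [/\ rg h' qI = j, j <= c & forall i, i < j -> rw h' (obase n + i) = nth 0 kvs i])) => //.
  - by rewrite muln1.
  - move=> j h' [F G] [p1 p2 p3]; rewrite /= p1 (F off isT) /= ec eqb0 negbK => lt; split=> //.
    have eB : rg h' qB = obase n by rewrite F.
    apply: R_seq; apply: R_raw; first by rewrite /= p1 eB; apply: gap_obase; lia.
    apply: R_asg; rewrite /= p1; first by lia.
    split=> //; first by rewrite addn1.
    move=> i; rewrite addn1 ltnS => le; rewrite eB eqn_add2l.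
    case: eqP => [->|/eqP ne]; last by apply: p3; rewrite ltn_neqAle ne.
    by rewrite !G // (F 71 isT) /= hk.
  - move=> j h' [F G] [p1 p2 p3]; rewrite /= p1 (F off isT) /= ec eqb0 -leqNgt => le.
    have E : j = c by apply/eqP; rewrite eqn_leq p2.
    by rewrite -E.
move=> h2 [F2 G2] [q1 q2]; apply: R_seqa; first by [].
set h3 := setr _ _ _.
apply: (@R_whl _ _ 0 (size hs) _ _ _ (fun j h' => [/\ rg h' qJ = j, j <= size hs & forall i, i < c + j -> rw h' (obase n + i) = nth 0 (kvs ++ hs) i])) => //.
- by rewrite muln1.
- by split=> // i; rewrite addn0 => lt; rewrite nth_cat sk lt; exact: q2.
- move=> j h' [F G] [p1 p2 p3]; rewrite /= p1 (F 7 isT) /= (F2 7 isT) /= eH eqb0 negbK => lt; split=> //.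
  have eB : rg h' qB = obase n by rewrite (F 66 isT) /= (F2 66 isT).
  have eI : rg h' qI = c by rewrite (F 65 isT).
  apply: R_seq; apply: R_raw; first by rewrite /= p1 eB eI; apply: gap_obase; lia.
  apply: R_asg; rewrite /= p1; first by lia.
  split=> //; first by rewrite addn1.
  move=> i; rewrite addnS ltnS => le; rewrite eB eI eqn_add2l.
  case: eqP => [->|/eqP ne]; last by apply: p3; rewrite ltn_neqAle ne.
  by rewrite nth_cat sk ltnNge leq_addr /= addKn G // G2 // hh.
- move=> j h' [F G] [p1 p2 p3]; rewrite /= p1 (F 7 isT) /= (F2 7 isT) /= eH eqb0 -leqNgt => le.
  have E : j = size hs by apply/eqP; rewrite eqn_leq p2.
  by split; [rewrite (F 66 isT) /= (F2 66 isT)|rewrite -E].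
Qed.

Lemma undo_spec V M h0 h l : rg h qC = size l -> (size l).+1 <= M.+1 -> size l <= V ->
  (forall i, ar h aL 0 i = (nth (0, 0) l i).1) -> (forall i, ar h aL 1 i = (nth (0, 0) l i).2) ->
  (forall i, ar h aL 1 i <= V) -> (forall a i j, ~~ logged a i -> ar h a i j = ar h0 a i j) ->
  (forall i j, ar h0 aL i j = 0) ->
  undone l (ar h aK 0) =1 ar h0 aK 0 ->
  R V M undo h (fun h' => rw h' = rw h /\ forall a i j, ar h' a i j = ar h0 a i j).
Proof.
move=> ec lM lV ha hv hb ho hz hu.
pose I j h' := let l' := take (size l - j) l in [/\ rg h' qC = size l - j, rw h' = rw h /\ j <= size l,
  (forall i, ar h' aL 0 i = (nth (0, 0) l' i).1) /\ (forall i, ar h' aL 1 i = (nth (0, 0) l' i).2),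
  (forall a i j, ~~ logged a i -> ar h' a i j = ar h0 a i j) &
  undone l' (ar h' aK 0) =1 ar h0 aK 0].
apply: (@R_whl _ _ 0 (size l) _ _ _ I) => //.
- by rewrite muln1.
- by rewrite /I subn0 take_size.
- move=> j h' [F G] [p1 [pw p2] [p3 p4] p5 p6]; rewrite /= p1 => nz.
  have lt : j < size l by rewrite -subn_gt0 lt0n.
  split=> //; set m := size l - j.+1.
  have em : size l - j = m.+1 by rewrite /m; lia.
  have lm : m < size l by rewrite /m; lia.
  rewrite em (take_nth (0, 0) lm) in p1 p3 p4 p6.
  set l' := take m l in p3 p4 p6; have sl' : size l' = m by rewrite size_takel // ltnW.
  set q := nth (0, 0) l m in p3 p4 p6.
  have p3m : ar h' aL 0 m = q.1 by rewrite p3 nth_rcons sl' ltnn eqxx.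
  have p4m : ar h' aL 1 m = q.2 by rewrite p4 nth_rcons sl' ltnn eqxx.
  have em1 : m.+1 - 1 = m by lia.
  apply: R_seqa; rewrite /= p1 em1; first by lia.
  apply: R_seqs; rewrite /= p4m; first by rewrite /q -hv.
  apply: R_seqs; rewrite /=; first by [].
  apply: R_sto; rewrite /=; first by [].
  rewrite /I -/m -/l'; split=> //=.
  + have nl : nth (0, 0) l' m = (0, 0) by rewrite nth_default // sl'.
    split=> i; case: (i =P m) => [->|/eqP ne]; rewrite ?nl // ?p3 ?p4 nth_rcons sl';
      by case: (ltngtP i m) ne => // gt _; rewrite nth_default // sl' ltnW.
  + move=> a i k nl; have := p5 a i k nl.
    move: nl; rewrite /logged negb_or !negb_and.
    case: (a =P aK) => [->|_]; first by move=> /andP[/= /negbTE-> _].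
    by case: (a =P aL) => [->|//] /=; case: i => [|[|i]].
  + move=> i; rewrite -p6 p3m /undone foldr_rcons; apply: undone_eq => x.
    by [].
- move=> j h' [F G] [p1 [pw p2] [p3 p4] p5 p6]; rewrite /= p1 => /eqP z; split=> // a i k.
  rewrite z take0 /= in p3 p4 p6.
  case: (boolP (logged a i)) => [|nl]; last exact: p5.
  case/orP=> /andP[/eqP-> ]; first by move=> /eqP->; exact: p6.
  by case: i => [|[|i]] // _; rewrite ?p3 ?p4 nth_nil hz.
Qed.

Lemma answer_spec V M h0 h s l n c kvs hs : lifted h0 h s l ->
  (forall i j, ar h0 aL i j = 0) -> bdd V h ->
  rg h0 rN = n -> reg s 0 = c -> rg h0 rH = size hs ->
  obase n + n <= V -> c + size hs <= n -> c + size hs <= M -> size l <= M -> size l <= V ->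
  size kvs = c -> (forall i, i < c -> ar h0 aV 0 (Defs.mem s (reg s 1 + i)) = nth 0 kvs i) ->
  (forall i, i < size hs -> ar h0 aH 0 i = nth 0 hs i) ->
  R V M answer h (fun h' => [/\ forall a i j, ar h' a i j = ar h0 a i j,
    forall r, 2 <= r < 64 -> rg h' r = rg h0 r, rg h' rU = c + size hs, rg h' rV = obase n &
    forall i, i < c + size hs -> rw h' (obase n + i) = nth 0 (kvs ++ hs) i]).
Proof.
move=> Hl hz [_ bA] eN ec eH lV ln lM llM llV sk hk hh.
have eN' : rg h rN = n by rewrite (l_g Hl).
have eH' : rg h rH = size hs by rewrite (l_g Hl).
have ec' : rg h off = c by rewrite -ec -(l_r Hl).
have kk i : i < c -> ar h aV 0 (ar h aK 0 (rg h (off + 1) + i)) = nth 0 kvs i.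
  by move=> lt; rewrite (l_r Hl) (l_k Hl) (l_o Hl) // hk.
have hk' i : i < size hs -> ar h aH 0 i = nth 0 hs i by move=> lt; rewrite (l_o Hl) // hh.
apply: (@R_seqm _ _ M _ _ _ _ _ _ (emit_spec eN' ec' eH' lV ln _ _ sk kk hk')) => //; try by lia.
move=> h1 [F1 G1] [b1 w1].
have uu : undone l (ar h1 aK 0) =1 ar h0 aK 0.
  by move=> j; rewrite -(l_u Hl); apply: undone_eq => x; rewrite G1 // (l_k Hl).
apply: (@R_seqm _ _ M _ _ _ _ _ _ (undo_spec _ _ llV _ _ _ _ hz uu)) => //.
- by rewrite F1 // (l_c Hl).
- by move=> i; rewrite G1 // (l_a Hl).
- by move=> i; rewrite G1 // (l_v Hl).
- by move=> i; rewrite G1.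
- by move=> a i j nl; rewrite G1 // (l_o Hl).
move=> h2 [F2 G2] [w2 a2].
have e1 : rg h2 off = c by rewrite F2 // F1.
have e2 : rg h2 rH = size hs by rewrite F2 // F1.
have e3 : rg h2 qB = obase n by rewrite F2.
apply: R_seqa; rewrite /= e1 e2; first by lia.
apply: R_asg; rewrite /= e3; first by lia.
split=> //.
- move=> r /andP[r1 r2]; have nr q : 64 <= q -> r != q by move=> le; rewrite neq_ltn (leq_trans r2 le).
  have [n0 n1] : r != rU /\ r != rV by split; rewrite neq_ltn ?r1 ?(ltnW r1) orbT.
  by rewrite /= !ifN // F2 ?F1 ?(l_g Hl) //= !inE ?negb_or ?nr //.
- by move=> i lt; rewrite w2 w1.
Qed.

(** * The stored kernel as an input of the static algorithm *)

Section KernelGraph.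

Variables (n L : nat) (h : hst) (e : rel 'I_n) (xs kv hv : seq 'I_n).
Hypotheses (esy : symmetric e) (eirr : irreflexive e) (Hs : stored L h e xs kv hv).

Definition kvert (i : 'I_(size kv)) : 'I_n := tnth (in_tuple kv) i.

Definition kgraph : rel 'I_(size kv) := [rel i j | e (kvert i) (kvert j)].

Lemma kvert_nth i x0 : kvert i = nth x0 kv i.
Proof. exact: tnth_nth. Qed.

Lemma kvert_inj : injective kvert.
Proof.
move=> i j; rewrite (kvert_nth i (kvert i)) (kvert_nth j (kvert i)) => /eqP.
by rewrite nth_uniq ?(s_u Hs) // => /eqP/val_inj.
Qed.

Lemma kvert_in i : kvert i \in kv.
Proof. exact: mem_tnth. Qed.

Lemma kvertP w : w \in kv -> exists i, kvert i = w.
Proof.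
move=> wk; have lt : index w kv < size kv by rewrite index_mem.
by exists (Ordinal lt); rewrite (kvert_nth _ w) nth_index.
Qed.

Lemma kgraph_simple : simple_graph kgraph.
Proof. by split=> [i j|i] /=; [exact: esy|exact: eirr]. Qed.

Lemma kedgeE (i j : 'I_(size kv)) : kedge h i j = kgraph i j.
Proof.
rewrite /kedge (s_v Hs (kvert i) (ltn_ord i)) (s_v Hs (kvert i) (ltn_ord j)) -!kvert_nth (c_adj (s_core Hs)).
by rewrite /kgraph /=; case: (e _ _).
Qed.

Lemma ord_pairs k (ps : seq (nat * nat)) : (forall p, p \in ps -> p.1 < k /\ p.2 < k) ->
  exists es : seq ('I_k * 'I_k), [seq (val p.1, val p.2) | p <- es] = ps.
Proof.
elim: ps => [|p ps IH] hp; first by exists [::].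
have [|es E] := IH; first by move=> q qin; apply: hp; rewrite inE qin orbT.
have [l1 l2] := hp p (mem_head _ _).
by exists ((Ordinal l1, Ordinal l2) :: es); rewrite /= E; case: (p).
Qed.

(** The memories agree at every address, including the zeros beyond the edge list, as an algorithm
    may use any cell that it assumes to be zero. *)
Lemma kgraph_edges : exists es, edge_list kgraph es /\ Defs.mem (input_state es) =1 ar h aK 0.
Proof.
have [|es E] := @ord_pairs (size kv) (pairs (kedge h) (size kv)).
  by move=> [a b]; rewrite mem_pairs => /and3P[ba ak _]; split=> //=; apply: ltn_trans ak.
exists es; pose f (p : 'I_(size kv) * 'I_(size kv)) := (val p.1, val p.2).
have fi : injective f by move=> [a b] [a' b'] [/val_inj-> /val_inj->].
have mE u v : ((u, v) \in es) = (v < u) && kgraph u v.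
  by rewrite -(mem_map fi) E mem_pairs kedgeE ltn_ord.
split.
- split; first by rewrite -(map_inj_uniq fi) E uniq_pairs.
  + by move=> u v; rewrite !mE => /andP[lt _]; rewrite ltnNge ltnW.
  + move=> u v; rewrite !mE (kgraph_simple.1 v u).
    case: (ltngtP u v) => [lt|lt|/val_inj ->] //=; rewrite ?orbF //.
    exact: kgraph_simple.2.
- move=> j; rewrite (s_K Hs) -E size_map /flat -map_comp.
  by [].
Qed.

Lemma kgraph_cvd (S : {set 'I_n}) : is_cvd kgraph (kvert @^-1: S) <-> cvd_on e [set x in kv] S.
Proof.
split=> [/cvdP cS a b c /and4P[ac eab ebc nac]|cS].
  rewrite !in_set => /kvertP[i ei] /kvertP[j ej] /kvertP[k ek]; subst a b c.
  apply/negPn/negP; rewrite !negb_or => /and3P[na nb nc].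
  have ik : i != k by apply: contraNneq ac => ->.
  by move/negP: nac; apply; apply: (cS i j k); rewrite // inE.
apply/cvdP => i j k; rewrite !inE => ni nj nk ik eij ejk; apply/negPn/negP => nik.
have p : path3 e (kvert i) (kvert j) (kvert k) by apply/and4P; split; rewrite ?(inj_eq kvert_inj).
have := cS _ _ _ p; rewrite !in_set !kvert_in (negbTE ni) (negbTE nj) (negbTE nk).
by move=> /(_ isT isT isT).
Qed.

Lemma kgraph_answer (S : {set 'I_(size kv)}) : is_min_cvd kgraph S ->
  is_min_cvd e (kvert @: S :|: [set x in hv]) /\ #|S| <= cvd_number e.
Proof.
move=> [cS mS].
have E : kvert @^-1: (kvert @: S) = S.
  by apply/setP => i; rewrite inE mem_imset //; exact: kvert_inj.
rewrite -(card_imset _ kvert_inj); apply: (s_ok Hs).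
- by apply/subsetP => _ /imsetP[i _ ->]; rewrite inE kvert_in.
- by apply/kgraph_cvd; rewrite E.
- move=> S' /kgraph_cvd cS'; rewrite card_imset; last exact: kvert_inj.
  apply: leq_trans (mS _ cS') _; rewrite -(card_imset _ kvert_inj).
  by apply: subset_leq_card; apply/subsetP => _ /imsetP[i iin ->]; rewrite inE in iin.
Qed.

Lemma kgraph_number : cvd_number kgraph <= cvd_number e.
Proof.
have [S [cS <- mS]] := cvd_numberP kgraph; exact: (proj2 (kgraph_answer (conj cS mS))).
Qed.

Lemma kgraph_size : graph_size kgraph <= size kv + size kv * size kv.
Proof.
have [es [eL _]] := kgraph_edges; apply: leq_trans (edge_list_size eL) _.
rewrite leq_add2l; have [ues nes _] := eL.
rewrite -(card_uniqP ues); apply: leq_trans (max_card _) _.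
by rewrite card_prod card_ord.
Qed.

Lemma kgraph_output (S : {set 'I_(size kv)}) (ys : seq nat) :
  perm_eq ys [seq val x | x <- enum S] ->
  perm_eq ([seq ar h aV 0 y | y <- ys] ++ [seq val x | x <- hv])
          [seq val x | x <- enum (kvert @: S :|: [set x in hv])].
Proof.
move=> py.
have -> : perm_eq ([seq ar h aV 0 y | y <- ys] ++ [seq val x | x <- hv]) =1
          perm_eq [seq val x | x <- [seq kvert x | x <- enum S] ++ hv].
  apply/permPl; rewrite map_cat perm_cat2r; apply: perm_trans (perm_map _ py) _.
  rewrite -!map_comp; apply/permP => p; congr count; apply: eq_map => i /=.
  by rewrite (s_v Hs (kvert i) (ltn_ord i)) -kvert_nth.
apply: perm_map; apply: uniq_perm; rewrite ?enum_uniq //.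
  rewrite cat_uniq (map_inj_uniq kvert_inj) enum_uniq (s_hu Hs) andbT /=.
  apply/hasPn => x xin; apply/negP => /mapP[i _ E].
  by have := s_disj Hs (kvert_in i); rewrite -E xin.
move=> x; rewrite mem_cat mem_enum !in_set; congr (_ || _).
apply/mapP/imsetP => -[i iin ->]; exists i => //; move: iin; rewrite mem_enum //.
Qed.

(** Kernel solution and forced vertices are disjoint, so the list that is copied has length
    [cvd_number e]. This bounds both the time for copying and the space for the answer. *)
Lemma kgraph_total (S : {set 'I_(size kv)}) : is_min_cvd kgraph S -> #|S| + size hv = cvd_number e.
Proof.
move=> mS; have [[cX mX] _] := kgraph_answer mS.
have [Y [cY eY mY]] := cvd_numberP e.
have -> : cvd_number e = #|kvert @: S :|: [set x in hv]|.
  by have l1 := mY _ cX; have l2 := mX _ cY; rewrite eY in l2; apply/eqP; rewrite eqn_leq l1 l2.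
rewrite cardsU (_ : _ :&: _ = set0) ?cards0 ?subn0; last first.
  apply/setP => x; rewrite in_setI in_set0 in_set; apply/negP => /andP[/imsetP[i _ ->]].
  by rewrite (negbTE (s_disj Hs (kvert_in i))).
by rewrite card_imset ?cardsE ?(card_uniqP (s_hu Hs)) //; exact: kvert_inj.
Qed.

End KernelGraph.

(** * The data structure *)

Lemma ewf_mono tau tau' e : tau <= tau' -> ewf tau e -> ewf tau' e.
Proof.
move=> le; elim: e => //= [r lt|o e1 IH1 e2 IH2 /andP[w1 w2]|a e1 IH1 e2 IH2 /and3P[-> w1 w2]].
- exact: leq_trans lt le.
- by rewrite IH1 ?IH2.
- by rewrite IH1 ?IH2.
Qed.

Lemma wf_mono tau tau' p : tau <= tau' -> wf tau p -> wf tau' p.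
Proof.
move=> le; have ew := ewf_mono le; elim: p => //=.
- by move=> r e /andP[lt /ew->]; rewrite (leq_trans lt le).
- by move=> a e1 e2 e3 /and4P[-> /ew-> /ew-> /ew->].
- by move=> e1 e2 /andP[/ew-> /ew->].
- by move=> p IHp q IHq /andP[/IHp-> /IHq->].
- by move=> e p IHp q IHq /and3P[/ew-> /IHp-> /IHq->].
- by move=> e p IHp /andP[/ew-> /IHp->].
Qed.

(** A static algorithm presupposes that its registers are [0], but an earlier query may have left
    values there. How many have to be cleared depends on the algorithm only. *)
Fixpoint zeros (r m : nat) : cmd :=
  match m with
  | 0 => Skip
  | m.+1 => Seq (Const r 0) (zeros r.+1 m)
  end.

Lemma zeros_exec B m r s : exists s', [/\ exec B (zeros r m) s m.+1 s', Defs.mem s' = Defs.mem s &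
  forall x, reg s' x = if r <= x < r + m then 0 else reg s x].
Proof.
elim: m r s => [|m IH] r s /=.
  exists s; split=> //; first exact: ExecSkip.
  by move=> x; case: ifP => //; lia.
have [s' [ex em er]] := IH r.+1 (set_reg s r 0).
exists s'; split.
- by rewrite -[m.+2]add1n; apply: ExecSeq ex; exact: ExecConst.
- by rewrite em.
- move=> x; rewrite er /=; case: (ltngtP r x) => [lt|lt|->] //=; rewrite ?addSnnS //.
  by case: ifP => //; lia.
Qed.

(** Registers from [64] on are left unspecified, because the representation is fixed before the
    static algorithm, which determines how many of them a query uses. The undo log has to be zero
    between operations. *)
Definition repr n (e : rel 'I_n) (s : state) := exists h L,
  [/\ phys 64 h s, bdd (Vn n) h, logb n L, good L h e & forall i j, ar h aL i j = 0].

Lemma good_ext n L h h' (e : rel 'I_n) : good L h e ->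
  all (fun r => rg h' r == rg h r) [:: rN; rP; rX; rE; rW; rH] -> ar h' = ar h -> good L h' e.
Proof.
move=> [xs [kv [hv H]]] /= /and5P[/eqP f1 /eqP f2 /eqP f3 /eqP f4 /andP[/eqP f5 /andP[/eqP f6 _]]] G.
exists xs, kv, hv; case: H => c *; split; rewrite ?f1 ?f2 ?f3 ?f4 ?f5 ?f6 /kedge ?G //.
by case: c => *; split; rewrite ?f1 ?f2 ?f3 ?G.
Qed.

Lemma Vn_obase n : obase n + n <= Vn n.
Proof.
rewrite /Vn /obase (expnD _ 8 2).
apply: (@leq_trans (2 ^ 8 * (n + 2) ^ 2)); first by rewrite -mulnn -[2 ^ 8]/256; nia.
by rewrite leq_mul2r leq_exp2r // addnC leq_addr orbT.
Qed.

Lemma Vn_W n m : (Vn n + 2) ^ m <= (n + 2) ^ (11 * m).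
Proof.
case: m => [|m]; first by rewrite muln0.
rewrite expnM leq_exp2r // /Vn (expnS _ 10).
have : (n + 2) ^ 1 <= (n + 2) ^ 10 by rewrite leq_pexp2l // addn2.
rewrite expn1; move: ((n + 2) ^ 10) => w; nia.
Qed.

Lemma start_run : exists init c, forall n : nat,
  exists (t : nat) (s : state), exec ((n + 2) ^ c) init (init_state n) t s /\ repr (@edgeless 'I_n) s.
Proof.
exists (comp 64 start), (11 * psz start) => n.
have [M [t [h [ex _ [L hL gL]]]]] := start_spec n.
have b0 : bdd (Vn n) (hinit n).
  split=> //= r; case: ifP => // _.
  by have := Vn_obase n; rewrite /obase; lia.
have p0 : phys 64 (hinit n) (init_state n) by [].
have w0 : wf 64 start by [].
have [t' [s' [ex' _ ph]]] := sim_comp ex w0 p0 b0 (Vn_W _ _).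
exists t', s'; split=> //; exists h, L; split=> //; first exact: hexec_bdd ex b0.
by move=> i j; rewrite (proj2 (hexec_frame ex)).
Qed.

(** The cost is of order [k ^ 4 + k ^ 2 * (l + 1)], and both [k ^ 4] and the part of [k ^ 2] that
    comes without the logarithm are absorbed by [k ^ 8]. *)
Lemma ucost_bound : exists C, forall L k l, 0 < k -> L <= l + 1 ->
  (ucost L k).+1 <= C * (k ^ 8 + k ^ 2 * l).
Proof.
(* From [x <= 15 * k] and [x.+1 <= 16 * k] comes [15 * 4 * 16 = 960], and one more for the
   successor. The variable keeps the square of this number from being computed in unary. *)
have [y ey] : exists y, y = 961 by exists 961.
exists (y * y + 2000) => L k l kpos leL.
rewrite /ucost /kcost; set x := 9 * k + 6.
have h1 : x.+2 * (x.+2 * (2 * L + 1).+1) <= 17 * k * (17 * k * (2 * l + 4)).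
  by rewrite leq_mul ?leq_mul // /x; lia.
have h2 : (x * (4 * x.+1)).+1 <= y * (k * k).
  have : x * (4 * x.+1) <= 15 * k * (4 * (16 * k)) by rewrite leq_mul ?leq_mul // /x; lia.
  have : 0 < k * k by rewrite muln_gt0 kpos.
  have -> : 15 * k * (4 * (16 * k)) = 960 * (k * k) by lia.
  by rewrite ey; lia.
have {}h2 := leq_mul h2 h2.
have k28 : k ^ 2 <= k ^ 8 by rewrite leq_pexp2l.
have k48 : k ^ 4 <= k ^ 8 by rewrite leq_pexp2l.
have e4 : y * (k * k) * (y * (k * k)) = y * y * k ^ 4.
  by rewrite mulnACA (expnD k 2 2) -mulnn.
have e2 : 17 * k * (17 * k * (2 * l + 4)) = 578 * (k ^ 2 * l) + 1156 * k ^ 2.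
  by rewrite -mulnn; clear; lia.
rewrite e4 in h2; rewrite e2 in h1.
have k8 : 0 < k ^ 8 by rewrite expn_gt0 kpos.
have h3 : y * y * k ^ 4 <= y * y * k ^ 8 by rewrite leq_mul2l k48 orbT.
apply: leq_ltn_trans (leq_add h1 h2) _.
apply: leq_ltn_trans (leq_add (leqnn _) h3) _.
rewrite mulnDr mulnDl.
move: (y * y) => z.
have : z * k ^ 8 <= z * k ^ 8 + z * (k ^ 2 * l) by rewrite leq_addr.
move: (k ^ 8) (k ^ 4) (k ^ 2) (k ^ 2 * l) k8 k28 (z * _) => a b d c; clear; lia.
Qed.

Lemma update_run (b : bool) : exists p c C, forall n (e e' : rel 'I_n) (u v : 'I_n) s,
  repr e s -> simple_graph e' -> u != v ->
  (forall x y, e' x y = if ((x == u) && (y == v)) || ((x == v) && (y == u)) then b else e x y) ->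
  performs_update c C p u v e e' (@repr n) s.
Proof.
have [D HD] := ucost_bound.
exists (comp 64 (update b)), (11 * psz (update b)), (cc (update b) * (hsz (update b) * D)).
move=> n e e' u v s [h [L [ph bd hL gL hz]]] [esy eirr] uv he.
set h1 := setr (setr h rU u) rV v.
have lv (w : 'I_n) : w <= Vn n by have := Vn_obase n; have := ltn_ord w; rewrite /obase; lia.
have b1 : bdd (Vn n) h1.
  by case: bd => bR bA; split=> // r /=; case: ifP => // _; case: ifP => // _.
have g1 : good L h1 e by apply: good_ext gL _ _; rewrite //= !eqxx.
have p1 : phys 64 h1 (with_args u v s).
  case: ph => f1 f2 f3; split=> // r lr; rewrite /with_args /= /upd.
  by case: ifP => // _; case: ifP => // _; apply: f1.
set k := maxn 1 (maxn (cvd_number e) (cvd_number e')).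
have k1 : cvd_number e <= k by rewrite /k; lia.
have k2 : cvd_number e' <= k by rewrite /k; lia.
have k0 : 0 < k by rewrite /k; lia.
have [t [h2 [ex le g2]]] := update_spec (proj1 hL) (logb_V hL) g1 esy eirr (erefl _) (erefl _) uv he k1 k2.
have w0 : wf 64 (update b) by case: (b).
have [t' [s' [ex' le' ph']]] := sim_comp ex w0 p1 b1 (Vn_W _ _).
exists t', s'; split=> //.
- apply: leq_trans le' _; rewrite -!mulnA leq_mul2l; apply/orP; right.
  apply: leq_trans le _; rewrite leq_mul2l; apply/orP; right.
  exact: HD k0 (logb_log hL).
- exists h2, L; split=> //; first exact: hexec_bdd ex b1.
  move=> i j; rewrite (proj2 (hexec_frame ex)); first exact: hz.
  by case: (b).
Qed.

Lemma kgraph_size_bound : exists K, forall n L h (e : rel 'I_n) xs kv hv,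
  stored L h e xs kv hv -> size kv + size kv * size kv <= K * cvd_number e ^ 4.
Proof.
(* [48 = 3 * 4 * 4]: there are at most [4 * (3 * k).+1 <= 16 * k] kernel vertices for each of the at
   most [3 * k] members of the deletion set, if [k > 0]. *)
have [z ez] : exists z, z = 48 by exists 48.
exists (z * z + z) => n L h e xs kv hv Hs; move: (s_size Hs) (s_xs Hs).
move: (cvd_number e) => k le1 le2; case: (posnP k) => [k0|kpos].
  by move: le2; rewrite k0 muln0 leqn0 => /eqP sx; move: le1; rewrite sx mul0n leqn0 => /eqP->.
have le : size kv <= z * (k * k).
  apply: leq_trans le1 _; apply: (@leq_trans (3 * k * (4 * (4 * k)))).
    by rewrite leq_mul // leq_mul //; lia.
  by rewrite ez; lia.
rewrite mulnDl addnC leq_add //.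
  by apply: leq_trans (leq_mul le le) _; rewrite mulnACA (expnD k 2 2) -mulnn.
apply: leq_trans le _; rewrite leq_mul2l mulnn leq_pexp2l ?orbT //.
Qed.

Lemma query_run A f : static_cvd_algorithm A f -> exists query c' C', forall n (e : rel 'I_n) s,
  simple_graph e -> repr e s -> let k := cvd_number e in
  exists (t : nat) (s' : state), [/\ exec ((n + f (k ^ 5) k + 2) ^ c') query s t s',
    t <= C' * f (k ^ 5) k, answers_cvd e s' & repr e s'].
Proof.
move=> HA; have [c Hc] := HA; have [K HK] := kgraph_size_bound; set F := f (K ^ 5) K.
pose tau := off + maxn 2 (regs_bound A); pose p := Sq (lift A) answer.
exists (Seq (zeros 64 (tau - 64)) (comp tau p)), ((c * (F + 3) + F + 13) * psz p),
  (tau + cc p * (4 * F.+1 + hsz answer * (F + 7))).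
move=> n e s [esy eirr] [h [L [ph bd hL gL hz]]] k.
have [xs [kv [hv Hs]]] := gL.
(* The exponent is large enough for three bounds at once: the words of [A] need at most
   [(w ^ (F + 3)) ^ c], its running time is at most [w ^ (F + 2)], and [Vn n] is at most
   [w ^ 10]. *)
set fk := f (k ^ 5) k; set w := n + fk + 2; set V := w ^ (c * (F + 3) + F + 12).
have fk0 : 0 < fk by exact: static_time_gt0 HA.
have kf : k <= 5 * fk by exact: static_time_lower HA.
have w3 : n + 3 <= w by rewrite /w; lia.
have wexp m m' : m <= m' -> w ^ m <= w ^ m' by move=> le; rewrite leq_pexp2l //; lia.
(* Below [K] the kernel may be larger than [k ^ 5], but then it has bounded size. *)
have [m [k' [lm lk lf]]] : exists m k', [/\ size kv + size kv * size kv <= m, k <= k' &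
    f m k' <= F.+1 * fk /\ f m k' <= F + fk].
  have le := HK _ _ _ _ _ _ _ Hs; case: (leqP K k) => lK.
    exists (k ^ 5), k; split=> //.
      by apply: leq_trans le _; rewrite (expnS _ 4) leq_mul2r lK orbT.
    by rewrite -/fk; split; [rewrite leq_pmull|exact: leq_addl].
  exists (K ^ 5), K; split=> //; last 1 [|].
  - apply: leq_trans le _; rewrite (expnS _ 4) leq_mul2l.
    by case: (posnP K) => [->//|K0]; rewrite leq_exp2r // ltnW ?orbT.
  - exact: ltnW.
  - rewrite -/F; split; last exact: leq_addr.
    by rewrite mulSn; apply: leq_trans (leq_addl _ _); rewrite leq_pmulr.
have [es [eL hes]] := kgraph_edges esy eirr Hs.
have [||tA [sA [exA lA [S [out mS]]]]] := Hc _ _ _ m k' (kgraph_simple kv esy eirr) eL.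
- exact: leq_trans (kgraph_size esy eirr Hs) lm.
- exact: leq_trans (kgraph_number Hs) lk.
have le_kv : size kv <= n by rewrite -[X in _ <= X]card_ord -(card_uniqP (s_u Hs)) max_card.
have leB : (graph_size (@kgraph n e kv) + f m k' + 2) ^ c <= V.
  apply: (@leq_trans ((w ^ (F + 3)) ^ c)).
    case: (c) => // c'; rewrite leq_exp2r //.
    have := kgraph_size esy eirr Hs; have := leq_mul le_kv le_kv.
    have : F.+2 <= w ^ F.+1 by apply: leq_trans (ltn_expl F.+1 (_ : 1 < w)) _ => //; lia.
    rewrite (_ : F + 3 = F.+1 + 2) ?expnD; last by lia.
    move: lf.2 w3 le_kv; rewrite /w -mulnn.
    move: (f m k') (size kv) ((n + fk + 2) ^ F.+1) (graph_size _); clear=> a z x g h1 h2 h3 h4 h5 h6.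
    have h7 : n + n * n + fk + 2 <= (n + fk + 2) * (n + fk + 2) by nia.
    apply: (@leq_trans (F.+2 * ((n + fk + 2) * (n + fk + 2)))); last by rewrite leq_mul2r h4 orbT.
    by move: (_ * (n + fk + 2)) (n * n) h7 h5 => W nn; nia.
  by rewrite -expnM; apply: wexp; lia.
have leV0 : Vn n <= V.
  apply: (@leq_trans (w ^ 10)); last by apply: wexp; lia.
  by rewrite /Vn leq_exp2r //; lia.
have lt_A : tA <= V.
  apply: leq_trans lA (leq_trans lf.1 _); apply: (@leq_trans (w ^ F.+1 * w ^ 1)).
    rewrite leq_mul //; last by rewrite expn1 /w; lia.
    by apply: leq_trans (ltnW (ltn_expl F.+1 (_ : 1 < w))) _ => //; lia.
  by rewrite -expnD; apply: wexp; lia.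
pose h1 := Hst (fun r => if r < 64 then rg h r else 0) (ar h) (rw h).
have b1 : bdd V h1.
  case: bd => bR bA; split=> [r|a i j] /=; last exact: leq_trans (bA _ _ _) leV0.
  by case: ifP => // _; exact: leq_trans (bR _) leV0.
have l1 : lifted h1 h1 (input_state es) [::].
  by split=> // i; rewrite /= hz nth_nil.
have [|t1 [h2 [l [ex1 le1 l2 sz2]]]] := lift_exec exA leB l1 b1; first by rewrite add0n.
have b2 := hexec_bdd ex1 b1.
pose kvs := [seq ar h aV 0 y | y <- [seq Defs.mem sA (reg sA 1 + i) | i <- iota 0 (reg sA 0)]].
pose hs := [seq val x | x <- hv].
have ec : reg sA 0 = #|S| by have := perm_size out; rewrite !size_map size_iota -cardE.
have tot : reg sA 0 + size hs = k by rewrite ec size_map (kgraph_total Hs mS).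
have kn : k <= n by exact: cvd_bound.
have leM : k <= (F + 6) * fk by apply: leq_trans kf _; rewrite leq_mul2r; apply/orP; right; lia.
have lel : size l <= (F + 6) * fk.
  by apply: leq_trans sz2 (leq_trans lA (leq_trans lf.1 _)); rewrite leq_mul2r; apply/orP; right; lia.
have [|||||||||||t2 [h3 [ex2 le2 [a3 r3 u3 v3 w3']]]] := @answer_spec V ((F + 6) * fk) h1 h2 sA l n (reg sA 0) kvs hs l2 hz b2.
- by rewrite /= (c_n (s_core Hs)).
- by [].
- by rewrite /= (s_h Hs) size_map.
- exact: leq_trans (Vn_obase n) leV0.
- by rewrite tot.
- by rewrite tot.
- exact: lel.
- exact: leq_trans sz2 lt_A.
- by rewrite !size_map size_iota.
- by move=> i lt; rewrite /kvs -map_comp (nth_map 0) ?size_iota // nth_iota.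
- move=> i; rewrite size_map => lt.
  have x0 : 'I_n by case: (hv) lt => // x ? _; exact: x.
  by rewrite (nth_map x0) //; exact: s_hv Hs _ _ lt.
have [s1 [ex0 em0 er0]] := zeros_exec (w ^ ((c * (F + 3) + F + 13) * psz p)) (tau - 64) 64 s.
have ph1 : phys tau h1 s1.
  case: ph => f1 f2 f3; split=> [r lr|a i j la|q gq]; rewrite ?em0 ?f2 ?f3 //.
  rewrite er0 /=; case: (ltnP r 64) => [lt|le]; first by rewrite /= f1.
  by rewrite /= subnKC ?lr // /tau; lia.
have wfp : wf tau p.
  apply/andP; split; first by apply: wf_lift; rewrite leq_add2l leq_maxr.
  change (wf tau answer); apply: (@wf_mono 72 tau answer) => //; rewrite /tau; lia.
have hB : (V + 2) ^ psz p <= w ^ ((c * (F + 3) + F + 13) * psz p).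
  case: (psz p) => [|q]; first by rewrite muln0.
  rewrite expnM leq_exp2r // (_ : _ + 13 = (c * (F + 3) + F + 12).+1); last by lia.
  rewrite expnS -/V; have : 1 <= V by apply: leq_trans leV0; rewrite expn_gt0 addn2.
  by clear -w3; move: V => v; nia.
have [t3 [s3 [ex3 le3 ph3]]] := sim_comp (HSq ex1 ex2) wfp ph1 b1 hB.
have [f1 f2 f3] := ph3.
have tau72 : 72 <= tau by rewrite /tau; lia.
exists ((tau - 64).+1 + t3), s3; split.
- exact: ExecSeq ex0 ex3.
- rewrite mulnDl; apply: leq_add.
    by apply: (@leq_trans (tau * 1)); [lia|rewrite leq_mul2l fk0 orbT].
  apply: leq_trans le3 _; rewrite -mulnA leq_mul2l mulnDl; apply/orP; right; apply: leq_add.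
    by apply: leq_trans le1 _; rewrite -mulnA leq_mul2l (leq_trans lA) ?orbT //; exact: lf.1.
  apply: leq_trans le2 _; rewrite -mulnA leq_mul2l; apply/orP; right.
  by rewrite !mulnDl; move: (F * fk) fk0; clear; lia.
- exists (kvert (kv := kv) @: S :|: [set x in hv]); split; last exact: (kgraph_answer Hs mS).1.
  rewrite /outputs !f1; try by lia.
  rewrite u3 v3.
  apply: perm_trans (kgraph_output Hs out); rewrite -/kvs -/hs.
  have so : size (kvs ++ hs) = reg sA 0 + size hs by rewrite size_cat !size_map size_iota.
  rewrite -[X in perm_eq _ X](mkseq_nth 0) so /mkseq.
  rewrite (_ : map _ _ = [seq nth 0 (kvs ++ hs) i | i <- iota 0 (reg sA 0 + size hs)]) //.
  apply/eq_in_map => i; rewrite mem_iota add0n => /= lt.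
  by rewrite f3 ?w3' //; apply: gap_obase; lia.
(* All arrays are as before the query, so this is the old state except for the two answer registers,
   the registers from [64] on, and the raw cells. *)
- pose h4 := Hst (fun r => if r == 0 then k else if r == 1 then obase n else if r < 64 then rg h r else 0)
    (ar h) (rw h3).
  exists h4, L; split=> //.
  + split=> [r lr|a i j la|q gq]; rewrite /= ?f2 ?f3 //.
    rewrite f1; last by lia.
    case: eqP => [->|n0]; first by rewrite u3.
    case: eqP => [->|n1]; first by rewrite v3.
    by rewrite lr r3 /= ?lr //; lia.
  + case: bd => bR bA; split=> // r /=; have := Vn_obase n.
    case: ifP => [_|_]; first by lia.
    case: ifP => [_|_]; first by lia.
    by case: ifP.
  + by apply: good_ext gL _ _ => //=; rewrite !eqxx.
Qed.

Lemma performs_update_mono n c c' C C' p (u v : 'I_n) (e e' : rel 'I_n) rp s :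
  c <= c' -> C <= C' -> performs_update c C p u v e e' rp s -> performs_update c' C' p u v e e' rp s.
Proof.
move=> lc lC [t [s' [ex le r]]]; exists t, s'; split=> //.
  by apply: exec_mono ex; rewrite leq_pexp2l // addn2.
by apply: leq_trans le _; rewrite leq_mul2r lC orbT.
Qed.

Lemma add_edge_simple (T : finType) (e : rel T) u v : simple_graph e -> u != v ->
  simple_graph (add_edge e u v).
Proof.
move=> [esy eirr] uv; split=> [x y|x]; rewrite /add_edge /=.
  by rewrite esy [in RHS]orbC; do 4!case: eqP; rewrite /= ?orbT ?orbF.
rewrite eirr /=; case: (x =P u) => [->|_]; rewrite ?(negbTE uv) //=.
by rewrite andbF.
Qed.

Lemma remove_edge_simple (T : finType) (e : rel T) u v : simple_graph e ->
  simple_graph (remove_edge e u v).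
Proof.
move=> [esy eirr]; split=> [x y|x]; rewrite /remove_edge /=; last by rewrite eirr.
by rewrite esy; case: (e y x) => //=; do 4!case: eqP.
Qed.

Theorem theorem2 :
  exists (init add del : cmd)
         (repr : forall n : nat, rel 'I_n -> state -> Prop)
         (c C : nat),
  [/\ forall n : nat,
        exists (t : nat) (s : state),
          exec ((n + 2) ^ c) init (init_state n) t s /\
          repr n (@edgeless 'I_n) s,
      forall (n : nat) (e : rel 'I_n) (s : state) (u v : 'I_n),
        simple_graph e -> repr n e s -> u != v -> ~~ e u v ->
        performs_update c C add u v e (add_edge e u v) (repr n) s,
      forall (n : nat) (e : rel 'I_n) (s : state) (u v : 'I_n),
        simple_graph e -> repr n e s -> e u v ->
        performs_update c C del u v e (remove_edge e u v) (repr n) s &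
      forall (A : cmd) (f : nat -> nat -> nat),
        static_cvd_algorithm A f ->
        exists (query : cmd) (c' C' : nat),
        forall (n : nat) (e : rel 'I_n) (s : state),
          simple_graph e -> repr n e s ->
          let k := cvd_number e in
          exists (t : nat) (s' : state),
            [/\ exec ((n + f (k ^ 5) k + 2) ^ c') query s t s',
                t <= C' * f (k ^ 5) k,
                answers_cvd e s' &
                repr n e s']].
Proof.
have [init [c0 Hi]] := start_run.
have [add [c1 [C1 Ha]]] := update_run true.
have [del [c2 [C2 Hd]]] := update_run false.
exists init, add, del, (fun n => @repr n), (maxn c0 (maxn c1 c2)), (maxn C1 C2).
split.
- move=> n; have [t [s [ex r]]] := Hi n; exists t, s; split=> //.
  by apply: exec_mono ex; rewrite leq_pexp2l ?addn2 ?leq_maxl.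
- move=> n e s u v sg r uv _.
  apply: (@performs_update_mono n c1 _ C1); rewrite ?leq_max ?leqnn ?orbT //.
  apply: Ha r (add_edge_simple sg uv) uv _ => x y.
  by rewrite /add_edge /=; case: ifP => _; rewrite ?orbT ?orbF.
- move=> n e s u v sg r uv.
  have ne : u != v by apply: contraTneq uv => ->; rewrite sg.2.
  apply: (@performs_update_mono n c2 _ C2); rewrite ?leq_max ?leqnn ?orbT //.
  apply: Hd r (remove_edge_simple u v sg) ne _ => x y.
  by rewrite /remove_edge /= -negb_or; case: ifP => _; rewrite ?andbF ?andbT.
- exact: query_run.
Qed.
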